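(* Let $G$ be a locally compact, compactly generated group, let $S$ be a compact generating set of $G$ which is a symmetric neighbourhood of the identity, with word length $|\cdot|_S$, and let $\mathcal{X}$ be a class of metric spaces for which $G$ does not have property $F\mathcal{X}$. Let $2 \le p < \infty$ and $c > 0$. Suppose that one of the following conditions holds. (1) The group $G$ is discrete and $\mathcal{X}$ is any class of $(p,c)$-uniformly convex metric spaces that is stable under scaling and ultraproducts. (2) $\mathcal{X}$ is any class of $(p,c)$-uniformly convex Banach spaces that is stable under scaling, ultraproducts and smoothing. Then there exist a space $(F,d) \in \mathcal{X}$, a continuous isometric action $\sigma : G \to \mathrm{Isom}(F)$ and a basepoint $v \in F$ such that $\sup_{|g|_S \le 1} d(\sigma(g)v, v) > 0$ and, for all $n \ge 1$, $$\sup_{|g|_S \le n} d(\sigma(g)v, v) \;\ge\; \left( \frac12 \big(c(n-1)+1\big)^{\frac1p} - 2 \right) \sup_{|g|_S \le 1} d(\sigma(g)v, v).$$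
   Context: Word length: $|g|_S = \min\{ n \in \mathbb{N} : g \in S^n\}$. Uniquely geodesic: a complete metric space $(E,d)$ is uniquely geodesic if any two points $x,y$ are joined by a unique path $\gamma:[0,1]\to E$ with $d(\gamma(s),\gamma(t)) = |s-t|\, d(x,y)$ for all $s,t$. $(p,c)$-uniformly convex: a uniquely geodesic complete metric space $(E,d)$ such that for all $x_0,x_1,z \in E$ and $t \in [0,1]$, $$d(z,x_t)^p \le (1-t)\, d(z,x_0)^p + t\, d(z,x_1)^p - c\,t(1-t)\, d(x_0,x_1)^p,$$ where $t\mapsto x_t$ is the linear parametrization of the geodesic from $x_0$ to $x_1$. A (real) Banach space is $(p,c)$-uniformly convex if it is so for its norm distance. Property $F\mathcal{X}$: every continuous isometric action of $G$ on any metric space $X \in \mathcal{X}$ has a fixed point. Fix a non-principal ultrafilter $\mathcal{U}$ on $\mathbb{N}$. Stable under scaling: $(E,d)\in\mathcal{X}$ and $t>0$ imply $(E,td)\in\mathcal{X}$. Ultraproducts: for pointed metric spaces $(E_i,d_i,v_i)_{i\in\mathbb{N}}$, $\prod_{\mathcal U}E_i$ is the set of sequences $(x_i)\in\prod_i E_i$ with $d_i(v_i,x_i)$ bounded, modulo $(x_i)\sim(y_i)$ iff $\lim_{\mathcal U}d_i(x_i,y_i)=0$, with metric $d_{\mathcal U}([x_i],[y_i])=\lim_{\mathcal U}d_i(x_i,y_i)$. For Banach spaces one takes $v_i=0$. $\mathcal{X}$ is stable under ultraproducts if for every sequence $(E_i,d_i)\in\mathcal{X}$ (with any choice of basepoints),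 $(\prod_{\mathcal U}E_i,d_{\mathcal U})\in\mathcal{X}$. Smoothing (for classes of Banach spaces): let $\pi_i : G\to\mathcal{O}(E_i)$ be strongly continuous representations by linear isometries on Banach spaces $E_i$, $i \in \mathbb{N}$. For $f\in C_c(G)$ put $\pi_i(f)x=\int_G f(g)\pi_i(g)x\,dm_G(g)$ ($m_G$ a Haar measure) and let $\pi(f)$ act on $\prod_{\mathcal U}E_i$ by $\pi(f)[(x_i)_i]=[(\pi_i(f)x_i)_i]$. Let $E_{\mathcal U}$ be the closed linear span in $\prod_{\mathcal U}E_i$ of $\{\pi(f)x : x\in\prod_{\mathcal U}E_i,\ f\in C_c(G)\}$. $\mathcal{X}$ is stable under smoothing if for every sequence of strongly continuous isometric representations $\pi_i$ of $G$ on spaces $E_i\in\mathcal{X}$, one has $E_{\mathcal U}\in\mathcal{X}$. *)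

(* Defs.v *)
From HB Require Import structures.
From mathcomp Require Import all_boot all_order all_algebra.
From mathcomp Require Import all_classical all_reals all_analysis.
From mathcomp Require Import generic_quotient lra.

Set Implicit Arguments.
Unset Strict Implicit.
Unset Printing Implicit Defensive.

Import Order.TTheory GRing.Theory Num.Theory.
Import numFieldNormedType.Exports.

Local Open Scope classical_set_scope.
Local Open Scope quotient_scope.
Local Open Scope ring_scope.

HB.mixin Record isTopologicalGroup G & Group G & Topological G := {
  mulg_continuous : continuous (fun x : G * G => (x.1 * x.2)%g) ;
  invg_continuous : continuous (fun x : G => (x^-1)%g) }.

#[short(type="topologicalGroupType")]
HB.structure Definition TopologicalGroup :=
  {G of Group G & Topological G & isTopologicalGroup G}.

Section groups.
Context {G : topologicalGroupType}.
Implicit Types (S : set G) (g : G).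

Definition symmetric_set S := forall g, S g -> S (g^-1)%g.

Definition generates S := forall H : set G,
  H 1%g -> (forall x y, H x -> H y -> H (x * y)%g) ->
  (forall x, H x -> H (x^-1)%g) -> S `<=` H -> H = setT.

Fixpoint set_pow S (n : nat) : set G :=
  if n is m.+1 then [set (x * y)%g | x in set_pow S m & y in S]
  else [set 1%g].

(* Takes the junk value 0 on elements that lie in no S^n. *)
Definition word_length S g : nat :=
  xget 0%N [set n | set_pow S n g /\ forall m, set_pow S m g -> (n <= m)%N].

End groups.

Section actions.
Context {R : realType} (G : topologicalGroupType).

Record continuous_isometric_action (E : metricType R) (s : G -> E -> E) :
  Prop := ContinuousIsometricAction {
    action1 : forall x, s 1%g x = x ;
    actionM : forall g h x, s (g * h)%g x = s g (s h x) ;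
    action_isometry : forall g x y, mdist (s g x) (s g y) = mdist x y ;
    action_continuous : continuous (fun gx : G * E => s gx.1 gx.2) }.

(* Metric spaces are nonempty by convention; the action on the empty space,
   which has no fixed point, is therefore not considered. *)
Definition property_F (X : metricType R -> Prop) :=
  forall (E : metricType R) (s : G -> E -> E), X E -> inhabited E ->
    continuous_isometric_action s -> exists x, forall g, s g x = x.

Definition displacement (S : set G) (E : metricType R) (s : G -> E -> E)
    (v : E) (n : nat) : R :=
  sup [set mdist (s g v) v | g in [set g | (word_length S g <= n)%N]].

End actions.

Section uniform_convexity.
Context {R : realType}.

Definition complete_metric (E : metricType R) :=
  forall F : set_system E, ProperFilter F -> cauchy F -> exists x : E, F --> x.

(* Only the values of the path on [0, 1] are relevant. *)
Definition geodesic (E : metricType R) (x y : E) (gamma : R -> E) :=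
  [/\ gamma 0 = x, gamma 1 = y &
      forall s t, s \in `[0, 1] -> t \in `[0, 1] ->
        mdist (gamma s) (gamma t) = `|s - t| * mdist x y].

Definition uniquely_geodesic (E : metricType R) :=
  complete_metric E /\
  forall x y : E, exists2 gamma, geodesic x y gamma &
    forall gamma', geodesic x y gamma' -> {in `[0, 1], gamma' =1 gamma}.

Definition uniformly_convex (p c : R) (E : metricType R) :=
  uniquely_geodesic E /\
  forall (x0 x1 z : E) (gamma : R -> E) (t : R),
    geodesic x0 x1 gamma -> t \in `[0, 1] ->
    mdist z (gamma t) `^ p <=
      (1 - t) * mdist z x0 `^ p + t * mdist z x1 `^ p
      - c * t * (1 - t) * mdist x0 x1 `^ p.

End uniform_convexity.

Section normed_metric.
Context {R : realType}.

Definition normed_metric (E : normedModType R) : Type := E.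

Variable E : normedModType R.

Let dist (x y : E) : R := `|x - y|.

Let dist_ge0 x y : 0 <= dist x y. Proof. exact: normr_ge0. Qed.

Let dist_positivity x y : dist x y = 0 -> x = y.
Proof. by move/normr0_eq0/eqP; rewrite subr_eq0 => /eqP. Qed.

Let ballEdist (x : E) d : ball x d = [set y | dist x y < d].
Proof. by rewrite -ball_normE. Qed.

HB.instance Definition _ := PseudoMetric.copy (normed_metric E) E.
HB.instance Definition _ := @PseudoMetric_isMetric.Build R (normed_metric E)
  dist dist_ge0 dist_positivity ballEdist.

End normed_metric.

Definition metric_class (R : realType) (B : completeNormedModType R -> Prop) :
    metricType R -> Prop :=
  fun M => exists2 E : completeNormedModType R,
    B E & M = normed_metric E :> metricType R.

Section scaled_metric.
Context {R : realType}.

Definition scaled_metric (t : {posnum R}) (E : metricType R) : Type := E.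

Variables (t : {posnum R}) (E : metricType R).

Let dist (x y : E) : R := t%:num * mdist x y.

Let distxx x : dist x x = 0. Proof. by rewrite /dist mdistxx mulr0. Qed.

Let dist_positivity x y : dist x y = 0 -> x = y.
Proof.
by move/eqP; rewrite mulf_eq0 gt_eqF//= => /eqP; exact: mdist_positivity.
Qed.

Let dist_sym x y : dist x y = dist y x.
Proof. by rewrite /dist metric_sym. Qed.

Let dist_triangle y x z : dist x z <= dist x y + dist y z.
Proof. by rewrite /dist -mulrDr ler_pM2l// metric_triangle. Qed.

HB.instance Definition _ := Choice.copy (scaled_metric t E) E.
HB.instance Definition _ := @isMetric.Build R (scaled_metric t E)
  dist distxx dist_positivity dist_sym dist_triangle.

End scaled_metric.

Section scaled_banach.
Context {R : realType}.

Definition scaled_banach (t : {posnum R}) (E : completeNormedModType R) : Type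
  := E.

Variables (t : {posnum R}) (E : completeNormedModType R).

Let nrm (x : E) : R := t%:num * `|x|.

Let nrmD x y : nrm (x + y) <= nrm x + nrm y.
Proof. by rewrite /nrm -mulrDr ler_pM2l// ler_normD. Qed.

Let nrmZ (l : R) x : nrm (l *: x) = `|l| * nrm x.
Proof. by rewrite /nrm normrZ mulrCA. Qed.

Let nrm0_eq0 x : nrm x = 0 -> x = 0.
Proof. by move/eqP; rewrite mulf_eq0 gt_eqF//= normr_eq0 => /eqP. Qed.

HB.instance Definition _ := GRing.Lmodule.copy (scaled_banach t E) E.
HB.instance Definition _ := @Lmodule_isNormed.Build R (scaled_banach t E)
  nrm nrmD nrmZ nrm0_eq0.

Let ball_scaled (x : scaled_banach t E) (e : R) :
  ball x e = @ball R E x (e / t%:num).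
Proof.
rewrite -!ball_normE; apply/seteqP; split=> y /=;
by rewrite ltr_pdivlMr// mulrC.
Qed.

Let scaled_complete (F : set_system (scaled_banach t E)) :
  ProperFilter F -> cauchy F -> cvg F.
Proof.
move=> FF /cauchy_ballP Fc.
have /cauchy_cvgP/cvg_ex[l Fl] : @cauchy E F.
  apply/cauchy_ballP => e e0.
  have /Fc : 0 < t%:num * e by rewrite mulr_gt0.
  apply: filterS => -[x y] /=.
  by rewrite ball_scaled mulrAC divff// mul1r.
apply/cvg_ex; exists l; apply/cvg_ballP => e e0.
move/cvg_ballP : Fl => /(_ (e / t%:num)); rewrite divr_gt0// => /(_ isT).
by apply: filterS => x; rewrite ball_scaled.
Qed.

HB.instance Definition _ := Uniform_isComplete.Build (scaled_banach t E)
  scaled_complete.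

End scaled_banach.

Record free_ultrafilter := FreeUltrafilter {
  ultra_set :> set_system nat ;
  ultra_ultra : UltraFilter ultra_set ;
  ultra_free : forall n, ultra_set <> principal_filter n }.

#[global] Instance free_ultrafilter_proper (U : free_ultrafilter) :
  ProperFilter (ultra_set U) := @ultra_proper _ _ (ultra_ultra U).

Lemma ultra_cvg (R : realType) (U : free_ultrafilter) (a : nat -> R) (M : R) :
  (forall i, `|a i| <= M) -> cvg (a @ ultra_set U).
Proof.
move=> aM; have UU : UltraFilter (a @ ultra_set U).
  split=> [|F FF aF]; first exact: fmap_proper_filter.
  apply/seteqP; split=> [A FA|]; last exact: aF.
  case: (in_ultra_setVsetC (a @^-1` A) (ultra_ultra U)) => // UA.
  have /aF FC : (a @ ultra_set U) (~` A) by [].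
  by have [x []] := filter_ex (filterI FA FC).
have := @segment_compact R (- M) M; rewrite compact_ultra => /(_ _ UU)[].
  by apply: (@filterE _ (ultra_set U)) => i; rewrite /= in_itv/= -ler_norml.
by move=> l [_ al]; apply/cvg_ex; exists l.
Qed.

Lemma ultra_tail (U : free_ultrafilter) (n : nat) : ultra_set U [set i | (n <= i)%N].
Proof.
elim: n => [|n IH]; first exact: filterE.
case: (in_ultra_setVsetC [set n] (ultra_ultra U)) => Un; last first.
  apply: filterS (filterI IH Un) => i /= [ni /eqP ne].
  by rewrite ltn_neqAle eq_sym ne.
exfalso; apply: (@ultra_free U n).
apply: (@max_filter _ _ (principal_filter_ultra n)) => // A /principal_filterP An.
by apply: filterS Un => _ ->.
Qed.

Section metric_ultraproduct.
Context {R : realType} (U : free_ultrafilter).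

Record bounded_seq (E : nat -> metricType R) (v : forall i, E i) := BoundedSeq {
  bounded_seq_val :> forall i, E i ;
  bounded_seqP : exists M : R, forall i, mdist (v i) (bounded_seq_val i) <= M }.

HB.instance Definition _ E v := gen_eqMixin (@bounded_seq E v).
HB.instance Definition _ E v := gen_choiceMixin (@bounded_seq E v).

Variables (E : nat -> metricType R) (v : forall i, E i).
Implicit Types x y z : bounded_seq v.

Definition ultra_equiv x y : bool :=
  `[< (fun i => mdist (x i) (y i)) @ ultra_set U --> (0 : R) >].

Lemma bounded_seq_dist x y : exists M, forall i, `|mdist (x i) (y i)| <= M.
Proof.
have [[M xM] [N yN]] := (bounded_seqP x, bounded_seqP y).
exists (M + N) => i; rewrite ger0_norm ?mdist_ge0//.
by rewrite (le_trans (metric_triangle _ (v i) _))// lerD// metric_sym.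
Qed.

Lemma ultra_dist_cvg x y : cvg ((fun i => mdist (x i) (y i)) @ ultra_set U).
Proof. by have [M /ultra_cvg] := bounded_seq_dist x y; exact. Qed.

Lemma ultra_equiv_refl : reflexive ultra_equiv.
Proof.
move=> x; apply/asboolP; under eq_cvg do rewrite mdistxx; exact: cvg_cst.
Qed.

Lemma ultra_equiv_sym : symmetric ultra_equiv.
Proof. by move=> x y; congr asbool; under eq_fun do rewrite metric_sym. Qed.

Lemma ultra_equiv_trans : transitive ultra_equiv.
Proof.
move=> y x z /asboolP xy; move=> /asboolP yz; apply/asboolP.
apply: (@squeeze_cvgr _ _ _ _ (fun=> 0)
  (fun i => mdist (x i) (y i) + mdist (y i) (z i))).
- by apply: nearW => i; rewrite mdist_ge0 metric_triangle.
- exact: cvg_cst.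
- rewrite -[0](addr0 0); exact: cvgD.
Qed.

Canonical ultra_equiv_rel :=
  EquivRel ultra_equiv ultra_equiv_refl ultra_equiv_sym ultra_equiv_trans.

Definition ultraproduct : Type := {eq_quot ultra_equiv_rel}.

HB.instance Definition _ := Choice.copy ultraproduct {eq_quot ultra_equiv_rel}.

Definition ultra_class x : ultraproduct := \pi_({eq_quot ultra_equiv_rel}) x.
Definition ultra_repr (a : ultraproduct) : bounded_seq v :=
  repr (a : {eq_quot ultra_equiv_rel}).

Lemma ultra_reprK a : ultra_class (ultra_repr a) = a.
Proof. exact: (@reprK _ {eq_quot ultra_equiv_rel}). Qed.

Lemma ultra_classP x y :
  ultra_class x = ultra_class y <->
  (fun i => mdist (x i) (y i)) @ ultra_set U --> (0 : R).
Proof.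
split=> [/eqmodP/asboolP//|xy]; by apply/eqmodP/asboolP.
Qed.

Lemma ultra_repr_class x :
  (fun i => mdist (ultra_repr (ultra_class x) i) (x i)) @ ultra_set U --> (0 : R).
Proof. by apply/ultra_classP; rewrite ultra_reprK. Qed.

Definition ultra_dist (a b : ultraproduct) : R :=
  lim ((fun i => mdist (ultra_repr a i) (ultra_repr b i)) @ ultra_set U).

Lemma ultra_distE x y : ultra_dist (ultra_class x) (ultra_class y) =
  lim ((fun i => mdist (x i) (y i)) @ ultra_set U).
Proof.
apply: cvg_lim => //.
set x' := ultra_repr _; set y' := ultra_repr _.
have h : (fun i => mdist (x' i) (x i) + mdist (y' i) (y i)) @ ultra_set U --> (0 : R).
  rewrite -[0](addr0 0); apply: cvgD; exact: ultra_repr_class.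
have xy := @ultra_dist_cvg x y.
set d := fun i => _; set f := fun i => mdist (x i) (y i) in xy *.
rewrite -[d](subrK f) -[lim _]add0r; apply: cvgD => //.
apply/norm_cvg0P.
apply: (@squeeze_cvgr _ _ _ _ (fun=> 0) _ _ _ _ _ h); last exact: cvg_cst.
apply: nearW => i; rewrite /= normr_ge0/= /d /f !fctE ler_norml.
have t1 := metric_triangle (x' i) (x i) (y' i).
have t2 := metric_triangle (x i) (y i) (y' i).
have t3 := metric_triangle (x i) (x' i) (y i).
have t4 := metric_triangle (x' i) (y' i) (y i).
rewrite (metric_sym (y i)) in t2; rewrite (metric_sym (x i) (x' i)) in t3.
by apply/andP; split; lra.
Qed.

Let dist_cvg (a b : ultraproduct) :
  (fun i => mdist (ultra_repr a i) (ultra_repr b i)) @ ultra_set U --> ultra_dist a b.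
Proof. exact: ultra_dist_cvg. Qed.

Let distxx a : ultra_dist a a = 0.
Proof.
by apply: cvg_lim => //; under eq_cvg do rewrite mdistxx; exact: cvg_cst.
Qed.

Let dist_positivity a b : ultra_dist a b = 0 -> a = b.
Proof.
move=> ab; rewrite -(ultra_reprK a) -(ultra_reprK b); apply/ultra_classP.
by rewrite -ab.
Qed.

Let dist_sym a b : ultra_dist a b = ultra_dist b a.
Proof. by rewrite /ultra_dist; under eq_fun do rewrite metric_sym. Qed.

Let dist_triangle b a c : ultra_dist a c <= ultra_dist a b + ultra_dist b c.
Proof.
apply: (ler_cvg_to (@dist_cvg a c) (cvgD (@dist_cvg a b) (@dist_cvg b c))).
by apply: nearW => i; rewrite metric_triangle.
Qed.

HB.instance Definition _ := @isMetric.Build R ultraproduct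
  ultra_dist distxx dist_positivity dist_sym dist_triangle.

End metric_ultraproduct.

Section ultraproduct_complete.
Context {R : realType} (U : free_ultrafilter).
Variables (E : nat -> metricType R) (v : forall i, E i).

Lemma ultraproduct_complete : complete_metric (ultraproduct U v).
Proof.
move=> F FF Fc.
pose e (k : nat) : R := k.+1%:R^-1.
have e_gt0 k : 0 < e k by rewrite invr_gt0.
have e_le k n : (k <= n)%N -> e n <= e k.
  by move=> kn; rewrite lef_pV2 ?posrE// ler_nat.
have /choice[a Fa] : forall k, exists a, F (ball a (e k)).
  by move=> k; apply: (cauchyP F).1 => //; exact: e_gt0.
have a_dist k n : mdist (a k) (a n) < e k + e n.
  have [c []] := filter_ex (filterI (Fa k) (Fa n)).
  rewrite !ballEmdist/= => ac; rewrite metric_sym => ca.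
  exact: le_lt_trans (metric_triangle _ c _) (ltrD ac ca).
pose x k := ultra_repr (a k).
pose A n : set nat := [set i | forall k, (k <= n)%N ->
  mdist (x k i) (x n i) <= e k + e n].
have UA n : ultra_set U (A n).
  have : forall m, (m <= n)%N -> ultra_set U [set i | forall k, (k <= m)%N ->
      mdist (x k i) (x n i) <= e k + e n].
    have near k : ultra_set U [set i | mdist (x k i) (x n i) <= e k + e n].
      have := @ultra_dist_cvg _ U _ _ (x k) (x n).
      move/cvgr_le; apply; exact: a_dist.
    elim=> [_|m IH mn].
      by apply: filterS (near 0%N) => i /= h k; rewrite leqn0 => /eqP ->.
    apply: filterS (filterI (IH (ltnW mn)) (near m.+1)) => i [/= h1 h2] k.
    by rewrite leq_eqVlt => /predU1P[->//|]; exact: h1.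
  exact.
have /choice[m mP] : forall i, exists m, [/\ A m i, (m <= i)%N &
    forall n, A n i -> (n <= i)%N -> (n <= m)%N].
  move=> i; pose P n := (n <= i)%N && `[< A n i >].
  have P0 : exists n, P n.
    exists 0%N; apply/andP; split=> //; apply/asboolP => k.
    by rewrite leqn0 => /eqP ->; rewrite mdistxx addr_ge0// ltW.
  have Pi n : P n -> (n <= i)%N by case/andP.
  case: (ex_maxnP P0 Pi) => m /andP[mi /asboolP Am] mmax.
  by exists m; split=> // n An ni; apply: mmax; rewrite /P ni; exact/asboolP.
have yx k i : A k i -> (k <= i)%N -> mdist (x k i) (x (m i) i) <= e k + e k.
  have [Am mi mmax] := mP i => Aki ki; have km := mmax _ Aki ki.
  by rewrite (le_trans (Am _ km))// lerD2l e_le.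
have A0 i : A 0%N i.
  by move=> k; rewrite leqn0 => /eqP ->; rewrite mdistxx addr_ge0// ltW.
have y_bounded : exists M : R, forall i, mdist (v i) (x (m i) i) <= M.
  have [M xM] := bounded_seqP (x 0%N); exists (M + (e 0%N + e 0%N)) => i.
  by rewrite (le_trans (metric_triangle _ (x 0%N i) _))// lerD// yx.
pose y := BoundedSeq y_bounded.
have ya k : mdist (ultra_class U y) (a k) <= e k + e k.
  rewrite -(ultra_reprK (a k)) [mdist _ _]ultra_distE.
  apply: limr_le; first exact: ultra_dist_cvg.
  apply: filterS (filterI (UA k) (ultra_tail U k)) => i [Aki ki].
  by rewrite metric_sym yx.
exists (ultra_class U y); apply/cvg_ballP => d d0.
have [k ke] : exists k, e k < d / 3%:R.
  have d3 : 0 < d / 3%:R by rewrite divr_gt0.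
  exact: filter_ex (near_infty_natSinv_lt (PosNum d3)).
apply: filterS (Fa k) => c; rewrite !ballEmdist/= => ac.
apply: le_lt_trans (metric_triangle _ (a k) _) _.
have := ya k; move: ke ac; rewrite -/(e k); lra.
Qed.

End ultraproduct_complete.

Section banach_ultraproduct.
Context {R : realType} (U : free_ultrafilter).
Variable (E : nat -> completeNormedModType R).

Definition banach_seq : Type :=
  @bounded_seq R (fun i => normed_metric (E i)) (fun i => (0 : E i)).

Definition banach_seq_val (x : banach_seq) (i : nat) : E i :=
  bounded_seq_val x i.

Definition banach_ultraproduct : Type :=
  @ultraproduct R U (fun i => normed_metric (E i)) (fun i => (0 : E i)).

Definition banach_class (x : banach_seq) : banach_ultraproduct :=
  ultra_class U x.

Local Notation val := banach_seq_val.
Local Notation cls := banach_class.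
Implicit Types (x y z : banach_seq) (a b c : banach_ultraproduct).

Let rep a : banach_seq := ultra_repr a.

Let repK a : cls (rep a) = a. Proof. exact: ultra_reprK. Qed.

Lemma banach_seqP x : exists M, forall i, `|val x i| <= M.
Proof.
by have [M xM] := bounded_seqP x; exists M => i; rewrite -normrN -sub0r xM.
Qed.

Lemma banach_classP x y :
  cls x = cls y <-> (fun i => `|val x i - val y i|) @ ultra_set U --> (0 : R).
Proof. exact: ultra_classP. Qed.

Let mkP (f : forall i, E i) : (exists M, forall i, `|f i| <= M) ->
  exists M : R, forall i, @mdist R (normed_metric (E i)) (0 : E i) (f i) <= M.
Proof.
by move=> [M fM]; exists M => i; rewrite (_ : mdist _ _ = `|f i|)//
  [LHS]/mdist/= sub0r normrN.
Qed.

Lemma banach_addP x y : exists M, forall i, `|val x i + val y i| <= M.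
Proof.
have [[M xM] [N yN]] := (banach_seqP x, banach_seqP y); exists (M + N) => i.
by rewrite (le_trans (ler_normD _ _))// lerD.
Qed.

Lemma banach_scaleP (l : R) x : exists M, forall i, `|l *: val x i| <= M.
Proof.
have [M xM] := banach_seqP x; exists (`|l| * M) => i.
by rewrite normrZ ler_wpM2l // xM.
Qed.

Lemma banach_zeroP : exists M : R, forall i, `|0 : E i| <= M.
Proof. by exists 0 => i; rewrite normr0. Qed.

Definition banach_zero : banach_seq := BoundedSeq (mkP banach_zeroP).
Definition banach_add x y : banach_seq := BoundedSeq (mkP (banach_addP x y)).
Definition banach_scale (l : R) x : banach_seq :=
  BoundedSeq (mkP (banach_scaleP l x)).

Let add a b : banach_ultraproduct := cls (banach_add (rep a) (rep b)).
Let scale (l : R) a : banach_ultraproduct := cls (banach_scale l (rep a)).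
Let zero : banach_ultraproduct := cls banach_zero.
Let opp a : banach_ultraproduct := scale (-1) a.

Let repc x : (fun i => `|val (rep (cls x)) i - val x i|) @ ultra_set U -->
  (0 : R).
Proof. by apply/banach_classP; rewrite repK. Qed.

Let addE x y : add (cls x) (cls y) = cls (banach_add x y).
Proof.
apply/banach_classP.
apply: (@squeeze_cvgr _ _ _ _ (fun=> 0) (fun i =>
  `|val (rep (cls x)) i - val x i| + `|val (rep (cls y)) i - val y i|)).
- by apply: nearW => i; rewrite normr_ge0/= opprD addrACA ler_normD.
- exact: cvg_cst.
- by rewrite -[0](addr0 0); apply: cvgD; exact: repc.
Qed.

Let scaleE l x : scale l (cls x) = cls (banach_scale l x).
Proof.
apply/banach_classP.
have -> : (fun i => `|val (banach_scale l (rep (cls x))) i -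
    val (banach_scale l x) i|) =
    (fun i => `|l| * `|val (rep (cls x)) i - val x i|).
  by apply/funext => i; rewrite -normrZ scalerBr.
by rewrite -(mulr0 `|l|); apply: cvgMl_tmp; exact: repc.
Qed.

Let cls_eq x y : (forall i, val x i = val y i) -> cls x = cls y.
Proof.
move=> xy; apply/banach_classP; rewrite (_ : (fun i => _) = fun=> 0).
  exact: cvg_cst.
by apply/funext => i; rewrite xy subrr normr0.
Qed.

Let addA : associative add.
Proof.
move=> a b c; rewrite -(repK a) -(repK b) -(repK c) !addE.
by apply: cls_eq => i; exact: addrA.
Qed.

Let addC : commutative add.
Proof.
move=> a b; rewrite -(repK a) -(repK b) !addE.
by apply: cls_eq => i; exact: addrC.
Qed.

Let add0 : left_id zero add.
Proof.
by move=> a; rewrite -(repK a) addE; apply: cls_eq => i; exact: add0r.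
Qed.

Let addN : left_inverse zero opp add.
Proof.
move=> a; rewrite -(repK a) /opp scaleE addE; apply: cls_eq => i.
by rewrite /= scaleN1r addNr.
Qed.

HB.instance Definition _ := Choice.on banach_ultraproduct.
HB.instance Definition _ := @GRing.isZmodule.Build banach_ultraproduct
  zero opp add addA addC add0 addN.

Let scaleA (k l : R) a : scale k (scale l a) = scale (k * l) a.
Proof.
rewrite -(repK a) !scaleE; apply: cls_eq => i; exact: scalerA.
Qed.

Let scale1 : left_id 1 scale.
Proof.
by move=> a; rewrite -(repK a) scaleE; apply: cls_eq => i; exact: scale1r.
Qed.

Let scaleDr : right_distributive scale +%R.
Proof.
move=> l a b; rewrite -(repK a) -(repK b) [_ + _]addE !scaleE [RHS]addE.
by apply: cls_eq => i; exact: scalerDr.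
Qed.

Let scaleDl a : {morph scale^~ a : k l / k + l}.
Proof.
move=> k l; rewrite -(repK a) !scaleE [RHS]addE.
by apply: cls_eq => i; exact: scalerDl.
Qed.

HB.instance Definition _ :=
  @GRing.Zmodule_isLmodule.Build R banach_ultraproduct
    scale scaleA scale1 scaleDr scaleDl.

Lemma banach_classD x y : cls x + cls y = cls (banach_add x y).
Proof. exact: addE. Qed.

Lemma banach_classZ (l : R) x : l *: cls x = cls (banach_scale l x).
Proof. exact: scaleE. Qed.

Definition banach_ultra_norm a : R :=
  @ultra_dist R U _ _ (0 : banach_ultraproduct) a.

Lemma banach_ultra_normE x :
  banach_ultra_norm (cls x) = lim ((fun i => `|val x i|) @ ultra_set U).
Proof.
rewrite [LHS](@ultra_distE _ U) (_ : (fun i => mdist _ _) = fun i => `|val x i|)//.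
by apply/funext => i; rewrite [LHS]/mdist/= sub0r normrN.
Qed.

Let norm_cvg x :
  (fun i => `|val x i|) @ ultra_set U --> banach_ultra_norm (cls x).
Proof.
rewrite banach_ultra_normE; have [M xM] := banach_seqP x.
by apply: (@ultra_cvg _ U _ M) => i; rewrite normr_id.
Qed.

Let normD a b :
  banach_ultra_norm (a + b) <= banach_ultra_norm a + banach_ultra_norm b.
Proof.
rewrite -(repK a) -(repK b) banach_classD.
have : (fun i => `|val (rep a) i| + `|val (rep b) i|) @ ultra_set U -->
    banach_ultra_norm (cls (rep a)) + banach_ultra_norm (cls (rep b)).
  by apply: cvgD; exact: norm_cvg.
move=> h; apply: (ler_cvg_to (@norm_cvg (banach_add (rep a) (rep b))) h).
by apply: nearW => i; exact: ler_normD.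
Qed.

Let normZ (l : R) a : banach_ultra_norm (l *: a) = `|l| * banach_ultra_norm a.
Proof.
rewrite -(repK a) banach_classZ banach_ultra_normE; apply: cvg_lim => //.
rewrite (_ : (fun i => _) = fun i => `|l| * `|val (rep a) i|).
  by apply: cvgMl_tmp; exact: norm_cvg.
by apply/funext => i; exact: normrZ.
Qed.

Let norm0_eq0 a : banach_ultra_norm a = 0 -> a = 0.
Proof. by move/(@mdist_positivity R (ultraproduct U _)) => ->. Qed.

Lemma banach_ultra_distE a b :
  @mdist R (ultraproduct U _) a b = banach_ultra_norm (b - a).
Proof.
rewrite -scaleN1r -(repK a) -(repK b) banach_classZ banach_classD.
rewrite banach_ultra_normE [LHS](@ultra_distE _ U).
rewrite (_ : (fun i => mdist _ _) =
  fun i => `|val (banach_add (rep b) (banach_scale (-1) (rep a))) i|)//.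
by apply/funext => i; rewrite [LHS]/mdist/= distrC /= scaleN1r.
Qed.

HB.instance Definition _ := @Lmodule_isNormed.Build R banach_ultraproduct
  banach_ultra_norm normD normZ norm0_eq0.

Let complete (F : set_system banach_ultraproduct) :
  ProperFilter F -> cauchy F -> cvg F.
Proof.
have ballE (a : banach_ultraproduct) e :
    ball a e = @ball R (ultraproduct U _) a e.
  rewrite -ball_normE ballEmdist; apply/seteqP; split=> b /=;
  by rewrite banach_ultra_distE distrC.
move=> FF /cauchy_ballP Fc.
have [l Fl] : exists l : ultraproduct U _, F --> l.
  apply: ultraproduct_complete; apply/cauchy_ballP => e e0.
  by apply: filterS (Fc e e0) => -[a b] /=; rewrite ballE.
apply/cvg_ex; exists l; apply/cvg_ballP => e e0.
by apply: filterS (Fl _ (nbhsx_ballx l e e0)) => a; rewrite ballE.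
Qed.

HB.instance Definition _ :=
  Uniform_isComplete.Build banach_ultraproduct complete.

End banach_ultraproduct.

Section closed_span.
Context {R : realType} {E : completeNormedModType R}.
Implicit Types A : set E.

Definition closed_subspace (W : set E) :=
  [/\ closed W, W 0 & forall (l : R) x y, W x -> W y -> W (l *: x + y)].

(* The smallest closed linear subspace containing A. *)
Definition closed_span A : set E :=
  [set x | forall W, closed_subspace W -> A `<=` W -> W x].

Lemma closed_span_closed_subspace A : closed_subspace (closed_span A).
Proof.
split.
- rewrite (_ : closed_span A =
    \bigcap_(W in [set W | closed_subspace W /\ A `<=` W]) W).
    by apply: closed_bigI => W [[]].
  by apply/seteqP; split=> x xA W => [[]|?]; [exact: xA|move=> ?; exact: xA].
- by move=> W [].
- move=> l x y xA yA W WE AW; case: (WE) => _ _; apply.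
    exact: xA.
  exact: yA.
Qed.

Definition closed_span_pred A : {pred E} := fun x => `[< closed_span A x >].

Lemma closed_span_submod A : submod_closed (closed_span_pred A).
Proof.
have [_ h0 hD] := closed_span_closed_subspace A; split; first exact/asboolP.
by move=> l x y /asboolP xA /asboolP yA; apply/asboolP; exact: hD.
Qed.

HB.instance Definition _ A := GRing.isSubmodClosed.Build R E
  (closed_span_pred A) (closed_span_submod A).

Record closed_span_type A := ClosedSpan {
  closed_span_val :> E ;
  closed_span_valP : closed_span_val \in closed_span_pred A }.

HB.instance Definition _ A := [isSub for @closed_span_val A].
HB.instance Definition _ A := [Choice of closed_span_type A by <:].
HB.instance Definition _ A :=
  [SubChoice_isSubLmodule of closed_span_type A by <:].

Section closed_span_norm.
Variable A : set E.

Let nrm (x : closed_span_type A) : R := `|val x|.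

Let nrmD x y : nrm (x + y) <= nrm x + nrm y.
Proof. by rewrite /nrm raddfD ler_normD. Qed.

Let nrmZ (l : R) x : nrm (l *: x) = `|l| * nrm x.
Proof. by rewrite /nrm linearZ normrZ. Qed.

Let nrm0_eq0 x : nrm x = 0 -> x = 0.
Proof.
by move/normr0_eq0 => x0; apply: val_inj; rewrite x0 raddf0.
Qed.

HB.instance Definition _ := @Lmodule_isNormed.Build R (closed_span_type A)
  nrm nrmD nrmZ nrm0_eq0.

Let ball_span (x : closed_span_type A) e : ball x e = val @^-1` ball (val x) e.
Proof.
have nB (y : closed_span_type A) : `|x - y| = `|val x - val y|.
  by rewrite -raddfB.
by rewrite -!ball_normE; apply/seteqP; split=> y /=; rewrite nB.
Qed.

Let complete (F : set_system (closed_span_type A)) :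
  ProperFilter F -> cauchy F -> cvg F.
Proof.
move=> FF /cauchyP Fc.
have /cauchy_cvgP/cvg_ex[l Fl] : cauchy ((val : _ -> E) @ F).
  apply/cauchyP => e e0; have [x Fx] := Fc e e0; exists (val x).
  by apply: (@filterS _ F) Fx => y; rewrite ball_span.
have lA : l \in closed_span_pred A.
  apply/asboolP; have [clA _ _] := closed_span_closed_subspace A.
  have vA (x : closed_span_type A) : closed_span A (val x).
    by apply/asboolP; exact: closed_span_valP.
  exact: (@closed_cvg _ E F FF val (closed_span A) clA (filterE _ vA) l Fl).
apply/cvg_ex; exists (ClosedSpan lA); apply/cvg_ballP => e e0.
apply: (@filterS _ F _ _ _ _ (Fl _ (nbhsx_ballx l e e0))) => x.
by rewrite ball_span.
Qed.

HB.instance Definition _ :=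
  Uniform_isComplete.Build (closed_span_type A) complete.

End closed_span_norm.
End closed_span.

Section haar.
Context {R : realType} (G : topologicalGroupType).

Definition borel : Type := G.

HB.instance Definition _ := Choice.on borel.
HB.instance Definition _ := isPointed.Build borel (1%g : G).
HB.instance Definition _ := @isMeasurable.Build (sigma_display (@open G)) borel
  <<s @open G >> (@sigma_algebra0 _ setT (@open G))
  (@sigma_algebraC borel (@open G)) (@sigma_algebra_bigcup _ setT (@open G)).

Record haar_measure (m : {measure set borel -> \bar R}) : Prop := HaarMeasure {
  haar_neq0 : m setT <> 0%E ;
  haar_invariant : forall (g : G) (A : set borel), measurable A ->
    m [set (g * x)%g | x in (A : set G)] = m A ;
  haar_compact : forall K : set G, compact K -> (m K < +oo)%E ;
  haar_outer_regular : forall A : set borel, measurable A ->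
    m A = ereal_inf [set m O | O in [set O : set G | open O /\ A `<=` O]] ;
  haar_inner_regular : forall O : set G, open O ->
    m O = ereal_sup [set m K | K in [set K : set G | compact K /\ K `<=` O]] }.

End haar.

Section bochner.
Context {R : realType} {d : measure_display} {T : measurableType d}.
Variables (m : {measure set T -> \bar R}) (E : completeNormedModType R).

Record simple_map := SimpleMap {
  simple_size : nat ;
  simple_set : 'I_simple_size -> set T ;
  simple_val : 'I_simple_size -> E ;
  simple_measurable : forall k, measurable (simple_set k) ;
  simple_finite : forall k, (m (simple_set k) < +oo)%E }.

Definition simple_fun (s : simple_map) (x : T) : E :=
  \sum_k \1_(simple_set (s := s) k) x *: simple_val (s := s) k.

Definition simple_integral (s : simple_map) : E :=
  \sum_k fine (m (simple_set (s := s) k)) *: simple_val (s := s) k.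

Definition bochner_integral (f : T -> E) (y : E) :=
  exists s : nat -> simple_map,
  [/\ forall n, measurable_fun setT (fun x => `|f x - simple_fun (s n) x|),
      (fun n => \int[m]_x (`|f x - simple_fun (s n) x|)%:E)%E @ \oo --> 0%E &
      (fun n => simple_integral (s n)) @ \oo --> y].

End bochner.

Section smoothing.
Context {R : realType} (G : topologicalGroupType).

Record isometric_representation (E : completeNormedModType R)
    (pi : G -> E -> E) : Prop := IsometricRepresentation {
  repr1 : forall x, pi 1%g x = x ;
  reprM : forall g h x, pi (g * h)%g x = pi g (pi h x) ;
  repr_linear : forall g, linear (pi g) ;
  repr_isometry : forall g x, `|pi g x| = `|x| ;
  repr_strongly_continuous : forall x, continuous (fun g => pi g x) }.

Definition compactly_supported (f : G -> R) :=
  continuous f /\ compact (closure [set g | f g != 0]).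

Variables (U : free_ultrafilter) (m : {measure set (borel G) -> \bar R}).
Variable E : nat -> completeNormedModType R.

(* The set of all pi(f)x: the relation between x and y below reads
   y_i = pi_i(f)x_i for every i. *)
Definition smoothed_vectors (pi : forall i, G -> E i -> E i) :
    set (banach_ultraproduct U E) :=
  [set a | exists (f : G -> R) (x y : banach_seq E),
    [/\ compactly_supported f,
        forall i, bochner_integral m
          (fun g : borel G => f g *: pi i g (banach_seq_val x i))
          (banach_seq_val y i) &
        a = banach_class U y]].

Definition smoothed_ultraproduct (pi : forall i, G -> E i -> E i) :
    completeNormedModType R :=
  closed_span_type (smoothed_vectors pi).

End smoothing.

Section stability.
Context {R : realType}.

Definition metric_stable_scaling (X : metricType R -> Prop) :=
  forall (E : metricType R) (t : {posnum R}), X E -> X (scaled_metric t E).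

Definition metric_stable_ultraproducts (U : free_ultrafilter)
    (X : metricType R -> Prop) :=
  forall (E : nat -> metricType R) (v : forall i, E i),
    (forall i, X (E i)) -> X (ultraproduct U v).

Definition banach_stable_scaling (B : completeNormedModType R -> Prop) :=
  forall (E : completeNormedModType R) (t : {posnum R}),
    B E -> B (scaled_banach t E).

Definition banach_stable_ultraproducts (U : free_ultrafilter)
    (B : completeNormedModType R -> Prop) :=
  forall E : nat -> completeNormedModType R,
    (forall i, B (E i)) -> B (banach_ultraproduct U E).

(* Haar measures are unique up to a positive factor, which does not affect
   the smoothed ultraproduct. *)
Definition banach_stable_smoothing (G : topologicalGroupType)
    (U : free_ultrafilter) (B : completeNormedModType R -> Prop) :=
  exists2 m : {measure set (borel G) -> \bar R}, haar_measure m &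
    forall (E : nat -> completeNormedModType R)
      (pi : forall i, G -> E i -> E i),
    (forall i, B (E i)) -> (forall i, isometric_representation (pi i)) ->
    B (smoothed_ultraproduct U m pi).

End stability.

(* Main.v *)
Require Import Defs.
From HB Require Import structures.
From mathcomp Require Import all_boot all_order all_algebra.
From mathcomp Require Import all_classical all_reals all_analysis.
From mathcomp Require Import measurable_realfun ring lra.

Set Implicit Arguments.
Unset Strict Implicit.
Unset Printing Implicit Defensive.

Import Order.TTheory GRing.Theory Num.Theory.
Import numFieldNormedType.Exports.

Local Open Scope classical_set_scope.
Local Open Scope ring_scope.

(** Why the theorem is true.

    Growth. Call displacement of a point the supremum over S of the distances by
    which it is moved. Suppose that G acts by isometries on a (p,c)-uniformly convex
    space, that a point v is moved by at most 1 by every element of S, and that no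
    point has a displacement smaller than 1. Let r_k be the radius of the smallest
    ball containing the points g v with g in S^k. Uniform convexity makes the centre
    z_k of that ball unique in a quantitative way: a ball centred at x that contains
    the same points has a radius r such that r^p >= r_k^p + c d(x, z_k)^p
    (circumcenter). If x is the centre z_(k+1), this applies to x and to all its
    translates by elements of S, and one of these is at distance at least 1/2 of
    z_k, up to epsilon, since S moves x by at least 1. Hence r_(k+1)^p >= r_k^p + c
    / 2^p, and the displacement of v over S^n is at least r_n >= (c (n - 1) +
    1)^(1/p) / 2 (orbit_radius, displacement_growth).

    Minimal displacement. An action without fixed points has, for every n, a point
    v_n of displacement 1 after rescaling, such that the displacement is at least 1
    - 1/(n + 1) in the ball of radius n around v_n (almost_minimal_point). In the
    ultraproduct of the rescaled spaces the class of (v_n) has displacement at most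
    1, and the displacement is at least 1 at all equicontinuous points
    (equicontinuous_displacement). If G is discrete, all points are equicontinuous
    and the proof is finished.

    Banach spaces. Unique geodesics make isometries affine (isometry_affine), so
    there are linear parts, and the equicontinuous vectors for these are exactly the
    closed span of the smoothed vectors (closed_span_eqc, eqc_closed_span). It
    remains to find an equicontinuous point w of displacement at most 1: then G acts
    continuously on w plus this span and the growth estimate applies to w. The base
    point 0 need not be equicontinuous, but its averages against continuous weights
    are. As the supports of the weights shrink to 1, the averages of almost minimal
    norm converge to such a point w (near_minimisers, smoothings_limit). To see that
    w moves no more than 0, one compares them through averages Q over g^-1, which
    absorb left translations into the weight: Q w and Q 0 agree for every such
    average (limit_point_displacement). This is an elementary form of the projection
    onto the continuous part of a representation on a reflexive space, and it loses
    nothing in the estimates. *)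

(** * Topological groups and normed spaces *)

Section topological_group.
Context (G : topologicalGroupType).
Implicit Types (g h : G) (V : set G).

Lemma mulg_continuousl h : continuous (fun g : G => (h * g)%g).
Proof.
move=> g; apply: (@continuous_comp _ _ _ (fun g => (h, g)) (fun a : G * G => (a.1 * a.2)%g)).
  by apply: cvg_pair; [exact: cvg_cst|exact: cvg_id].
exact: mulg_continuous.
Qed.

Lemma near_translate g V : nbhs (1%g : G) V -> \forall h \near g, V (g^-1 * h)%g.
Proof.
have : (fun h => (g^-1 * h)%g) @ g --> (1%g : G).
  by rewrite -(mulVg g); exact: mulg_continuousl.
exact.
Qed.

Lemma near_conj h V : nbhs (1%g : G) V -> \forall g \near (1%g : G), V (h * g * h^-1)%g.
Proof.
have conj_cont : continuous (fun g : G => (h * g * h^-1)%g).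
  move=> g; apply: (@continuous_comp _ _ _ (fun g => ((h * g)%g, h^-1%g))
    (fun a : G * G => (a.1 * a.2)%g)); last exact: mulg_continuous.
  by apply: cvg_pair; [exact: mulg_continuousl|exact: cvg_cst].
have h1 : (h * 1 * h^-1)%g = 1%g :> G by rewrite mulg1 mulgV.
by have := conj_cont 1%g; rewrite /continuous_at h1; apply.
Qed.

End topological_group.

Section linear_maps.
Context (R : realType) (V W : lmodType R) (T : V -> W).
Hypothesis Tlin : linear T.

Lemma linear_propD x y : T (x + y) = T x + T y.
Proof. by have := Tlin 1 x y; rewrite !scale1r. Qed.

Lemma linear_prop0 : T 0 = 0.
Proof.
have := linear_propD 0 0; rewrite addr0 => /eqP.
by rewrite -subr_eq0 opprD addNKr oppr_eq0 => /eqP.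
Qed.

Lemma linear_propZ (l : R) x : T (l *: x) = l *: T x.
Proof. by have := Tlin l x 0; rewrite addr0 linear_prop0 addr0. Qed.

Lemma linear_propN x : T (- x) = - T x.
Proof. by rewrite -scaleN1r linear_propZ scaleN1r. Qed.

Lemma linear_propB x y : T (x - y) = T x - T y.
Proof. by rewrite linear_propD linear_propN. Qed.

Lemma linear_prop_sum n (F : 'I_n -> V) : T (\sum_k F k) = \sum_k T (F k).
Proof. by rewrite (big_morph T linear_propD linear_prop0). Qed.

End linear_maps.

Lemma linear_scale (R : realType) (E : lmodType R) (l : R) :
  linear (fun x : E => l *: x).
Proof. by move=> k x y; rewrite scalerDr !scalerA mulrC. Qed.

Section segments.
Context (R : realType) (E : completeNormedModType R).
Implicit Types x y : E.

Lemma normed_mdistE x y : @mdist R (normed_metric E) x y = `|x - y|.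
Proof. by []. Qed.

Lemma midpointE x y : x + 2^-1 *: (y - x) = 2^-1 *: (x + y).
Proof.
rewrite scalerBr scalerDr addrCA addrC; congr (_ + _).
by rewrite -[X in X - _]scale1r -scalerBl; congr (_ *: _); lra.
Qed.

Lemma segment_geodesic x y :
  @geodesic R (normed_metric E) x y (fun t => x + t *: (y - x)).
Proof.
split; first by rewrite scale0r addr0.
  by rewrite scale1r addrC subrK.
move=> t u _ _; rewrite !normed_mdistE opprD addrACA subrr add0r -scalerBl normrZ.
by rewrite (distrC x y).
Qed.

Lemma half_in01 : (2^-1 : R) \in `[0, 1].
Proof. by rewrite in_itv/=; apply/andP; split; lra. Qed.

(** Mazur-Ulam in its easy case: an isometry sends geodesics to geodesics, and
    when these are unique they are the segments. *)
Lemma isometry_affine (T : E -> E) : uniquely_geodesic (normed_metric E) ->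
  (forall x y, `|T x - T y| = `|x - y|) -> linear (fun x => T x - T 0).
Proof.
move=> [_ Egeo] Tiso.
have Tline x y t : t \in `[0, 1] -> T (x + t *: (y - x)) = T x + t *: (T y - T x).
  move=> tI; have [gamma _ gammaU] := Egeo (T x) (T y).
  rewrite [RHS](gammaU _ (segment_geodesic _ _) t tI).
  apply: (gammaU (fun t => T (x + t *: (y - x)) : E) _ t tI).
  have [l0 l1 ld] := segment_geodesic x y; split; [by rewrite l0|by rewrite l1|].
  by move=> u u' uI u'I; rewrite !normed_mdistE !Tiso -!normed_mdistE; exact: ld.
pose P x := T x - T 0.
have PZ01 t x : t \in `[0, 1] -> P (t *: x) = t *: P x.
  by move=> tI; have := Tline 0 x t tI; rewrite subr0 add0r /P => ->; rewrite addrC addKr.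
have PD x y : P (x + y) = P x + P y.
  have := Tline x y 2^-1 half_in01; rewrite !midpointE => Txy.
  have : P (2^-1 *: (x + y)) = 2^-1 *: (P x + P y).
    rewrite {1}/P Txy /P addrACA -opprD scalerBr; congr (_ - _).
    by rewrite -mulr2n -(scaler_nat 2 (T 0)) scalerA mulVf ?scale1r// pnatr_eq0.
  by rewrite PZ01 ?half_in01// => /(scalerI _); apply; rewrite invr_eq0 pnatr_eq0.
have P0 : P 0 = 0 by rewrite /P subrr.
have PN x : P (- x) = - P x.
  by apply/eqP; rewrite -addr_eq0 -PD addNr P0.
have PZp k x : 0 <= k -> P (k *: x) = k *: P x.
  move=> k0; have [k1|k1] := leP k 1; first by rewrite PZ01// in_itv/= k0.
  have kn0 : k != 0 by rewrite gt_eqF// (lt_trans ltr01).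
  have := @PZ01 k^-1 (k *: x); rewrite scalerA mulVf// scale1r => ->.
    by rewrite scalerA divff// scale1r.
  by rewrite in_itv/= invr_ge0 k0 invf_le1 ?(lt_trans ltr01)// ltW.
move=> k x y; rewrite -/(P _) -/(P x) -/(P y) PD; congr (_ + _).
have [k0|k0] := leP 0 k; first exact: PZp.
by rewrite -[k]opprK !(scaleNr (- k)) PN PZp// oppr_ge0 ltW.
Qed.

End segments.

Lemma dist_chain (R : realType) (V : normedModType R) (d : R)
    (a0 a1 a2 a3 a4 a5 a6 a7 : V) :
  `|a1 - a0| <= d -> `|a1 - a2| <= d -> `|a2 - a3| <= d -> `|a3 - a4| <= 1 ->
  `|a5 - a4| <= d -> `|a6 - a5| <= d -> `|a6 - a7| <= d ->
  `|a0 - a7| <= 1 + 6 * d.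
Proof.
have tri (b0 b1 b2 : V) : `|b0 - b2| <= `|b0 - b1| + `|b1 - b2|.
  by rewrite -(subrKA b1); exact: ler_normD.
have := tri a0 a1 a7; have := tri a1 a2 a7; have := tri a2 a3 a7.
have := tri a3 a4 a7; have := tri a4 a5 a7; have := tri a5 a6 a7.
rewrite (distrC a0 a1) (distrC a4 a5) (distrC a5 a6); lra.
Qed.

(** * Growth of orbits in uniformly convex spaces *)

Lemma ltr_powR_cancel (R : realType) (p x y : R) :
  0 <= p -> 0 <= x -> 0 <= y -> x `^ p < y `^ p -> x < y.
Proof.
move=> p0 x0 y0; rewrite !ltNge; apply: contra => yx.
by rewrite ge0_ler_powR// nnegrE.
Qed.

(** One compactness argument for two uses. The decrease of phi at midpoints forces
    points where phi is almost minimal to be close to each other, so the sets of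
    almost minimal points, over a filter base of sets closed under midpoints, form
    a Cauchy filter. With the base reduced to the whole space it gives circumcenters;
    with a genuine base it replaces weak compactness. *)
Lemma near_minimisers (R : realType) (E : metricType R) (p k b : R)
    (C : set (set E)) (phi : E -> R) :
  complete_metric E -> 0 <= p -> 0 < k -> C !=set0 ->
  (forall A B, C A -> C B -> exists2 D, C D & D `<=` A `&` B) ->
  (forall x, 0 <= phi x) ->
  (forall A, C A -> exists2 x, A x & phi x <= b) ->
  (forall A x y, C A -> A x -> A y -> exists2 m, A m &
    phi m <= (phi x + phi y) / 2 - k * mdist x y `^ p) ->
  exists w N,
    (forall A e, C A -> 0 < e ->
      exists x, [/\ A x, mdist w x < e & phi x < N + e]) /\
    (forall e, 0 < e -> exists2 A, C A & forall x, A x -> N - e < phi x).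
Proof.
move=> cE p0 k0 [A0 CA0] Cdir phi0 phib Cmid.
pose J A := inf (phi @` A).
have lbJ A x : A x -> J A <= phi x.
  move=> Ax; apply: ge_inf; last by exists x.
  by exists 0 => _ [y _ <-].
have nearJ A e : C A -> 0 < e -> exists2 x, A x & phi x < J A + e.
  move=> CA e0; have [x Ax xb] := phib _ CA.
  have [|_ [y Ay <-] ye] := @inf_adherent _ (phi @` A) e e0.
    by split; [exists (phi x), x|exists 0 => _ [y _ <-]].
  by exists y.
pose N := sup (J @` C).
have JN A : C A -> J A <= N.
  move=> CA; apply: ub_le_sup; last by exists A.
  exists b => _ [B CB <-]; have [x Bx] := phib _ CB.
  exact/le_trans/lbJ.
have nearN e : 0 < e -> exists2 A, C A & forall x, A x -> N - e < phi x.
  move=> e0; have [|_ [A CA <-] Ae] := @sup_adherent _ (J @` C) e e0.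
    split; first by exists (J A0), A0.
    exists b => _ [B CB <-]; have [x Bx] := phib _ CB.
    exact/le_trans/lbJ.
  by exists A => // x /lbJ; apply: lt_le_trans.
pose D := [set Ae : set E * R | C Ae.1 /\ 0 < Ae.2].
pose B (Ae : set E * R) := [set x | Ae.1 x /\ phi x < N + Ae.2].
have BF : ProperFilter (filter_from D B).
  apply: filter_from_proper.
    apply: filter_from_filter; first by exists (A0, 1); split => /=.
    move=> [A e] [A' e'] [/= CA e0] [/= CA' e'0].
    have [A'' CA'' sub] := Cdir _ _ CA CA'.
    exists (A'', Num.min e e'); first by split => //=; rewrite lt_min e0.
    move=> x [/= /sub[Ax A'x]]; rewrite -ltrBlDl lt_min !ltrBlDl => /andP[xe xe'].
    by split.
  move=> [A e] [/= CA e0]; have [x Ax xe] := nearJ _ _ CA e0.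
  by exists x; split => //=; rewrite (lt_le_trans xe)// lerD2r JN.
have [|w Bw] := cE _ BF.
  apply: cauchy_exP => e e0.
  have h0 : 0 < k * e `^ p / 2 by rewrite divr_gt0// mulr_gt0// powR_gt0.
  set h := _ / 2 in h0; have [A CA Ah] := nearN _ h0.
  have [x Ax xh] := nearJ _ _ CA h0.
  exists x; exists (A, h); first by split.
  move=> y [/= Ay yh]; rewrite ballEmdist/=.
  have [m /Ah mh mxy] := Cmid _ _ _ CA Ax Ay.
  have := JN _ CA => JAN.
  apply: (@ltr_powR_cancel _ p) => //; rewrite ?mdist_ge0// ?ltW//.
  rewrite -(ltr_pM2l k0); move: mxy mh xh yh; rewrite /h; lra.
exists w, N; split=> // A e CA e0.
have wB : filter_from D B (B (A, e)) by exists (A, e).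
have [x [wx [/= Ax xe]]] := filter_ex (filterI (Bw _ (nbhsx_ballx w e e0)) wB).
by exists x; split => //; move: wx; rewrite ballEmdist.
Qed.

Section word_length.
Context (G : topologicalGroupType) (S : set G).
Implicit Types (g h : G) (n : nat).

Lemma set_powSl n g h : S g -> set_pow S n h -> set_pow S n.+1 (g * h)%g.
Proof.
move=> Sg; elim: n h => [|n IH] h /=.
  by move=> ->; exists 1%g => //; exists g => //; rewrite mul1g mulg1.
move=> [x Sx [y Sy <-]]; exists (g * x)%g; first exact: IH.
by exists y => //; rewrite mulgA.
Qed.

Lemma set_powD m n g h :
  set_pow S m g -> set_pow S n h -> set_pow S (m + n) (g * h)%g.
Proof.
move=> Sg; elim: n h => [|n IH] h /=; first by move=> ->; rewrite addn0 mulg1.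
move=> [x /IH Sx [y Sy <-]]; rewrite addnS.
by exists (g * x)%g => //; exists y => //; rewrite mulgA.
Qed.

Hypotheses (S1 : S 1%g) (SV : symmetric_set S) (Sgen : generates S).

Lemma set_pow_mono n m g : (n <= m)%N -> set_pow S n g -> set_pow S m g.
Proof.
move=> nm Sg; rewrite -(subnK nm); elim: (m - n)%N => // k IH.
by exists g => //; exists 1%g => //; rewrite mulg1.
Qed.

Lemma set_powV n g : set_pow S n g -> set_pow S n (g^-1)%g.
Proof.
elim: n g => [|n IH] g /=; first by move=> ->; rewrite invg1.
by move=> [x /IH Sx [y /SV Sy <-]]; rewrite invgM; exact: set_powSl.
Qed.

Lemma set_pow_total g : exists n, set_pow S n g.
Proof.
suff : [set g | exists n, set_pow S n g] g by [].
rewrite (_ : [set _ | _] = setT)//; apply: Sgen.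
- by exists 0%N.
- by move=> x y [n nx] [m my]; exists (n + m)%N; exact: set_powD.
- by move=> x [n /set_powV nx]; exists n.
- by move=> x Sx; exists 1%N; exists 1%g => //; exists x => //; rewrite mul1g.
Qed.

Lemma word_length_le n g : (word_length S g <= n)%N <-> set_pow S n g.
Proof.
have gS : [set n | set_pow S n g /\ forall m, set_pow S m g -> (n <= m)%N] !=set0.
  have hex : exists n, `[< set_pow S n g >].
    by have [k] := set_pow_total g; exists k; exact/asboolP.
  case: (ex_minnP hex) => k /asboolP Sk kmin.
  by exists k; split => // m /asboolP /kmin.
rewrite /word_length; case: xgetP => [k _ [Sk kmin]|/(_ _) none]; last first.
  by case: gS => k /none.
by split=> [kn|/kmin//]; exact: set_pow_mono kn Sk.
Qed.

Lemma set_pow1 g : set_pow S 1 g <-> S g.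
Proof.
split=> [[_ -> [y Sy <-]]|Sg]; first by rewrite mul1g.
by exists 1%g => //; exists g => //; rewrite mul1g.
Qed.

End word_length.

(** Only the algebra of the action matters for the growth estimate; in the
    non-discrete case it is also applied to actions on ultraproducts, whose
    continuity is not known. *)
Record isometric_action (R : realType) (G : topologicalGroupType)
    (E : metricType R) (s : G -> E -> E) : Prop := IsometricAction {
  iact1 : forall x, s 1%g x = x ;
  iactM : forall g h x, s (g * h)%g x = s g (s h x) ;
  iact_dist : forall g x y, mdist (s g x) (s g y) = mdist x y }.

Section isometric_action_theory.
Context (R : realType) (G : topologicalGroupType) (E : metricType R).
Variables (s : G -> E -> E) (sA : isometric_action s).

Lemma iactK g x : s g^-1%g (s g x) = x.
Proof. by rewrite -iactM// mulVg iact1. Qed.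

Lemma iact_distV g x y : mdist (s g x) y = mdist x (s g^-1%g y).
Proof. by rewrite -(iact_dist sA g^-1%g) iactK. Qed.

Lemma mdist_set_pow (S : set G) v b n g : (forall h, S h -> mdist (s h v) v <= b) ->
  set_pow S n g -> mdist (s g v) v <= n%:R * b.
Proof.
move=> Sb; elim: n g => [|n IH] g /=.
  by move=> ->; rewrite iact1// mdistxx mul0r.
move=> [x /IH xb [y /Sb yb <-]]; rewrite iactM//.
have := metric_triangle (s x (s y v)) (s x v) v; rewrite iact_dist// => h.
by rewrite -natr1 mulrDl mul1r; lra.
Qed.

End isometric_action_theory.

(** z minimises the p-th power of the radius of a ball containing the family. Applying
    uniform convexity to every a i on the geodesic from z to x, and letting the
    parameter tend to z, gives the quantitative form of minimality stated here. *)
Lemma circumcenter (R : realType) (E : metricType R) (p c : R) (J : Type)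
    (i0 : J) (a : J -> E) (b : R) :
  0 < p -> 0 < c -> uniformly_convex p c E -> (forall i, mdist (a i0) (a i) <= b) ->
  let phi x := sup (range (fun i => mdist x (a i) `^ p)) in
  exists z, forall x, phi z + c * mdist x z `^ p <= phi x.
Proof.
move=> p0 c0 [[cE Egeo] Econv] ab phi.
have phi_has x : has_sup (range (fun i => mdist x (a i) `^ p)).
  split; first by exists (mdist x (a i0) `^ p), i0.
  exists ((mdist x (a i0) + b) `^ p) => _ [i _ <-].
  have b0 : 0 <= b by rewrite (le_trans (mdist_ge0 _ _) (ab i0)).
  apply: ge0_ler_powR; rewrite ?(ltW p0)// ?nnegrE ?mdist_ge0 ?addr_ge0 ?mdist_ge0//.
  by apply: le_trans (metric_triangle _ (a i0) _) _; rewrite lerD2l ab.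
have le_phi x i : mdist x (a i) `^ p <= phi x.
  by apply: (ub_le_sup (proj2 (phi_has x))); exists i.
have phi_le x N : (forall i, mdist x (a i) `^ p <= N) -> phi x <= N.
  by move=> xN; apply: ge_sup; [exact: (proj1 (phi_has x))|move=> _ [i _ <-]].
have conv x y gamma t : geodesic x y gamma -> 0 <= t <= 1 ->
    phi (gamma t) <=
      (1 - t) * phi x + t * phi y - c * t * (1 - t) * mdist x y `^ p.
  move=> xy /andP[t0 t1]; apply: phi_le => i; rewrite metric_sym.
  have tI : t \in `[0, 1] by rewrite in_itv/= t0.
  apply: le_trans (Econv x y (a i) gamma t xy tI) _.
  rewrite lerB// lerD// ler_wpM2l// ?subr_ge0//; rewrite metric_sym; exact: le_phi.
have [||||A|A x y ->|w [N [near low]]] :=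
  @near_minimisers R E p (c / 4) (phi (a i0)) [set setT] phi cE (ltW p0).
- by rewrite divr_gt0.
- by exists setT.
- by move=> A B -> ->; exists setT.
- by move=> x; apply: le_trans (le_phi x i0); exact: powR_ge0.
- by move=> ->; exists (a i0).
- move=> _ _; have [gamma xy _] := Egeo x y; exists (gamma 2^-1) => //.
  have h2 : 0 <= (2^-1 : R) <= 1.
    by apply/andP; split; lra.
  by have := conv x y gamma 2^-1 xy h2; lra.
have Nle x : N <= phi x.
  apply/ler_addgt0Pl => e e0; have [_ -> /(_ x I)] := low _ e0; lra.
have phiw : phi w <= N.
  apply: phi_le => i; rewrite leNgt; apply/negP => Nw.
  have N0 : 0 <= N.
    apply/ler_addgt0Pl => e e0; have [x [_ _ xe]] := near setT e erefl e0.
    rewrite addrC; apply: le_trans (ltW xe); apply: le_trans (le_phi x i0).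
    exact: powR_ge0.
  (* Strict inequality survives a small displacement of w: pick r' between the
     radius r and the distance from w to a i. *)
  pose r := N `^ p^-1; have rN : r `^ p = N.
    by rewrite /r -powRrM mulVf ?gt_eqF// powRr1.
  have rw : r < mdist w (a i).
    by apply: (@ltr_powR_cancel _ p); rewrite ?powR_ge0 ?mdist_ge0 ?(ltW p0)// rN.
  pose r' := (r + mdist w (a i)) / 2.
  have r0 : 0 <= r by exact: powR_ge0.
  have rr' : r < r' by rewrite /r'; lra.
  have r'w : r' < mdist w (a i) by rewrite /r'; lra.
  have Nr' : N < r' `^ p.
    by rewrite -rN gt0_ltr_powR ?nnegrE// ltW// (le_lt_trans r0).
  pose e := Num.min (r' `^ p - N) (mdist w (a i) - r').
  have e0 : 0 < e by rewrite lt_min !subr_gt0 Nr'.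
  have [x [_ wx xN]] := near setT e erefl e0.
  have xr' : mdist x (a i) < r'.
    apply: (@ltr_powR_cancel _ p); rewrite ?mdist_ge0 ?(ltW p0)//; first lra.
    apply: le_lt_trans (le_phi x i) _; apply: lt_le_trans xN _.
    by rewrite -lerBrDl ge_min lexx.
  have : e <= mdist w (a i) - r' by rewrite ge_min lexx orbT.
  by have := metric_triangle w x (a i); lra.
exists w => x; have [gamma wx _] := Egeo w x.
(* The factor 1 - t tends to 1 as the point gamma t approaches z. *)
have step t : 0 < t < 1 -> (1 - t) * (c * mdist x w `^ p) <= phi x - phi w.
  move=> /andP[t0 t1].
  have t01 : 0 <= t <= 1 by rewrite !ltW.
  have := le_trans (le_trans phiw (Nle (gamma t))) (conv w x gamma t wx t01).
  rewrite (metric_sym w x) => h; rewrite -(ler_pM2l t0); lra.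
rewrite -lerBrDl; set q := c * _ in step *; set d := phi x - _ in step *.
have q0 : 0 <= q by rewrite mulr_ge0 ?powR_ge0 ?(ltW c0).
apply/ler_addgt0Pl => e e0; have [qe|eq] := leP q e.
  by have := le_trans phiw (Nle x); rewrite /d; lra.
have q_gt0 := lt_trans e0 eq; have := step (e / q).
rewrite divr_gt0// ltr_pdivrMr// mul1r eq => /(_ isT).
by rewrite mulrBl mul1r divfK ?gt_eqF//; lra.
Qed.

Lemma half_le_powR (R : realType) (p M : R) : 0 < p ->
  (forall e, 0 < e -> exists a b, [/\ 0 <= a, 0 <= b,
     a `^ p <= M, b `^ p <= M & 1 - e <= a + b]) ->
  2^-1 `^ p <= M.
Proof.
move=> p0 ab.
have root a r : 0 <= a -> a `^ p <= r -> a <= r `^ p^-1.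
  move=> a0 ar; have -> : a = (a `^ p) `^ p^-1.
    by rewrite -powRrM divff ?gt_eqF// powRr1.
  have ap0 : 0 <= a `^ p by exact: powR_ge0.
  apply: ge0_ler_powR; rewrite ?invr_ge0 ?(ltW p0) ?nnegrE//.
  exact: le_trans ap0 ar.
have M0 : 0 <= M.
  have [a [b [_ _ aM _ _]]] := ab 1 ltr01.
  exact: le_trans (powR_ge0 _ _) aM.
have r2 : 2^-1 <= M `^ p^-1.
  apply/ler_addgt0Pl => e e0.
  have [a [b [a0 b0 /root aM /root bM]]] := ab (2 * e) ltac:(by rewrite mulr_gt0).
  by have := aM a0; have := bM b0; lra.
have -> : M = (M `^ p^-1) `^ p by rewrite -powRrM mulVf ?gt_eqF// powRr1.
by apply: ge0_ler_powR; rewrite ?(ltW p0) ?nnegrE ?powR_ge0.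
Qed.

Section growth.
Context (R : realType) (G : topologicalGroupType) (S : set G).
Hypotheses (S1 : S 1%g) (SV : symmetric_set S) (Sgen : generates S).
Context (E : metricType R) (s : G -> E -> E) (sA : isometric_action s).

Lemma displacement_le v b n g : (forall h, S h -> mdist (s h v) v <= b) ->
  (word_length S g <= n)%N -> mdist (s g v) v <= displacement S s v n.
Proof.
move=> Sb gn; apply: ub_le_sup; last by exists g.
exists (n%:R * b) => _ [h hn <-].
by apply: mdist_set_pow sA _ _ _ _ _ Sb _; exact/word_length_le.
Qed.

Context (p c : R) (p0 : 0 < p) (c0 : 0 < c) (v : E).
Hypotheses (Econv : uniformly_convex p c E)
  (v_le : forall h, S h -> mdist (s h v) v <= 1)
  (low : forall x e, 0 < e -> exists2 h, S h & 1 - e <= mdist (s h x) x).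

(** Let z be the circumcenter of the ball of radius k + 1 of the orbit. The ball
    of radius k + 2 contains that ball and its translates by S, so a ball centred at x
    that contains it forces x and all h x, h in S, to be centres for the smaller one.
    The circumcenter inequality bounds their distances to z in terms of the increase of
    the p-th power of the radius, while some h moves x by almost 1, so that x or h x
    is at distance almost 1/2 from z: each step adds c / 2^p. *)
Lemma orbit_radius k x M :
  (forall g, set_pow S k.+1 g -> mdist x (s g v) `^ p <= M) ->
  2^-1 `^ p * (1 + c * k%:R) <= M.
Proof.
elim: k x M => [|k IH] x M xM.
  rewrite mulr0 addr0 mulr1; apply: half_le_powR p0 _ => e e0.
  have [h Sh eh] := low v e0.
  exists (mdist x (s h v)), (mdist x v); split; rewrite ?mdist_ge0//.
  - by apply: xM; exact/set_pow1.
  - by have := xM 1%g; rewrite iact1//; apply; exact/set_pow1.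
  - by apply: le_trans eh _; rewrite (metric_sym x); exact: metric_triangle.
pose J := {g : G | set_pow S k.+1 g}.
pose a (i : J) := s (sval i) v.
have J1 : set_pow S k.+1 (1%g : G) by apply: (@set_pow_mono _ _ S1 0).
have [|z zP] := @circumcenter _ E p c J (exist _ 1%g J1) a (k.+1%:R * 1) p0 c0 Econv.
  move=> [g Sg]; rewrite /a/= iact1// metric_sym.
  exact: mdist_set_pow sA _ _ _ _ _ v_le Sg.
pose f x0 i := mdist x0 (a i) `^ p; pose phi x0 := sup (range (f x0)).
rewrite -/(phi z) in zP.
have f_ub y : has_ubound (range (f y)).
  exists ((mdist y v + k.+1%:R * 1) `^ p) => _ [[g Sg] _ <-].
  have vg := mdist_set_pow sA v_le Sg.
  apply: ge0_ler_powR; rewrite ?(ltW p0)// ?nnegrE ?mdist_ge0//.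
    by rewrite addr_ge0// mdist_ge0.
  apply: le_trans (metric_triangle _ v _) _.
  by rewrite lerD2l metric_sym.
have phi_le y N : (forall g, set_pow S k.+1 g -> mdist y (s g v) `^ p <= N) ->
    phi y <= N.
  move=> yN; apply: ge_sup => [|_ [[g Sg] _ <-]]; last exact: yN.
  by exists (f y (exist _ 1%g J1)), (exist _ 1%g J1).
have phiz : 2^-1 `^ p * (1 + c * k%:R) <= phi z.
  by apply: (IH z) => g Sg; apply: (ub_le_sup (f_ub z)); exists (exist _ g Sg).
have xz : mdist x z `^ p <= (M - phi z) / c.
  rewrite ler_pdivlMr// mulrC lerBrDl (le_trans (zP x : _ <= phi x))//.
  by apply: phi_le => g Sg; apply: xM; exact: set_pow_mono (leqnSn _) Sg.
have sxz h : S h -> mdist (s h x) z `^ p <= (M - phi z) / c.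
  move=> Sh; rewrite ler_pdivlMr// mulrC lerBrDl (le_trans (zP (s h x) : _ <= phi (s h x)))//.
  apply: phi_le => g Sg; rewrite (iact_distV sA) -iactM//; apply: xM.
  by apply: set_powSl Sg; exact: SV.
have half : 2^-1 `^ p <= (M - phi z) / c.
  apply: half_le_powR p0 _ => e e0; have [h Sh eh] := low x e0.
  exists (mdist (s h x) z), (mdist x z); split; rewrite ?mdist_ge0//.
  - exact: sxz.
  - by apply: le_trans eh _; rewrite (metric_sym x z); exact: metric_triangle.
move: half; rewrite ler_pdivlMr// -natr1; move: phiz; lra.
Qed.

Lemma displacement1 : displacement S s v 1 = 1.
Proof.
apply/eqP; rewrite eq_le; apply/andP; split.
  apply: ge_sup => [|_ [g /word_length_le-/(_ S1 SV Sgen)/set_pow1 Sg <-]].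
    exists (mdist (s 1%g v) v), 1%g => //=.
    by apply/word_length_le => //; exact/set_pow1.
  exact: v_le.
apply/ler_addgt0Pl => e e0; have [h Sh eh] := low v e0.
have : mdist (s h v) v <= displacement S s v 1.
  by apply: displacement_le v_le _; apply/word_length_le => //; exact/set_pow1.
lra.
Qed.

Lemma displacement_growth n : (1 <= n)%N ->
  2^-1 * (c * (n%:R - 1) + 1) `^ p^-1 <= displacement S s v n.
Proof.
case: n => // k _; set D := displacement _ _ _ _.
have D0 : 0 <= D.
  have := @displacement_le v 1 k.+1 1%g v_le; rewrite iact1// mdistxx; apply.
  by apply/word_length_le => //; exact: (@set_pow_mono _ _ S1 0).
have : 2^-1 `^ p * (1 + c * k%:R) <= D `^ p.
  apply: (@orbit_radius k v) => g Sg.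
  apply: ge0_ler_powR; rewrite ?(ltW p0)// ?nnegrE ?mdist_ge0//.
  by rewrite metric_sym; apply: displacement_le v_le _; exact/word_length_le.
have A0 : 0 <= 1 + c * k%:R by rewrite addr_ge0// mulr_ge0// ltW.
move=> /(@ge0_ler_powR _ p^-1).
rewrite !nnegrE mulr_ge0 ?powR_ge0// => /(_ _ isT isT).
rewrite powRM ?powR_ge0// -!powRrM divff ?gt_eqF// !powRr1//.
by rewrite -[k.+1%:R]natr1 addrK [_ * _ + 1]addrC; apply; rewrite invr_ge0 ltW.
Qed.

End growth.

(** * Points of almost minimal displacement *)

Section almost_minimal_point.
Context (R : realType) (G : topologicalGroupType) (S : set G).
Hypotheses (S_compact : compact S) (S1 : S 1%g) (Sgen : generates S).
Context (E : metricType R) (s : G -> E -> E).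
Hypothesis sA : continuous_isometric_action s.

Lemma cont_isometric_action : isometric_action s.
Proof. by case: sA. Qed.

Lemma orbit_map_continuous x : continuous (fun g => s g x).
Proof.
move=> g; have := @action_continuous _ _ _ _ sA (g, x).
apply: (@continuous_comp _ _ _ (fun g => (g, x)) (fun gx => s gx.1 gx.2)).
by apply: cvg_pair; [exact: cvg_id|exact: cvg_cst].
Qed.

Lemma fixed_by_generators x : (forall h, S h -> s h x = x) ->
  forall g, s g x = x.
Proof.
move=> Sx g; have iA := cont_isometric_action.
suff : [set g | s g x = x] g by [].
rewrite (_ : [set _ | _] = setT)//; apply: Sgen => //=.
- exact: iact1.
- by move=> a b ax bx; rewrite iactM// bx.
- by move=> a ax; rewrite -{1}ax iactK.
Qed.

Lemma displacement_bounded x : exists b, forall h, S h -> mdist (s h x) x <= b.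
Proof.
have /compact_near_coveringP := S_compact.
move=> /(_ R (+oo%R : set_system R) (fun b h => mdist (s h x) x <= b)) [].
  move=> h _; exists ([set h' | ball (s h x) 1 (s h' x)],
      [set b | 1 + mdist (s h x) x <= b]) => /=.
    split; first exact: (orbit_map_continuous (nbhsx_ballx (s h x) 1 ltr01)).
    by apply: nbhs_pinfty_ge; rewrite num_real.
  move=> [h' b] [/=]; rewrite ballEmdist/= metric_sym => hh'.
  apply: le_trans; apply: le_trans (metric_triangle _ (s h x) _) _.
  by rewrite lerD2r ltW.
move=> b [_ Sb]; exists (b + 1) => h Sh; apply: (Sb (b + 1)) => //.
by rewrite ltrDl.
Qed.

(** If no such point existed, every point x would have, at distance at most n times
    its displacement, a point whose displacement is smaller by a fixed factor. The
    iterates would then converge geometrically to a fixed point. *)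
Lemma almost_minimal_point n : complete_metric E -> inhabited E ->
  ~ (exists x, forall g, s g x = x) ->
  exists (v : E) (t : {posnum R}),
    (forall h, S h -> t%:num * mdist (s h v) v <= 1) /\
    forall x, t%:num * mdist x v <= n%:R ->
      exists2 h, S h & 1 - n.+1%:R^-1 <= t%:num * mdist (s h x) x.
Proof.
move=> cE [x0] nofix; have iA := cont_isometric_action.
pose d x := sup [set mdist (s h x) x | h in S].
have d_ge x h : S h -> mdist (s h x) x <= d x.
  move=> Sh; have [b xb] := displacement_bounded x.
  by apply: ub_le_sup; [exists b => _ [k /xb kb <-]|exists h].
have d_gt0 x : 0 < d x.
  rewrite ltNge; apply/negP => d0; apply: nofix; exists x.
  apply: fixed_by_generators => h Sh; apply: mdist_positivity; apply/eqP.
  by rewrite eq_le mdist_ge0 andbT; exact: le_trans (d_ge _ _ Sh) d0.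
apply: contrapT => none; pose k : R := 1 - n.+1%:R^-1.
have k0 : 0 <= k by rewrite subr_ge0 invf_le1 ?ltr0n// ler1n.
have k1 : 0 < 1 - k by rewrite /k subKr invr_gt0 ltr0n.
have /choice[step stepP] : forall v, exists x,
    mdist x v <= n%:R * d v /\ d x <= k * d v.
  move=> v; apply: contrapT => noimp; apply: none.
  have dV : 0 < (d v)^-1 by rewrite invr_gt0.
  exists v, (PosNum dV) => /=; split.
    by move=> h Sh; rewrite ler_pdivrMl// mulr1; exact: d_ge.
  move=> x; rewrite ler_pdivrMl// mulrC => xv; apply: contrapT => nox.
  apply: noimp; exists x; split => //.
  apply: ge_sup; first by exists (mdist (s 1%g x) x), 1%g.
  move=> _ [h Sh <-]; rewrite leNgt; apply/negP => kh; apply: nox; exists h => //.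
  by rewrite ler_pdivlMl// mulrC ltW.
pose x i := iter i step x0.
have dx i : d (x i) <= k ^+ i * d x0.
  elim: i => [|i IH]; first by rewrite expr0 mul1r.
  have [_ /le_trans] := stepP (x i); apply.
  by rewrite exprS -mulrA ler_wpM2l.
have xD i j : (1 - k) * mdist (x i) (x (i + j)%N) <=
    n%:R * d x0 * (k ^+ i - k ^+ (i + j)).
  elim: j => [|j IH]; first by rewrite addn0 mdistxx mulr0 subrr mulr0.
  have [xx _] := stepP (x (i + j)%N).
  have {}xx : mdist (x (i + j)%N) (x (i + j.+1)%N) <= n%:R * d x0 * k ^+ (i + j).
    rewrite metric_sym addnS (le_trans xx)// -mulrA ler_wpM2l// mulrC; exact: dx.
  have tri := metric_triangle (x i) (x (i + j)%N) (x (i + j.+1)%N).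
  have := ler_wpM2l (ltW k1) tri; have := ler_wpM2l (ltW k1) xx.
  rewrite addnS exprS; move: IH; lra.
have xC i j : (i <= j)%N -> mdist (x i) (x j) <= n%:R * d x0 / (1 - k) * k ^+ i.
  move=> ij; rewrite mulrAC ler_pdivlMr// mulrC -(subnKC ij).
  apply: le_trans (xD _ _) _; rewrite ler_wpM2l ?mulr_ge0 ?(ltW (d_gt0 _))//.
  by rewrite gerBl exprn_ge0.
have small b : 0 < b -> forall C : R, \forall i \near \oo, C * k ^+ i < b.
  move=> b0 C; have kC : (fun i => C * k ^+ i) @ \oo --> (0 : R).
    rewrite -[0](mulr0 C); apply: cvgMr; apply: cvg_expr.
    by rewrite ger0_norm// -subr_gt0.
  exact: (cvgr_lt _ kC).
have [|l xl] := cE (x @ \oo) _.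
  apply: cauchy_exP => e e0.
  have [i _ /(_ i (leqnn _))/= ie] := small _ e0 (n%:R * d x0 / (1 - k)).
  exists (x i); exists i => // j /= ij; rewrite ballEmdist/=.
  exact: le_lt_trans (xC _ _ ij) ie.
apply: nofix; exists l; apply: fixed_by_generators => h Sh.
apply: mdist_positivity; apply/eqP; rewrite eq_le mdist_ge0 andbT.
apply/ler_addgt0Pl => e e0; have e30 : 0 < e / 3 by rewrite divr_gt0.
have xl3 : \forall i \near \oo, ball l (e / 3) (x i).
  exact: (xl _ (nbhsx_ballx l _ e30)).
have [i [xli ie]] := filter_ex (filterI xl3 (small _ e30 (d x0))).
have h1 := metric_triangle (s h l) (s h (x i)) l.
have h2 := metric_triangle (s h (x i)) (x i) l.
have h3 := le_trans (d_ge (x i) h Sh) (dx i).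
move: h1 h2 h3 xli ie; rewrite /= ballEmdist/= iact_dist// (metric_sym (x i)).
rewrite [d x0 * _]mulrC; lra.
Qed.

End almost_minimal_point.

Lemma orbit_continuous_action (R : realType) (G : topologicalGroupType)
    (E : metricType R) (s : G -> E -> E) : isometric_action s ->
  (forall x e, 0 < e -> \forall g \near (1%g : G), mdist (s g x) x <= e) ->
  continuous_isometric_action s.
Proof.
move=> sA s1; split; try by case: sA.
move=> [g x] /=; apply/cvg_ballP => e e0; have e20 : 0 < e / 3 by rewrite divr_gt0.
have gV := near_translate g (s1 x _ e20).
exists ([set h | mdist (s (g^-1 * h)%g x) x <= e / 3], ball x (e / 3)).
  by split => //=; exact: nbhsx_ballx.
move=> [h y] [/= hx]; rewrite !ballEmdist/= => xy.
have -> : s h y = s g (s (g^-1 * h)%g y) by rewrite -(iactM sA) mulgA mulgV mul1g.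
rewrite iact_dist//.
have h1 := metric_triangle x (s (g^-1 * h)%g x) (s (g^-1 * h)%g y).
by move: h1; rewrite iact_dist// (metric_sym x (s _ x)); lra.
Qed.

(** * Actions on metric ultraproducts *)

Section ultraproduct_dist.
Context (R : realType) (U : free_ultrafilter) (E : nat -> metricType R).
Context (v : forall i, E i).
Implicit Types x y : bounded_seq v.

Lemma ultraproduct_cvg x y :
  (fun i => mdist (x i) (y i)) @ ultra_set U -->
    mdist (ultra_class U x) (ultra_class U y).
Proof. rewrite [mdist (ultra_class _ _) _]ultra_distE; exact: ultra_dist_cvg. Qed.

Lemma ultraproduct_le x y M :
  (\forall i \near ultra_set U, mdist (x i) (y i) <= M) ->
  mdist (ultra_class U x) (ultra_class U y) <= M.
Proof.
move=> xy; rewrite [mdist (ultra_class _ _) _]ultra_distE.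
by apply: limr_le xy; exact: ultra_dist_cvg.
Qed.

Lemma ultraproduct_lt x y M : mdist (ultra_class U x) (ultra_class U y) < M ->
  \forall i \near ultra_set U, mdist (x i) (y i) < M.
Proof. by move=> xyM; have := @ultraproduct_cvg x y; move/cvgr_lt; apply. Qed.

End ultraproduct_dist.

Section ultraproduct_action.
Context (R : realType) (U : free_ultrafilter) (G : topologicalGroupType).
Context (E : nat -> metricType R) (v : forall i, E i).
Context (s : forall i, G -> E i -> E i).
Arguments s : clear implicits.
Hypothesis sA : forall i, isometric_action (s i).
Implicit Types (g h : G).

Section action.
Hypothesis sv : forall g, exists b, forall i, mdist (s i g (v i)) (v i) <= b.
Implicit Types x y : bounded_seq v.

Lemma seq_act_bounded g x : exists M, forall i, mdist (v i) (s i g (x i)) <= M.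
Proof.
have [[b sb] [M xM]] := (sv g, bounded_seqP x); exists (b + M) => i.
apply: le_trans (metric_triangle _ (s i g (v i)) _) _.
by rewrite metric_sym iact_dist// lerD.
Qed.

Definition seq_act g x : bounded_seq v := BoundedSeq (seq_act_bounded g x).

Definition ultra_act g (a : ultraproduct U v) : ultraproduct U v :=
  ultra_class U (seq_act g (ultra_repr a)).

Lemma ultra_actE g x : ultra_act g (ultra_class U x) = ultra_class U (seq_act g x).
Proof.
apply/ultra_classP; under eq_cvg do rewrite /= iact_dist//.
exact: ultra_repr_class.
Qed.

Lemma ultra_act_isometric : isometric_action ultra_act.
Proof.
split=> [a|g h a|g a b]; rewrite -(ultra_reprK a).
- rewrite ultra_actE; apply/ultra_classP.
  by under eq_cvg do rewrite /= iact1// mdistxx; exact: cvg_cst.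
- rewrite !ultra_actE; apply/ultra_classP.
  by under eq_cvg do rewrite /= iactM// mdistxx; exact: cvg_cst.
- rewrite -(ultra_reprK b) !ultra_actE [LHS]ultra_distE [RHS]ultra_distE.
  by under [X in lim (X @ _)]eq_fun do rewrite /= iact_dist//.
Qed.

End action.

(** The neighbourhood V depends on e but not on the index i. This is stronger than
    continuity of the orbit map of the class of x, and it is what allows suprema over
    the compact set S to commute with the ultralimit. *)
Definition equicontinuous (x : forall i, E i) := forall e : R, 0 < e ->
  exists2 V : set G, nbhs (1%g : G) V &
    \forall i \near ultra_set U, forall g, V g -> mdist (s i g (x i)) (x i) <= e.

Lemma equicontinuous_closed (x : bounded_seq v) :
  (forall e, 0 < e -> exists2 y : bounded_seq v, equicontinuous y &
    mdist (ultra_class U x) (ultra_class U y) < e) -> equicontinuous x.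
Proof.
move=> xcl e e0; have e30 : 0 < e / 3 by rewrite divr_gt0.
have [y yeq /ultraproduct_lt xy] := xcl _ e30.
have [V V1 yV] := yeq _ e30; exists V => //.
apply: filterS (filterI xy yV) => i [/= xyi yi] g /yi yg.
have h1 := metric_triangle (s i g (x i)) (s i g (y i)) (x i).
have h2 := metric_triangle (s i g (y i)) (y i) (x i).
move: h1 h2; rewrite iact_dist// (metric_sym (y i) (x i)); lra.
Qed.

Lemma equicontinuous_act (x : forall i, E i) h :
  equicontinuous x -> equicontinuous (fun i => s i h (x i)).
Proof.
move=> xeq e /xeq[V V1 xV].
exists [set g | V (h^-1 * g * h)%g]; last first.
  apply: filterS xV => i xi g /xi; apply: le_trans.
  rewrite -(iact_dist (sA i) h (s i _ (x i))) -!iactM//.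
  by rewrite !mulgA mulgV mul1g.
have := near_conj h^-1%g V1; apply: filterS => g.
by rewrite invgK.
Qed.

(** By compactness of S and equicontinuity, if every element of S moved the class
    of x by less than 1 - e, then for some index i every element of S would move x i
    by less than 1 - e / 3, against the lower bound at x i. *)
Lemma equicontinuous_displacement (sv : forall g, exists b, forall i,
    mdist (s i g (v i)) (v i) <= b) (S : set G) (x : bounded_seq v) :
  compact S ->
  (forall i y, mdist y (v i) <= i%:R ->
    exists2 h, S h & 1 - i.+1%:R^-1 <= mdist (s i h y) y) ->
  equicontinuous x -> forall e, 0 < e ->
  exists2 h, S h & 1 - e <=
    mdist (ultra_act sv h (ultra_class U x)) (ultra_class U x).
Proof.
move=> /compact_near_coveringP Scov low xeq e e0; apply: contrapT => none.
have e30 : 0 < e / 3 by rewrite divr_gt0.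
have near_lt : \forall i \near ultra_set U,
    S `<=` [set h | mdist (s i h (x i)) (x i) < 1 - e / 3].
  apply: (Scov _ _ (fun i h => mdist (s i h (x i)) (x i) < 1 - e / 3)) => h Sh.
  have : mdist (ultra_act sv h (ultra_class U x)) (ultra_class U x) < 1 - e.
    by rewrite ltNge; apply/negP => eh; apply: none; exists h.
  rewrite ultra_actE => /ultraproduct_lt hx; have [V V1 xV] := xeq _ e30.
  have hV := near_translate h V1.
  exists ([set h' | V (h^-1 * h')%g], [set i | mdist (s i h (x i)) (x i) < 1 - e /\
     forall g, V g -> mdist (s i g (x i)) (x i) <= e / 3]).
    by split => //=; exact: filterI.
  move=> [h' i] [/= Vh' [hi /(_ _ Vh') Vi]].
  have := metric_triangle (s i h' (x i)) (s i h (x i)) (x i).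
  have -> : s i h' (x i) = s i h (s i (h^-1 * h')%g (x i)).
    by rewrite -(iactM (sA i)) mulgA mulgV mul1g.
  by rewrite iact_dist//; lra.
have [M xM] := bounded_seqP x.
have [k kM] : exists k : nat, M <= k%:R.
  by exists (Num.truncn M).+1; rewrite ltW// truncnS_gt.
have [m me] : exists m : nat, m.+1%:R^-1 < e / 3.
  exact: filter_ex (near_infty_natSinv_lt (PosNum e30)).
have [i [[/= xi ki] mi]] := filter_ex (filterI (filterI near_lt
  (ultra_tail U k)) (ultra_tail U m)).
have [|h Sh] := low i (x i).
  by rewrite metric_sym (le_trans (xM i))// (le_trans kM)// ler_nat.
apply/negP; rewrite -ltNge (lt_le_trans (xi _ Sh))// lerD2l lerN2.
by rewrite (le_trans _ (ltW me))// lef_pV2 ?posrE// ler_nat.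
Qed.

End ultraproduct_action.

(** * Bochner integrals *)

Section simple_functions.
Context (R : realType) (d : measure_display) (T : measurableType d).
Context (m : {measure set T -> \bar R}).

Section one_space.
Context (E : completeNormedModType R).

(** E need not be separable, so Borel measurability of F is of no use; this weaker
    property is stable under adding simple functions. *)
Definition norms_measurable (F : T -> E) :=
  forall u, measurable_fun setT (fun x => `|F x + u|).

Lemma norms_measurable_indic F A (v : E) : measurable A ->
  norms_measurable F -> norms_measurable (fun x => F x + \1_A x *: v).
Proof.
move=> mA mF u.
rewrite (_ : (fun x => _) =
  (fun x => \1_A x * `|F x + (v + u)| + \1_(~` A) x * `|F x + u|)).
  apply: measurable_funD; apply: measurable_funM => //.
  by apply: measurable_indic; exact: measurableC.
apply/funext => x; rewrite !indicE in_setC; case: (x \in A).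
  by rewrite scale1r mul1r mul0r addr0 addrA.
by rewrite scale0r mul1r mul0r add0r addr0.
Qed.

Lemma norms_measurable_sum F n (A : 'I_n -> set T) (v : 'I_n -> E) :
  (forall k, measurable (A k)) -> norms_measurable F ->
  norms_measurable (fun x => F x + \sum_k \1_(A k) x *: v k).
Proof.
elim: n F A v => [|n IH] F A v mA mF u.
  by under eq_fun do rewrite big_ord0 addr0; exact: mF.
under eq_fun do rewrite big_ord_recl addrA.
by apply: IH => // ; exact: norms_measurable_indic.
Qed.

Lemma norms_measurable_cst (w : E) : norms_measurable (cst w).
Proof. by move=> u; exact: (measurable_cst `|w + u|). Qed.

Lemma norms_measurableW F : norms_measurable F -> measurable_fun setT (fun x => `|F x|).
Proof. by move/(_ 0); under eq_fun do rewrite addr0. Qed.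

Lemma measurable_norm_simple F (s : simple_map m E) : norms_measurable F ->
  measurable_fun setT (fun x => `|F x - simple_fun s x|).
Proof.
move=> mF; have := norms_measurable_sum (fun k => - simple_val (s := s) k)
  (@simple_measurable _ _ _ _ _ s) mF.
move=> /norms_measurableW; under eq_fun do
  (under eq_bigr do rewrite scalerN; rewrite sumrN).
exact.
Qed.

(** The triangle inequality for integrals of simple functions with overlapping sets.
    Splitting B along the first set A 0 absorbs v 0 into the constant u on the first
    half and drops it on the second, which allows an induction on the number of sets. *)
Lemma norm_sum_measure_le n (A : 'I_n -> set T) (v : 'I_n -> E) (B : set T)
    (u : E) : (forall k, measurable (A k)) -> measurable B -> (m B < +oo)%E ->
  (`|\sum_k fine (m (A k `&` B)) *: v k + fine (m B) *: u|%:E <=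
   \int[m]_(x in B) (`|\sum_k \1_(A k) x *: v k + u|)%:E)%E.
Proof.
elim: n A v B u => [|n IH] A v B u mA mB finB.
  under eq_integral do rewrite big_ord0 add0r.
  rewrite big_ord0 add0r integral_cst// normrZ ger0_norm ?fine_ge0//.
  by rewrite -[X in (_ * X)%E]fineK ?ge0_fin_numE// -EFinM mulrC.
pose B1 := A ord0 `&` B; pose B2 := B `\` A ord0.
have mB1 : measurable B1 by exact: measurableI.
have mB2 : measurable B2 by exact: measurableD.
have BE : B = B1 `|` B2 by rewrite /B1 setIC setUIDK.
have B12 : B1 `&` B2 = set0.
  by apply/seteqP; split=> x //= [[? _] [_]].
have finS C : measurable C -> C `<=` B -> (m C < +oo)%E.
  by move=> mC CB; apply: le_lt_trans finB; apply: le_measure; rewrite ?inE.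
have mf : measurable_fun setT (fun x => (`|\sum_k \1_(A k) x *: v k + u|)%:E).
  apply/measurable_EFinP.
  have := norms_measurable_sum v mA (norms_measurable_cst u).
  by move/norms_measurableW; under eq_fun do rewrite addrC.
rewrite [in X in (_ <= X)%E]BE ge0_integral_setU//; last 2 first.
- exact: measurable_funS mf.
- exact/disj_set2P.
pose A' k := A (lift ord0 k); pose v' k := v (lift ord0 k).
have mA' k : measurable (A' k) by exact: mA.
have IH1 := IH A' v' B1 (v ord0 + u) mA' mB1 (finS _ mB1 (@subIsetr _ _ _)).
have IH2 := IH A' v' B2 u mA' mB2 (finS _ mB2 (@subDsetl _ _ _)).
apply: le_trans (leeD (le_trans IH1 _) (le_trans IH2 _)); last 2 first.
- rewrite le_eqVlt; apply/orP; left; apply/eqP; apply: eq_integral => x.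
  rewrite inE => -[Ax Bx]; rewrite big_ord_recl indicE mem_set// scale1r.
  by rewrite addrCA addrA.
- rewrite le_eqVlt; apply/orP; left; apply/eqP; apply: eq_integral => x.
  rewrite inE => -[Bx Ax]; rewrite big_ord_recl indicE memNset// scale0r.
  by rewrite add0r.
rewrite -EFinD lee_fin; apply: le_trans (ler_normD _ _).
rewrite le_eqVlt; apply/orP; left; apply/eqP; congr `|_|.
have msplit C : measurable C ->
    fine (m (C `&` B)) = fine (m (C `&` B1)) + fine (m (C `&` B2)).
  move=> mC; rewrite -fineD ?ge0_fin_numE//; last 2 first.
  - by apply: finS; [exact: measurableI|apply: subset_trans (@subIsetr _ _ _) (@subIsetr _ _ _)].
  - by apply: finS; [exact: measurableI|apply: subset_trans (@subIsetr _ _ _) (@subDsetl _ _ _)].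
  rewrite -measureU//; [|exact: measurableI..|].
    by rewrite -setIUr -BE.
  by rewrite setIACA B12 setI0.
have -> : fine (m B) = fine (m B1) + fine (m B2).
  by have := msplit setT measurableT; rewrite !setTI.
rewrite big_ord_recl -/B1.
under eq_bigr do rewrite msplit// scalerDl.
rewrite big_split/= scalerDr scalerDl.
by rewrite -!addrA addrCA; do 2!congr (_ + _); rewrite addrCA.
Qed.

Lemma finite_measure_cover n (A : 'I_n -> set T) :
  (forall k, measurable (A k)) -> (forall k, m (A k) < +oo)%E ->
  exists B, [/\ measurable B, (m B < +oo)%E & forall k, A k `<=` B].
Proof.
elim: n A => [|n IH] A mA fA; first by exists set0; split=> //; [rewrite measure0|case].
have [|k|B [mB fB AB]] := IH (fun k => A (lift ord0 k)) _ _ => //.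
exists (A ord0 `|` B); split; first exact: measurableU.
  apply: le_lt_trans (measureU2 _ (mA ord0) mB) _.
    exact: lte_add_pinfty (fA ord0) fB.
move=> k; have [j ->|->] := unliftP ord0 k; last exact: subsetUl.
exact: subset_trans (AB j) (@subsetUr _ _ _).
Qed.

Lemma norm_simple_integral_le (s : simple_map m E) :
  (`|simple_integral s|%:E <= \int[m]_x (`|simple_fun s x|)%:E)%E.
Proof.
have mS := @simple_measurable _ _ _ _ _ s; have fS := @simple_finite _ _ _ _ _ s.
have [B [mB fB SB]] := finite_measure_cover mS fS.
have := norm_sum_measure_le (@simple_val _ _ _ _ _ s) 0 mS mB fB.
rewrite scaler0 addr0; under eq_bigr do rewrite setIidl//.
move=> /le_trans; apply.
under eq_integral do rewrite addr0.
apply: ge0_subset_integral => //; apply/measurable_EFinP.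
have := norms_measurable_sum (@simple_val _ _ _ _ _ s) mS (norms_measurable_cst 0).
by move/norms_measurableW; under eq_fun do rewrite add0r.
Qed.

End one_space.

Definition simple_image (E F : completeNormedModType R) (L : E -> F)
    (s : simple_map m E) : simple_map m F :=
  SimpleMap (fun k => L (simple_val (s := s) k))
    (@simple_measurable _ _ _ _ _ s) (@simple_finite _ _ _ _ _ s).

Lemma simple_fun_image (E F : completeNormedModType R) (L : E -> F) s x :
  linear L -> simple_fun (simple_image L s) x = L (simple_fun s x).
Proof.
move=> Llin; rewrite /simple_fun (linear_prop_sum Llin).
by apply: eq_bigr => k _; rewrite (linear_propZ Llin).
Qed.

Lemma simple_integral_image (E F : completeNormedModType R) (L : E -> F) s :
  linear L -> simple_integral (simple_image L s) = L (simple_integral s).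
Proof.
move=> Llin; rewrite /simple_integral (linear_prop_sum Llin).
by apply: eq_bigr => k _; rewrite (linear_propZ Llin).
Qed.

Section simple_add.
Context (E : completeNormedModType R) (s t : simple_map m E).

Let A k := match fintype.split k with
  inl i => simple_set (s := s) i | inr j => simple_set (s := t) j end.

Let v k := match fintype.split k with
  inl i => simple_val (s := s) i | inr j => simple_val (s := t) j end.

Let mA k : measurable (A k).
Proof. by rewrite /A; case: fintype.split => i; exact: simple_measurable. Qed.

Let fA k : (m (A k) < +oo)%E.
Proof. by rewrite /A; case: fintype.split => i; exact: simple_finite. Qed.

Definition simple_add : simple_map m E := SimpleMap v mA fA.

Lemma simple_fun_add x :
  simple_fun simple_add x = simple_fun s x + simple_fun t x.
Proof.
rewrite [LHS]big_split_ord/=; congr (_ + _); apply: eq_bigr => k _ /=;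
by rewrite /A /v ?(unsplitK (inl k)) ?(unsplitK (inr k)).
Qed.

Lemma simple_integral_add :
  simple_integral simple_add = simple_integral s + simple_integral t.
Proof.
rewrite [LHS]big_split_ord/=; congr (_ + _); apply: eq_bigr => k _ /=;
by rewrite /A /v ?(unsplitK (inl k)) ?(unsplitK (inr k)).
Qed.

End simple_add.

Section bochner_integral_theory.
Context (E : completeNormedModType R).

Lemma simple_integral_dist (F : T -> E) (s t : simple_map m E) :
  norms_measurable F ->
  (`|simple_integral t - simple_integral s|%:E <=
    \int[m]_x (`|F x - simple_fun t x|)%:E +
    \int[m]_x (`|F x - simple_fun s x|)%:E)%E.
Proof.
move=> mF; pose N := simple_image (fun x : E => -1 *: x).
have mn (s' : simple_map m E) :
    measurable_fun setT (fun x => (`|F x - simple_fun s' x|)%:E).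
  by apply/measurable_EFinP; exact: measurable_norm_simple.
have := norm_simple_integral_le (simple_add t (N s)).
rewrite simple_integral_add simple_integral_image; last exact: linear_scale.
rewrite scaleN1r => /le_trans; apply.
rewrite -ge0_integralD//; apply: ge0_le_integral => //.
- apply/measurable_EFinP; have := measurable_norm_simple
    (N (simple_add t (N s))) (norms_measurable_cst 0).
  congr (measurable_fun _ _); apply/funext => x.
  rewrite simple_fun_image; last exact: linear_scale.
  by rewrite scaleN1r opprK add0r.
- by apply: emeasurable_funD.
move=> x _; rewrite simple_fun_add simple_fun_image; last exact: linear_scale.
rewrite scaleN1r -EFinD lee_fin [X in _ <= X + _]distrC.
by apply: le_trans (ler_normD _ _); rewrite addrA subrK.
Qed.

(** Any simple function, not only those of the defining sequence, computes the
    integral up to its L1 distance to F. All rules of computation for the Bochner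
    integral follow by choosing suitable simple functions. *)
Lemma bochner_integral_approx (F : T -> E) y (s : simple_map m E) :
  norms_measurable F -> bochner_integral m F y ->
  (`|y - simple_integral s|%:E <= \int[m]_x (`|F x - simple_fun s x|)%:E)%E.
Proof.
move=> mF [t [mt tF ty]].
have lhs : (fun n => `|simple_integral (t n) - simple_integral s|%:E) @ \oo -->
    `|y - simple_integral s|%:E.
  apply: cvg_EFin; first exact: nearW.
  by apply: cvg_norm; apply: cvgB => //; exact: cvg_cst.
rewrite -[X in (_ <= X)%E]add0e.
have rhs : (fun n => \int[m]_x (`|F x - simple_fun (t n) x|)%:E +
    \int[m]_x (`|F x - simple_fun s x|)%:E)%E @ \oo -->
    (0 + \int[m]_x (`|F x - simple_fun s x|)%:E)%E.
  by apply: cvgeD tF _; [exact: fin_num_adde_defr|exact: cvg_cst].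
apply: (lee_cvg_to lhs rhs); apply: nearW => n; exact: simple_integral_dist.
Qed.

Lemma bochner_integral_near (F : T -> E) y e : bochner_integral m F y -> 0 < e ->
  exists s : simple_map m E, (\int[m]_x (`|F x - simple_fun s x|)%:E <= e%:E)%E.
Proof.
move=> [t [_ tF _]] e0; have e0' : (0 < e%:E)%E by rewrite lte_fin.
have /filter_ex[n tn] : \forall n \near \oo,
    (\int[m]_x (`|F x - simple_fun (t n) x|)%:E < e%:E)%E.
  apply: (tF [set u | (u < e%:E)%E]).
  by apply: open_nbhs_nbhs; split => //; exact: open_ereal_lt_ereal.
by exists (t n); exact: ltW.
Qed.

Lemma bochner_integral_close (F : T -> E) y (s : simple_map m E) e :
  norms_measurable F -> bochner_integral m F y ->
  (\int[m]_x (`|F x - simple_fun s x|)%:E <= e%:E)%E ->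
  `|y - simple_integral s| <= e.
Proof.
move=> mF Fy Fs; rewrite -lee_fin; apply: le_trans Fs.
exact: bochner_integral_approx.
Qed.

Lemma bochner_integral_uniq (F : T -> E) y z : norms_measurable F ->
  bochner_integral m F y -> bochner_integral m F z -> y = z.
Proof.
move=> mF Fy Fz; apply/eqP; rewrite -subr_eq0 -normr_le0.
apply/ler_addgt0Pl => e e0; have e20 : 0 < e / 2 by rewrite divr_gt0.
have [s Fs] := bochner_integral_near Fz e20; rewrite addr0.
have ys := bochner_integral_close mF Fy Fs; have zs := bochner_integral_close mF Fz Fs.
rewrite -(subrKA (simple_integral s)) (le_trans (ler_normD _ _))//.
by rewrite [X in _ + X]distrC; lra.
Qed.

Lemma simple_fun0 (s : simple_map m E) x : simple_fun (simple_image (fun=> 0) s) x = 0 :> E.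
Proof. by rewrite /simple_fun big1// => k _; rewrite scaler0. Qed.

Lemma norm_bochner_integral_le (F : T -> E) y : norms_measurable F ->
  bochner_integral m F y -> (`|y|%:E <= \int[m]_x (`|F x|)%:E)%E.
Proof.
move=> mF Fy; have [s _] := bochner_integral_near Fy ltr01.
have := bochner_integral_approx (simple_image (fun=> 0 : E) s) mF Fy.
under eq_integral do rewrite simple_fun0 subr0.
rewrite [simple_integral _]big1 ?subr0// => k _.
exact: scaler0.
Qed.

Lemma bochner_integral_add (F F' : T -> E) y y' z :
  norms_measurable F -> norms_measurable F' ->
  norms_measurable (fun x => F x + F' x) ->
  bochner_integral m F y -> bochner_integral m F' y' ->
  bochner_integral m (fun x => F x + F' x) z -> z = y + y'.
Proof.
move=> mF mF' mFF' Fy Fy' FFz; apply/eqP; rewrite -subr_eq0 -normr_le0.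
apply/ler_addgt0Pl => e e0; have e40 : 0 < e / 4 by rewrite divr_gt0.
have [s Fs] := bochner_integral_near Fy e40.
have [t Ft] := bochner_integral_near Fy' e40; rewrite addr0.
have ys := bochner_integral_close mF Fy Fs.
have yt := bochner_integral_close mF' Fy' Ft.
have mn (H : T -> E) (u : simple_map m E) : norms_measurable H ->
    measurable_fun setT (fun x => (`|H x - simple_fun u x|)%:E).
  by move=> mH; apply/measurable_EFinP; exact: measurable_norm_simple.
have zst : `|z - (simple_integral s + simple_integral t)| <= e / 4 + e / 4.
  rewrite -simple_integral_add; apply: (bochner_integral_close mFF' FFz).
  rewrite EFinD; apply: le_trans (leeD Fs Ft).
  rewrite -ge0_integralD//; [|exact: mn..].
  apply: ge0_le_integral => //; [exact: mn|by apply: emeasurable_funD; exact: mn|].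
  move=> x _; rewrite -EFinD lee_fin simple_fun_add opprD addrACA.
  exact: ler_normD.
have -> : z - (y + y') = (z - (simple_integral s + simple_integral t)) -
    ((y - simple_integral s) + (y' - simple_integral t)).
  by rewrite [X in _ = _ - X]addrACA -opprD opprB subrKA.
have yy := ler_normD (y - simple_integral s) (y' - simple_integral t).
by apply: le_trans (ler_normB _ _) _; lra.
Qed.

End bochner_integral_theory.

Lemma bochner_integral_image (E F : completeNormedModType R) (L : E -> F) (C : R)
    (H : T -> E) y z : linear L -> (forall x, `|L x| <= C * `|x|) ->
  norms_measurable H -> norms_measurable (L \o H) ->
  bochner_integral m H y -> bochner_integral m (L \o H) z -> z = L y.
Proof.
move=> Llin LC mH mLH Hy LHz; apply/eqP; rewrite -subr_eq0 -normr_le0.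
apply/ler_addgt0Pl => e e0; rewrite addr0.
pose D := `|C| + 1; have D0 : 0 < D by rewrite ltr_pwDr.
have LD x : `|L x| <= D * `|x|.
  apply: le_trans (LC x) _; rewrite ler_wpM2r// /D.
  by rewrite (le_trans (ler_norm C))// lerDl.
have e20 : 0 < e / (2 * D) by rewrite divr_gt0// mulr_gt0.
have [s Hs] := bochner_integral_near Hy e20.
have ys := bochner_integral_close mH Hy Hs.
have mn (V : completeNormedModType R) (K : T -> V) (u : simple_map m V) :
    norms_measurable K ->
    measurable_fun setT (fun x => (`|K x - simple_fun u x|)%:E).
  by move=> mK; apply/measurable_EFinP; exact: measurable_norm_simple.
have zs : `|z - L (simple_integral s)| <= e / 2.
  rewrite -simple_integral_image//; apply: (bochner_integral_close mLH LHz).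
  have -> : e / 2 = D * (e / (2 * D)).
    by field; rewrite gt_eqF.
  rewrite EFinM; apply: (@le_trans _ _
      (D%:E * \int[m]_x (`|H x - simple_fun s x|)%:E)%E); last first.
    by apply: lee_wpmul2l => //; rewrite lee_fin ltW.
  rewrite -ge0_integralZl_EFin//; [|exact: mn|exact: ltW].
  apply: ge0_le_integral => //; first exact: (mn _ (L \o H)).
    apply/measurable_EFinP/measurable_funM => //.
    exact: measurable_norm_simple.
  by move=> x _; rewrite -EFinM lee_fin simple_fun_image//= -linear_propB.
have Lys : `|L y - L (simple_integral s)| <= e / 2.
  rewrite -linear_propB//; apply: le_trans (LD _) _.
  apply: le_trans (ler_wpM2l (ltW D0) ys) _.
  have -> : D * (e / (2 * D)) = e / 2 by field; rewrite gt_eqF.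
  exact: lexx.
rewrite -(subrKA (L (simple_integral s))); apply: le_trans (ler_normD _ _) _.
by rewrite [X in _ + X]distrC; lra.
Qed.

Lemma integrable_finite_indic (A : set T) : measurable A -> (m A < +oo)%E ->
  m.-integrable setT (fun x => (\1_A x)%:E).
Proof.
move=> mA fA; apply/integrableP; split.
  by apply/measurable_EFinP; exact: measurable_indic.
rewrite (eq_integral (fun x => (\1_A x)%:E)); last first.
  by move=> x _; rewrite gee0_abs// lee_fin.
by rewrite integral_indic// setIT.
Qed.

Lemma integral_simple_fun (s : simple_map m R) :
  m.-integrable setT (EFin \o simple_fun s) /\
  (\int[m]_x (simple_fun s x)%:E = (simple_integral s)%:E)%E.
Proof.
have mS := @simple_measurable _ _ _ _ _ s; have fS := @simple_finite _ _ _ _ _ s.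
have sE x : (simple_fun s x)%:E =
    (\sum_k (simple_val (s := s) k)%:E * (\1_(simple_set (s := s) k) x)%:E)%E.
  by rewrite -sumEFin; apply: eq_bigr => k _; rewrite -EFinM mulrC.
have iS k : m.-integrable setT
    (fun x => (simple_val (s := s) k)%:E * (\1_(simple_set (s := s) k) x)%:E)%E.
  by apply: integrableZl => //; exact: integrable_finite_indic.
split.
  apply: (@eq_integrable _ _ _ _ _ _ (fun x => \sum_k (simple_val (s := s) k)%:E *
      (\1_(simple_set (s := s) k) x)%:E)%E) => //.
    by move=> x _; rewrite -sE.
  by apply: integrable_sum => // k _; exact: iS.
under eq_integral do rewrite sE.
rewrite integral_sum// -sumEFin; apply: eq_bigr => k _.
rewrite integralZl//; last exact: integrable_finite_indic.
by rewrite integral_indic// setIT -[X in (_ * X)%E]fineK ?ge0_fin_numE// -EFinM mulrC.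
Qed.

Lemma bochner_integral_real (f : T -> R) (y : R) : measurable_fun setT f ->
  bochner_integral m f y ->
  m.-integrable setT (EFin \o f) /\ (\int[m]_x (f x)%:E = y%:E)%E.
Proof.
move=> mf fy.
have Nf : norms_measurable f.
  by move=> u; apply: measurableT_comp => //; exact: measurable_funD.
have mfs (s : simple_map m R) : measurable_fun setT (EFin \o (fun x => f x - simple_fun s x)).
  apply/measurable_EFinP; apply: measurable_funB => //.
  by have [/measurable_int/measurable_EFinP] := integral_simple_fun s.
have ifs (s : simple_map m R) e :
    (\int[m]_x (`|f x - simple_fun s x|)%:E <= e%:E)%E ->
    m.-integrable setT (EFin \o (fun x => f x - simple_fun s x)).
  move=> fs; apply/integrableP; split => //.
  exact: le_lt_trans fs (ltry _).
have if_ : m.-integrable setT (EFin \o f).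
  have [s /ifs fs] := bochner_integral_near fy ltr01.
  have [is_ _] := integral_simple_fun s.
  apply: (@eq_integrable _ _ _ _ _ measurableT _ _ _ (integrableD _ fs is_)) => //.
  by move=> x _; rewrite /= -EFinD subrK.
split=> //.
have fin := integrable_fin_num measurableT if_.
rewrite -(fineK fin); congr EFin; apply/eqP; rewrite -subr_eq0 -normr_le0.
apply/ler_addgt0Pl => e e0; have e20 : 0 < e / 2 by rewrite divr_gt0.
have [s fs] := bochner_integral_near fy e20.
have ys := bochner_integral_close Nf fy fs; rewrite addr0.
have [is_ iE] := integral_simple_fun s.
have fis : `|fine (\int[m]_x (f x)%:E) - simple_integral s| <= e / 2.
  rewrite -lee_fin; apply: le_trans fs.
  rewrite -abse_EFin EFinB fineK// -iE -integralB_EFin//.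
  exact: le_abse_integral (mfs s).
rewrite -(subrKA (simple_integral s)); apply: le_trans (ler_normD _ _) _.
by rewrite [X in _ + X]distrC; lra.
Qed.

End simple_functions.

(** * Integrals of continuous functions with compact support *)

(** Compactness as an induction principle: a property of sets that is stable under
    finite unions and holds near each point of K holds for some set containing K. *)
Lemma compact_cover_ind (T : topologicalType) (K : set T) (good : set (set T)) :
  compact K -> good set0 -> (forall B B', good B -> good B' -> good (B `|` B')) ->
  (forall x, K x -> exists2 B, good B & nbhs x B) ->
  exists2 B, good B & K `<=` B.
Proof.
move=> /compact_near_coveringP Kcov good0 goodU near_good.
pose F : set_system (set T) :=
  filter_from good (fun B => [set B' | good B' /\ B `<=` B']).
have FF : Filter F.
  apply: filter_from_filter; first by exists set0.
  move=> B B' gB gB'; exists (B `|` B'); first exact: goodU.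
  move=> C [gC BC]; split; split=> //; apply: subset_trans BC.
    exact: subsetUl.
  exact: subsetUr.
have [x /near_good[B gB xB]|B gB KB] := Kcov _ F (fun B x => B x) FF.
  exists (B, [set B' | good B' /\ B `<=` B']); last by move=> [y B'] [/= By [_]]; apply.
  by split => //; exists B.
by exists B => //; exact: (KB B (conj gB (@subset_refl _ B))).
Qed.

Section haar_integral.
Context (R : realType) (G : topologicalGroupType).
Hypothesis G_hausdorff : hausdorff_space G.

Lemma open_borel (A : set G) : open A -> measurable (A : set (borel G)).
Proof. by move=> oA; exact: sub_sigma_algebra. Qed.

Lemma compact_borel (A : set G) : compact A -> measurable (A : set (borel G)).
Proof.
move=> cA; rewrite -[A]setCK; apply: measurableC; apply: open_borel.
by rewrite openC; exact: compact_closed.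
Qed.

Lemma continuous_borel (f : G -> R) : continuous f ->
  measurable_fun setT (f : borel G -> R).
Proof.
move=> cf; apply: (measurability _ (RGenOpens.measurableE R)).
move=> _ [A [a [b ->] <-]]; rewrite setTI; apply: open_borel.
by apply: open_comp => // x _; exact: cf.
Qed.

Lemma continuous_norms_measurable (E : completeNormedModType R) (H : G -> E) :
  continuous H -> norms_measurable (H : borel G -> E).
Proof.
move=> cH u; apply: continuous_borel => x.
apply: (@continuous_comp _ _ _ (fun x => H x + u) (fun y => `|y|)).
  by apply: cvgD; [exact: cH|exact: cvg_cst].
exact: norm_continuous.
Qed.

Lemma mulg_measurable (h : G) :
  measurable_fun setT (fun g : borel G => (h * g)%g : borel G).
Proof.
apply: (@measurability _ _ _ (borel G) _ _ (@open G) erefl) => _ [A oA <-]; rewrite setTI.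
by apply: open_borel; apply: open_comp => // x _; exact: mulg_continuousl.
Qed.

Context (m : {measure set (borel G) -> \bar R}) (mH : haar_measure m).

Lemma ge0_integral_translate (h : G) (f : G -> \bar R) :
  measurable_fun setT (f : borel G -> \bar R) -> (forall x, 0 <= f x)%E ->
  (\int[m]_x f (h * x)%g = \int[m]_x f x)%E.
Proof.
move=> mf f0; have := @ge0_integral_pushforward _ _ _ _ R _ (mulg_measurable h)
  m setT f measurableT mf (fun x _ => f0 x).
rewrite preimage_setT /= => <-; rewrite [LHS](eq_measure_integral m)//.
  exact: mulg_measurable.
move=> hm A mA _.
rewrite /pushforward -(haar_invariant mH h^-1%g mA); congr (m _).
apply/seteqP; split=> [x /= hx|_ [y Ay <-]] /=; last by rewrite mulgA mulgV mul1g.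
by exists (h * x)%g => //; rewrite mulgA mulVg mul1g.
Qed.

Definition continuous_compact_support (E : normedModType R) (H : G -> E) :=
  continuous H /\ exists2 K : set G, compact K & forall g, H g != 0 -> K g.

Section existence.
Context (E : completeNormedModType R) (H : G -> E) (K : set G).
Hypotheses (cH : continuous H) (cK : compact K) (HK : forall g, H g != 0 -> K g).

(** Sets on which H has such an approximation are stable under finite unions: the
    second simple function is cut off outside the first set. *)
Lemma simple_approx e : 0 < e -> exists s : simple_map m E,
  forall x, `|H x - simple_fun s x| <= e * \1_K x.
Proof.
move=> e0; pose good (B : set G) := open B /\ exists s : simple_map m E, forall x,
  (B x -> K x -> `|H x - simple_fun s x| <= e) /\
  (~ (B x /\ K x) -> simple_fun s x = 0).
have goodI (B B' : set G) : good B -> good B' -> good (B `|` B').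
  move=> [oB [s sB]] [oB' [s' sB']]; split; first exact: openU.
  have mBC : measurable (~` B : set (borel G)) by apply: measurableC; exact: open_borel.
  have mr k : measurable (simple_set (s := s') k `&` ~` B).
    by apply: measurableI => //; exact: simple_measurable.
  have fr k : (m (simple_set (s := s') k `&` ~` B) < +oo)%E.
    apply: le_lt_trans (simple_finite (s := s') k).
    by apply: le_measure; rewrite ?inE//; exact: simple_measurable.
  pose r := SimpleMap (fun k => simple_val (s := s') k) mr fr.
  have rE x : simple_fun r x = \1_(~` B) x *: simple_fun s' x.
    rewrite /simple_fun scaler_sumr; apply: eq_bigr => k _.
    by rewrite /= indicI scalerA mulrC.
  exists (simple_add s r) => x; rewrite simple_fun_add rE indicE in_setC.
  have [Bx|nBx] := pselect (B x).
    rewrite mem_set//= scale0r addr0; split=> [_ Kx|nx].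
      exact: (sB x).1.
    by apply: (sB x).2 => -[_ Kx]; apply: nx; split => //; left.
  rewrite memNset//= scale1r (sB x).2; last by case.
  rewrite add0r; split=> [[//|B'x] Kx|nx]; first exact: (sB' x).1.
  by apply: (sB' x).2 => -[B'x Kx]; apply: nx; split => //; right.
have good0 : good set0.
  split; first exact: open0.
  have s0 : simple_map m E.
    apply: (@SimpleMap _ _ _ m E 0 (fun=> set0) (fun=> 0)) => k.
      exact: measurable0.
    by rewrite measure0.
  by exists (simple_image (fun=> 0) s0) => x; rewrite simple_fun0; split.
have [x Kx|B gB KB] := compact_cover_ind cK good0 goodI.
  pose B := H @^-1` ball (H x) e.
  have oB : open B.
    by apply: open_comp => [y _|]; [exact: cH|exact: ball_open].
  have Bx : B x by rewrite /B/=; exact: ballxx.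
  have mBK : measurable (B `&` K : set (borel G)).
    by apply: measurableI; [exact: open_borel|exact: compact_borel].
  have fBK : (m (B `&` K) < +oo)%E.
    apply: le_lt_trans (haar_compact mH cK).
    by apply: le_measure; rewrite ?inE//; exact: compact_borel.
  have gB : good B.
    split => //; exists (@SimpleMap _ _ _ m E 1 (fun=> B `&` K) (fun=> H x) (fun=> mBK) (fun=> fBK)).
    move=> y; rewrite /simple_fun big_ord1/= indicE; split=> [By Ky|nBK].
      rewrite mem_set// scale1r distrC ltW//.
      by move: By; rewrite /B/= -ball_normE.
    by rewrite memNset// scale0r.
  by exists B => //; exact: open_nbhs_nbhs.
case: gB => _ [s sB]; exists s => x; rewrite indicE.
have [Kx|nKx] := pselect (K x).
  by rewrite mem_set// mulr1; apply: (sB x).1 => //; exact: KB.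
rewrite memNset// mulr0 (sB x).2; last by case.
by rewrite subr0 normr_le0; apply: contrapT => /negP /HK.
Qed.

Lemma bochner_integral_exists : exists y, bochner_integral m (H : borel G -> E) y.
Proof.
have mK : measurable (K : set (borel G)) by exact: compact_borel.
pose k := fine (m K); have k0 : 0 <= k by exact: fine_ge0.
have kE : m K = k%:E by rewrite fineK// ge0_fin_numE// (haar_compact mH).
have nH := continuous_norms_measurable cH.
have /choice[s sP] : forall n : nat, exists s : simple_map m E,
    forall x, `|H x - simple_fun s x| <= n.+1%:R^-1 * \1_K x.
  by move=> n; apply: simple_approx; rewrite invr_gt0.
have mn (t : simple_map m E) :
    measurable_fun setT (fun x : borel G => (`|H x - simple_fun t x|)%:E).
  by apply/measurable_EFinP; exact: measurable_norm_simple.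
have sI n : (\int[m]_x (`|H x - simple_fun (s n) x|)%:E <=
    (n.+1%:R^-1 * k)%:E)%E.
  apply: (@le_trans _ _ (\int[m]_x (n.+1%:R^-1%:E * (\1_K x)%:E))%E).
    apply: ge0_le_integral => //; first by apply/measurable_EFinP/measurable_funM.
    by move=> x _; rewrite -EFinM lee_fin; exact: sP.
  rewrite ge0_integralZl_EFin//.
    by rewrite integral_indic// setIT kE.
  by apply/measurable_EFinP; exact: measurable_indic.
have dist n p : `|simple_integral (s n) - simple_integral (s p)| <=
    (n.+1%:R^-1 + p.+1%:R^-1) * k.
  rewrite -lee_fin; apply: le_trans (simple_integral_dist (s p) (s n) nH) _.
  by rewrite mulrDl EFinD; exact: leeD (sI n) (sI p).
have small e : 0 < e -> \forall n \near \oo, n.+1%:R^-1 * k < e.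
  move=> e0; have c0 : (fun n : nat => n.+1%:R^-1 * k : R) @ \oo --> (0 : R).
    by rewrite -[0](mul0r k); apply: cvgMl; exact: cvg_harmonic.
  exact: (cvgr_lt _ c0).
have : cvg ((fun n => simple_integral (s n)) @ \oo).
  apply/cauchy_cvgP; apply: cauchy_exP => e e0.
  have e20 : 0 < e / 2 by rewrite divr_gt0.
  have [N _ NP] := small _ e20.
  exists (simple_integral (s N)); exists N => // n /= Nn.
  rewrite -ball_normE/=; apply: le_lt_trans (dist _ _) _.
  rewrite mulrDl [X in _ < X]splitr; apply: ltrD; first exact: (NP N (leqnn _)).
  exact: (NP n Nn).
move=> /cvg_ex[y sy]; exists y, s; split=> //.
  by move=> n; exact: measurable_norm_simple.
apply: (@squeeze_cvge _ _ _ _ (fun=> 0%E) _ (fun n => (n.+1%:R^-1 * k)%:E)).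
- by apply: nearW => n; rewrite sI integral_ge0.
- exact: cvg_cst.
- apply: cvg_EFin; first exact: nearW.
  by rewrite -[0](mul0r k); apply: cvgMl; exact: cvg_harmonic.
Qed.

End existence.
End haar_integral.

Section averages.
Context (R : realType) (G : topologicalGroupType).
Hypothesis G_hausdorff : hausdorff_space G.
Context (m : {measure set (borel G) -> \bar R}) (mH : haar_measure m).
Local Notation ccs := continuous_compact_support.

Definition bint (E : completeNormedModType R) (H : G -> E) : E :=
  xget 0 (bochner_integral m (H : borel G -> E)).

Section one_space.
Context (E : completeNormedModType R).
Implicit Types H : G -> E.

Lemma bintP H : ccs H -> bochner_integral m (H : borel G -> E) (bint H).
Proof.
move=> [cH [K cK HK]].
exact: xgetPex (bochner_integral_exists G_hausdorff mH cH cK HK).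
Qed.

Lemma bint_uniq H y : ccs H -> bochner_integral m (H : borel G -> E) y -> y = bint H.
Proof.
move=> cH Hy; apply: bochner_integral_uniq Hy (bintP cH).
exact: (continuous_norms_measurable cH.1).
Qed.

Lemma ccsD H H' : ccs H -> ccs H' -> ccs (fun g => H g + H' g).
Proof.
move=> [cH [K cK HK]] [cH' [K' cK' HK']]; split.
  by move=> g; apply: cvgD; [exact: cH|exact: cH'].
exists (K `|` K'); first exact: compactU.
move=> g; have [H0|/HK Kg _] := eqVneq (H g) 0; last by left.
by rewrite H0 add0r => /HK'; right.
Qed.

Lemma ccs_comp (F : completeNormedModType R) (L : F -> E) (H : G -> F) :
  continuous L -> L 0 = 0 -> ccs H -> ccs (L \o H).
Proof.
move=> cL L0 [cH [K cK HK]]; split.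
  by move=> g; apply: continuous_comp; [exact: cH|exact: cL].
exists K => // g LHg; apply: HK; apply: contra_neq LHg => /= ->; exact: L0.
Qed.

Lemma ccs_translate H h : ccs H -> ccs (fun g => H (h * g)%g).
Proof.
move=> [cH [K cK HK]]; split.
  by move=> g; apply: continuous_comp; [exact: mulg_continuousl|exact: cH].
exists [set (h^-1 * k)%g | k in K].
  by apply: continuous_compact cK; apply: continuous_subspaceT; exact: mulg_continuousl.
by move=> g /HK Kg; exists (h * g)%g => //; rewrite mulgA mulVg mul1g.
Qed.

Lemma bintD H H' : ccs H -> ccs H' -> bint (fun g => H g + H' g) = bint H + bint H'.
Proof.
move=> cH cH'; have cHH := ccsD cH cH'.
apply: (bochner_integral_add _ _ _ (bintP cH) (bintP cH') (bintP cHH)).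
- exact: (continuous_norms_measurable cH.1).
- exact: (continuous_norms_measurable cH'.1).
- exact: (continuous_norms_measurable cHH.1).
Qed.

Lemma bint_norm_le H (phi : G -> R) : ccs H -> measurable_fun setT (phi : borel G -> R) ->
  (forall g, `|H g| <= phi g) -> (`|bint H|%:E <= \int[m]_g (phi g)%:E)%E.
Proof.
move=> cH mphi Hphi.
have nH := continuous_norms_measurable cH.1.
apply: le_trans (norm_bochner_integral_le nH (bintP cH)) _.
apply: ge0_le_integral => //.
- by apply/measurable_EFinP; exact: norms_measurableW.
- exact/measurable_EFinP.
- by move=> x _; rewrite lee_fin.
Qed.

(** Left invariance of the measure, applied to translates of the sets of a simple
    function close to H. *)
Lemma bint_translate H h : ccs H -> bint (fun g => H (h * g)%g) = bint H.
Proof.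
move=> cH; have cHh := ccs_translate h cH.
have nH := continuous_norms_measurable cH.1.
have nHh := continuous_norms_measurable cHh.1.
apply/eqP; rewrite -subr_eq0 -normr_le0; apply/ler_addgt0Pl => e e0.
rewrite addr0; have e20 : 0 < e / 2 by rewrite divr_gt0.
have [s Hs] := bochner_integral_near (bintP cH) e20.
have ys := bochner_integral_close nH (bintP cH) Hs.
have mt k : measurable ((fun g : borel G => (h * g)%g : borel G) @^-1` simple_set (s := s) k).
  by rewrite -[X in measurable X]setTI; apply: mulg_measurable => //; exact: simple_measurable.
have tE k : m ((fun g : borel G => (h * g)%g : borel G) @^-1` simple_set (s := s) k) =
    m (simple_set (s := s) k).
  have mk := @simple_measurable _ _ _ _ _ s k.
  rewrite -(haar_invariant mH h^-1%g mk); congr (m _); apply/seteqP.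
  split=> [x /= hx|_ [y Ay <-]] /=; last by rewrite mulgA mulgV mul1g.
  by exists (h * x)%g => //; rewrite mulgA mulVg mul1g.
have ft k : (m ((fun g : borel G => (h * g)%g : borel G) @^-1` simple_set (s := s) k) < +oo)%E.
  by rewrite tE; exact: simple_finite.
pose t : simple_map m E := SimpleMap (fun k => simple_val (s := s) k) mt ft.
have tI : simple_integral t = simple_integral s.
  by apply: eq_bigr => k _ /=; rewrite tE.
have := @bochner_integral_close _ _ _ _ _ _ _ t (e / 2) nHh (bintP cHh).
rewrite tI => zs; rewrite -(subrKA (simple_integral s)).
apply: le_trans (ler_normD _ _) _; rewrite [X in _ + X]distrC [e]splitr.
apply: lerD; last exact: ys.
apply: zs; apply: le_trans Hs.
pose f g := (`|H g - simple_fun s g|)%:E.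
have mf : measurable_fun setT (f : borel G -> \bar R).
  by apply/measurable_EFinP; exact: measurable_norm_simple.
have f0 g : (0 <= f g)%E by rewrite lee_fin.
rewrite -[X in (_ <= X)%E](ge0_integral_translate mH h mf f0).
exact: lexx.
Qed.

End one_space.

Lemma bint_linear (E F : completeNormedModType R) (L : E -> F) (C : R) (H : G -> E) :
  linear L -> (forall x, `|L x| <= C * `|x|) -> continuous L -> ccs H ->
  bint (L \o H) = L (bint H).
Proof.
move=> Llin LC cL cH; have cLH := ccs_comp cL (linear_prop0 Llin) cH.
apply: (bochner_integral_image Llin LC _ _ (bintP cH) (bintP cLH)).
- exact: (continuous_norms_measurable cH.1).
- exact: (continuous_norms_measurable cLH.1).
Qed.

Lemma bint_real (f : G -> R) : ccs f ->
  (\int[m]_g (f g)%:E)%E = (bint f)%:E.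
Proof.
move=> cf; have [|_ ->//] := bochner_integral_real _ (bintP cf).
exact: (continuous_borel cf.1).
Qed.

Lemma ccsZ (E : completeNormedModType R) (f : G -> R) (F : G -> E) :
  ccs f -> continuous F -> ccs (fun g => f g *: F g).
Proof.
move=> [cf [K cK fK]] cF; split; first by move=> g; apply: cvgZ; [exact: cf|exact: cF].
by exists K => // g fF; apply: fK; apply: contra_neq fF => ->; rewrite scale0r.
Qed.

Lemma bint_scalar (E : completeNormedModType R) (f : G -> R) (x : E) : ccs f ->
  bint (fun g => f g *: x) = bint f *: x.
Proof.
move=> cf; apply: (@bint_linear _ _ (fun r : R => r *: x) `|x|) cf.
- by move=> k a b; rewrite scalerDl scalerA.
- by move=> r; rewrite normrZ mulrC.
- by move=> r; apply: cvgZ; [exact: cvg_id|exact: cvg_cst].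
Qed.

Record density (V : set G) (f : G -> R) : Prop := Density {
  density_ccs : ccs f ;
  density_ge0 : forall g, 0 <= f g ;
  density_supp : forall g, f g != 0 -> V g ;
  density_int : bint f = 1 }.

Lemma densityW (V W : set G) f : V `<=` W -> density V f -> density W f.
Proof. by move=> VW [? ? fV ?]; split=> // g /fV /VW. Qed.

Lemma density_mid (V : set G) f f' : density V f -> density V f' ->
  density V (fun g => 2^-1 * (f g + f' g)).
Proof.
move=> [cf f0 fV f1] [cf' f'0 f'V f'1]; have cff := ccsD cf cf'.
have c2 : continuous (fun r : R => 2^-1 * r) by exact: mulrl_continuous.
split.
- exact: (ccs_comp c2 (mulr0 _) cff).
- by move=> g; rewrite mulr_ge0// addr_ge0.
- move=> g; have [fg0|/fV//] := eqVneq (f g) 0.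
  have [f'g0|/f'V//] := eqVneq (f' g) 0.
  by rewrite fg0 f'g0 addr0 mulr0 eqxx.
rewrite (@bint_linear _ _ (fun r : R => 2^-1 * r) `|2^-1| _ _ _ c2 cff).
- by rewrite (bintD cf cf') f1 f'1; lra.
- by move=> k a b; rewrite mulrDr mulrCA.
- by move=> r; rewrite normrM.
Qed.

Section avg.
Context (E : completeNormedModType R).

Definition avg (f : G -> R) (F : G -> E) : E := bint (fun g => f g *: F g).

Lemma avg_cst V f x : density V f -> avg f (fun=> x) = x.
Proof. by move=> [cf _ _ f1]; rewrite /avg bint_scalar// f1 scale1r. Qed.

Lemma avg_sub f F F' : ccs f -> continuous F -> continuous F' ->
  avg f F - avg f F' = avg f (fun g => F g - F' g).
Proof.
move=> cf cF cF'; have cFF : continuous (fun g => F g - F' g).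
  by move=> g; apply: cvgB; [exact: cF|exact: cF'].
rewrite -[avg f F](_ : avg f (fun g => F g - F' g) + avg f F' = _) ?addrK//.
rewrite /avg -bintD; [|exact: ccsZ..].
by congr bint; apply/funext => g; rewrite -scalerDr subrK.
Qed.

Lemma avg_dist_le V f F F' M : density V f -> continuous F -> continuous F' ->
  (forall g, V g -> `|F g - F' g| <= M) -> `|avg f F - avg f F'| <= M.
Proof.
move=> [cf f0 fV f1] cF cF' FM; rewrite avg_sub//.
have cFF : continuous (fun g => F g - F' g).
  by move=> g; apply: cvgB; [exact: cF|exact: cF'].
have cfM : ccs (fun g => M * f g).
  by apply: (ccs_comp (L := fun r : R => M * r)) => //; [exact: mulrl_continuous|rewrite mulr0].
rewrite -lee_fin; apply: le_trans (bint_norm_le (phi := fun g => M * f g) _ _ _) _.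
- exact: ccsZ.
- exact: (continuous_borel cfM.1).
- move=> g; rewrite normrZ ger0_norm// mulrC.
  have [->|/fV/FM fM] := eqVneq (f g) 0; first by rewrite !mulr0.
  by rewrite ler_wpM2r.
rewrite bint_real//.
have := @bint_scalar R f M cf; rewrite f1 => fM.
have -> : bint (fun g => M * f g) = bint (fun g => f g *: (M : R)).
  by congr bint; apply/funext => g; rewrite mulrC.
by rewrite fM /GRing.scale/= mul1r.
Qed.

Lemma avg_near V f F y M : density V f -> continuous F ->
  (forall g, V g -> `|F g - y| <= M) -> `|avg f F - y| <= M.
Proof.
move=> df cF FM; rewrite -[X in _ - X](avg_cst y df).
by apply: avg_dist_le df cF _ FM => g; exact: cvg_cst.
Qed.

End avg.
End averages.

Section approximate_identities.
Context (R : realType) (G : topologicalGroupType).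
Hypothesis G_hausdorff : hausdorff_space G.
Context (m : {measure set (borel G) -> \bar R}) (mH : haar_measure m).
Local Notation ccs := continuous_compact_support.
Local Notation bint := (bint m).
Local Notation avg := (avg m).
Local Notation density := (density m).

Lemma avg_affine (E F : completeNormedModType R) (L : E -> F) (C : R) (c : F) V f
    (H : G -> E) : density V f -> linear L -> (forall x, `|L x| <= C * `|x|) ->
  continuous L -> continuous H ->
  avg f (fun g => L (H g) + c) = L (avg f H) + c.
Proof.
move=> df Llin LC cL cH; have cf := density_ccs df.
have cLH : continuous (L \o H).
  by move=> g; apply: continuous_comp; [exact: cH|exact: cL].
have cfH := ccsZ cf cH.
have cst_c : continuous (fun _ : G => c).
  by move=> g; exact: cvg_cst.
rewrite -[in RHS](avg_cst G_hausdorff mH c df) -(bint_linear G_hausdorff mH Llin LC cL cfH).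
rewrite /avg -(bintD G_hausdorff mH (ccs_comp cL (linear_prop0 Llin) cfH) (ccsZ cf cst_c)).
by congr bint; apply/funext => g; rewrite scalerDr /= (linear_propZ Llin).
Qed.

Section compact_neighbourhood.
Context (S : set G) (S_compact : compact S) (S_nbhs : nbhs (1%g : G) S).

(** By left invariance the translation moves from F to f. Uniform continuity makes
    f (h^-1 g) - f g small, and this difference is supported in S K, which has finite
    measure. Note that V does not depend on F nor on the space E: smoothing by f makes
    a sequence of actions equicontinuous. *)
Lemma bint_translate_close (f : G -> R) (e : R) : ccs f -> 0 < e ->
  exists2 V : set G, nbhs (1%g : G) V & forall h, V h ->
    forall (E : completeNormedModType R) (F : G -> E) (M : R),
    continuous F -> 0 <= M ->
    (forall g, f g != 0 \/ f (h^-1 * g)%g != 0 -> `|F g| <= M) ->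
    `|bint (fun g => f g *: F (h * g)%g) - bint (fun g => f g *: F g)| <= e * M.
Proof.
move=> cf e0; have [fc [K cK fK]] := cf.
pose SK : set G := [set (a.1 * a.2)%g | a in S `*` K].
have cSK : compact SK.
  apply: continuous_compact; last exact: compact_setX.
  by apply: continuous_subspaceT; exact: mulg_continuous.
have mSK : measurable (SK : set (borel G)) by exact: compact_borel.
pose k := fine (m SK); have k0 : 0 <= k by exact: fine_ge0.
have kE : m SK = k%:E by rewrite fineK// ge0_fin_numE// (haar_compact mH).
pose n := e / (k + 1); have n0 : 0 < n by rewrite divr_gt0// ltr_wpDl.
have /compact_near_coveringP Kcov := cSK.
have unif : \forall h \near (1%g : G), SK `<=` [set g | `|f (h^-1 * g)%g - f g| < n].
  apply: (Kcov _ _ (fun h g => `|f (h^-1 * g)%g - f g| < n)) => g _.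
  pose D (a : G * G) := f (a.2^-1 * a.1)%g - f a.1.
  have cD : continuous D.
    move=> a; apply: cvgB; last first.
      by apply: (@continuous_comp _ _ _ fst f); [exact: cvg_fst|exact: fc].
    apply: (@continuous_comp _ _ _ (fun a : G * G => (a.2^-1 * a.1)%g) f); last exact: fc.
    apply: (@continuous_comp _ _ _ (fun a : G * G => ((a.2^-1)%g, a.1))
      (fun a : G * G => (a.1 * a.2)%g)); last exact: mulg_continuous.
    apply: cvg_pair; last exact: cvg_fst.
    by apply: (@continuous_comp _ _ _ snd (fun g : G => g^-1%g));
      [exact: cvg_snd|exact: invg_continuous].
  have D0 : D (g, 1%g) = 0 by rewrite /D/= invg1 mul1g subrr.
  have := cD (g, 1%g); rewrite /continuous_at D0 => /cvgr0_norm_lt /(_ _ n0).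
  exact.
exists ([set h | SK `<=` [set g | `|f (h^-1 * g)%g - f g| < n]] `&` S); first exact: filterI.
move=> h [hSK Sh] E F M cF M0 FM.
have cfh : ccs (fun g => f (h^-1 * g)%g) by exact: ccs_translate.
have cFh : continuous (fun g => F (h * g)%g).
  by move=> g; apply: continuous_comp; [exact: mulg_continuousl|exact: cF].
have -> : bint (fun g => f g *: F (h * g)%g) = bint (fun g => f (h^-1 * g)%g *: F g).
  rewrite -(bint_translate G_hausdorff mH h (ccsZ cfh cF)); congr bint.
  by apply/funext => g; rewrite mulgA mulVg mul1g.
pose D g := f (h^-1 * g)%g - f g.
have cD : ccs D.
  have := ccsD cfh (ccs_comp (L := fun r : R => - r) _ _ cf); apply.
    exact: oppr_continuous.
  exact: oppr0.
have -> : bint (fun g => f (h^-1 * g)%g *: F g) =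
    bint (fun g => D g *: F g) + bint (fun g => f g *: F g).
  rewrite -(bintD G_hausdorff mH (ccsZ cD cF) (ccsZ cf cF)).
  by congr bint; apply/funext => g; rewrite -scalerDl subrK.
rewrite addrK -lee_fin.
have supp g : f g != 0 \/ f (h^-1 * g)%g != 0 -> SK g.
  case=> [/fK Kg|/fK Khg]; last by exists (h, (h^-1 * g)%g) => //=; rewrite mulgA mulgV mul1g.
  by exists (1%g, g) => /=; [split => //; exact: nbhs_singleton|rewrite mul1g].
apply: le_trans (bint_norm_le G_hausdorff mH (phi := fun g => n * M * \1_SK g) _ _ _) _ => //.
- exact: ccsZ.
- by apply: measurable_funM => //; exact: measurable_indic.
- move=> g; rewrite normrZ /D.
  have [f0|f0] := pselect (f g != 0 \/ f (h^-1 * g)%g != 0); last first.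
    have /eqP -> : f g == 0 by apply/negP => /negP ?; apply: f0; left.
    have /eqP -> : f (h^-1 * g)%g == 0 by apply/negP => /negP ?; apply: f0; right.
    by rewrite subrr normr0 mul0r mulr_ge0// mulr_ge0// ltW.
  rewrite indicE mem_set ?mulr1; last exact: supp.
  by rewrite ler_pM//; [rewrite ltW// hSK//; exact: supp|exact: FM].
under eq_integral do rewrite EFinM.
rewrite ge0_integralZl_EFin//; last 2 first.
- by apply/measurable_EFinP; exact: measurable_indic.
- by rewrite mulr_ge0// ltW.
rewrite integral_indic// setIT kE -EFinM lee_fin mulrAC ler_wpM2r//.
by rewrite /n mulrAC ler_pdivrMr ?ltr_wpDl// ler_pM2l// lerDl.
Qed.

(** Otherwise finitely many translates of O, hence every compact set, and by inner
    regularity the whole group, would have measure 0. *)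
Lemma haar_open_gt0 (O : set G) : open O -> O 1%g -> (0 < m O)%E.
Proof.
move=> oO O1; rewrite lt0e measure_ge0 andbT; apply/eqP => mO.
apply: (haar_neq0 mH); rewrite (haar_inner_regular mH openT).
have mO' : measurable (O : set (borel G)) by exact: open_borel.
have K0 (K : set G) : compact K -> m K = 0%E.
  move=> cK; pose good (B : set G) := open B /\ m B = 0%E.
  have [|B B' [oB mB] [oB' mB']|x Kx|B [oB mB] KB] := @compact_cover_ind G K good cK.
  - by split; [exact: open0|exact: measure0].
  - split; first exact: openU.
    apply/eqP; rewrite eq_le measure_ge0 andbT.
    apply: le_trans (measureU2 m (open_borel oB) (open_borel oB')) _.
    by rewrite [X in (X + _)%E]mB [X in (_ + X)%E]mB' adde0.
  - exists [set g | O (x^-1 * g)%g].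
      have oO' : open [set g | O (x^-1 * g)%g].
        by apply: open_comp oO => y _; exact: mulg_continuousl.
      split=> //; rewrite -(haar_invariant mH x^-1%g (open_borel oO')) -[RHS]mO.
      congr (m _); apply/seteqP; split=> [_ [y Oy <-]//|y Oy].
      by exists (x * y)%g; rewrite /= mulgA mulVg mul1g.
    by apply: near_translate; exact: open_nbhs_nbhs.
  - apply/eqP; rewrite eq_le measure_ge0 andbT -[X in (_ <= X)%E]mB.
    by apply: le_measure; rewrite ?inE//; [exact: compact_borel|exact: open_borel].
apply/eqP; rewrite eq_le; apply/andP; split.
  by apply: ub_ereal_sup => _ [K [cK _] <-]; rewrite K0.
apply: ereal_sup_ubound; exists set0; last exact: measure0.
by split; [exact: compact0|].
Qed.

Lemma density_exists (V : set G) : locally_compact [set: G] ->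
  nbhs (1%g : G) V -> exists f, density V f.
Proof.
move=> lc nV; have nVS : nbhs (1%g : G) (V `&` S)° by apply: nbhs_interior; exact: filterI.
have sep : uniform_separator [set (1%g : G)] (~` (V `&` S)°).
  apply: (locally_compact_completely_regular (R := R) lc G_hausdorff).
    by rewrite closedC; exact: open_interior.
  by move=> /(_ (nbhs_singleton nVS)).
have [u [cu u01 u1 uC]] := proj1 (@uniform_separatorP G R _ _) sep.
pose f g := 1 - u g.
have f0 g : 0 <= f g.
  by have /u01 : range u (u g) by []; rewrite /= in_itv/= subr_ge0 => /andP[].
have fV g : f g != 0 -> (V `&` S)° g.
  move=> /eqP fg; apply: contrapT => nVSg; apply: fg.
  have : [set u x | x in ~` (V `&` S)°] (u g) by exists g.
  by move=> /uC /= ug; rewrite /f ug subrr.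
have f1 : f 1%g = 1.
  have : [set u x | x in [set 1%g]] (u 1%g) by exists 1%g.
  by move=> /u1 /=; rewrite /f => ->; rewrite subr0.
have cf : continuous f by move=> g; apply: cvgB; [exact: cvg_cst|exact: cu].
have ccf : ccs f.
  by split=> //; exists S => // g /fV /interior_subset[].
have int_gt0 : 0 < bint f.
  rewrite -lte_fin -(bint_real G_hausdorff mH ccf).
  pose O := [set g | 2^-1 < f g].
  have oO : open O.
    rewrite (_ : O = f @^-1` [set r | 2^-1 < r])//.
    by apply: open_comp => [x _|]; [exact: cf|exact: open_gt].
  have mO : measurable (O : set (borel G)) by exact: open_borel.
  apply: (@lt_le_trans _ _ (2^-1%:E * m O)%E).
    rewrite mule_gt0// ?lte_fin ?invr_gt0//.
    by apply: haar_open_gt0 => //; rewrite /O/= f1; lra.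
  have := integral_indic m measurableT mO; rewrite setIT => <-.
  rewrite -ge0_integralZl_EFin//; last by apply/measurable_EFinP; exact: measurable_indic.
  apply: ge0_le_integral => //.
  - by apply/measurable_EFinP/measurable_funM => //; exact: measurable_indic.
  - by apply/measurable_EFinP; exact: continuous_borel.
  move=> g _; rewrite -EFinM lee_fin indicE.
  have [Og|nOg] := pselect (O g); first by rewrite mem_set// mulr1 ltW.
  by rewrite memNset// mulr0.
have cs : continuous (fun r : R => (bint f)^-1 * r) by exact: mulrl_continuous.
exists (fun g => (bint f)^-1 * f g); split.
- exact: (ccs_comp cs (mulr0 _) ccf).
- by move=> g; rewrite mulr_ge0// invr_ge0 ltW.
- move=> g; have [->|/fV /interior_subset[]//] := eqVneq (f g) 0.
  by rewrite mulr0 eqxx.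
rewrite (bint_linear G_hausdorff mH (L := fun r : R => (bint f)^-1 * r)
  (C := `|(bint f)^-1|) _ _ cs ccf).
- by rewrite mulVf// gt_eqF.
- by move=> k a b; rewrite mulrDr mulrCA.
- by move=> r; rewrite normrM.
Qed.

End compact_neighbourhood.
End approximate_identities.

(** * Averaging over affine isometric actions *)

Section affine_actions.
Context (R : realType) (G : topologicalGroupType).

Record affine_isometric_action (E : completeNormedModType R) (s : G -> E -> E) :
  Prop := AffineIsometricAction {
  aff_action : isometric_action (s : G -> normed_metric E -> normed_metric E) ;
  aff_continuous : forall x, continuous (fun g => s g x) ;
  aff_linear : forall g, linear (fun x => s g x - s g 0) }.

Definition linear_part (E : completeNormedModType R) (s : G -> E -> E) g x : E :=
  s g x - s g 0.

Section one_space.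
Context (E : completeNormedModType R) (s : G -> E -> E).
Hypothesis sA : affine_isometric_action s.
Local Notation pi := (linear_part s).

Lemma aff1 x : s 1%g x = x. Proof. exact: (iact1 (aff_action sA)). Qed.

Lemma affM g h x : s (g * h)%g x = s g (s h x).
Proof. exact: (iactM (aff_action sA)). Qed.

Lemma aff_norm g x y : `|s g x - s g y| = `|x - y|.
Proof. exact: (iact_dist (aff_action sA) g x y). Qed.

Lemma affE g x : s g x = pi g x + s g 0.
Proof. by rewrite /linear_part subrK. Qed.

Lemma pi_linear g : linear (pi g). Proof. exact: aff_linear. Qed.

Lemma pi_norm g x : `|pi g x| = `|x|.
Proof. by rewrite /linear_part aff_norm subr0. Qed.

Lemma aff_sub g x y : s g x - s g y = pi g (x - y).
Proof. by rewrite (linear_propB (pi_linear g)) /linear_part opprB addrA subrK. Qed.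

Lemma pi_continuous g : continuous (pi g).
Proof.
move=> x; apply/cvgrPdist_lt => e e0; near=> y.
rewrite -(linear_propB (pi_linear g)) pi_norm.
by near: y; exact: cvgr_dist_lt.
Unshelve. all: by end_near. Qed.

Lemma linear_part_representation : isometric_representation pi.
Proof.
split.
- by move=> x; rewrite /linear_part !aff1 subr0.
- move=> g h x; rewrite {1}/linear_part !affM aff_sub; congr (pi g _).
- exact: pi_linear.
- exact: pi_norm.
- move=> x g; apply: cvgB; exact: aff_continuous.
Qed.

Lemma aff_continuousV x : continuous (fun g => s g^-1%g x).
Proof.
move=> g; apply: (@continuous_comp _ _ _ (fun g : G => g^-1%g) (fun g => s g x)).
  exact: invg_continuous.
exact: aff_continuous.
Qed.

Lemma aff_normV g x y : `|s g^-1%g x - y| = `|s g y - x|.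
Proof. by rewrite -(aff_norm g) -affM mulgV aff1 distrC. Qed.

Hypothesis G_hausdorff : hausdorff_space G.
Context (m : {measure set (borel G) -> \bar R}) (mH : haar_measure m).
Local Notation avg := (avg m).

(** Precomposing this average with the action of h translates the weight f on the left.
    The average of s g x itself would lead to right translates of f, over which a left
    Haar measure gives no direct control. *)
Definition inv_average (f : G -> R) (x : E) : E := avg f (fun g => s g^-1%g x).

Section density.
Context (V : set G) (f : G -> R) (df : density m V f).

Lemma inv_average_affine : exists (L : E -> E) (c : E),
  [/\ linear L, forall x, `|L x| <= 1 * `|x|, continuous L &
      forall x, inv_average f x = L x + c].
Proof.
have cpi x : continuous (fun g => pi g^-1%g x).
  move=> g; apply: cvgB; exact: aff_continuousV.
pose L x := avg f (fun g => pi g^-1%g x).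
have cf := density_ccs df.
have Ln x : `|L x| <= 1 * `|x|.
  rewrite mul1r -[L x]subr0; apply: (avg_near G_hausdorff mH df) => // g _.
  by rewrite subr0 pi_norm.
have Ll : linear L.
  move=> k x y; rewrite /L.
  have kE : k *: avg f (fun g => pi g^-1%g x) = avg f (fun g => k *: pi g^-1%g x).
    have kl : linear (fun x : E => k *: x) by exact: linear_scale.
    have kc : continuous (fun x : E => k *: x).
      by move=> z; apply: cvgZ; [exact: cvg_cst|exact: cvg_id].
    have := avg_affine G_hausdorff mH (C := `|k|) 0 df kl _ kc (cpi x).
    under [in avg _ _]eq_fun do rewrite addr0.
    by rewrite addr0 => -> // z; rewrite normrZ.
  rewrite kE [RHS](_ : _ = bint m (fun g => f g *: (k *: pi g^-1%g x) + f g *: pi g^-1%g y)).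
    congr (bint m _); apply/funext => g; rewrite -scalerDr; congr (_ *: _).
    exact: pi_linear.
  rewrite bintD//; last exact: ccsZ.
  by apply: ccsZ => // g; apply: cvgZ; [exact: cvg_cst|exact: cpi].
exists L, (avg f (fun g => s g^-1%g 0)); split=> //.
  move=> x; apply/cvgrPdist_lt => e e0; near=> y.
  rewrite -(linear_propB Ll); apply: le_lt_trans (Ln _) _; rewrite mul1r.
  by near: y; exact: cvgr_dist_lt.
move=> x; have cf1 := ccsZ cf (cpi x); have cf2 := ccsZ cf (@aff_continuousV 0).
rewrite /L /avg -(bintD G_hausdorff mH cf1 cf2).
by congr (bint m _); apply/funext => g; rewrite -scalerDr -affE.
Unshelve. all: by end_near. Qed.

Lemma inv_average_dist x y : `|inv_average f x - inv_average f y| <= `|x - y|.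
Proof.
apply: (avg_dist_le G_hausdorff mH df); [exact: aff_continuousV..|].
by move=> g _; rewrite aff_norm.
Qed.

Lemma inv_average_near x e : (forall g, V g -> `|s g x - x| <= e) ->
  `|inv_average f x - x| <= e.
Proof.
move=> Ve; apply: (avg_near G_hausdorff mH df); first exact: aff_continuousV.
by move=> g Vg; rewrite aff_normV; exact: Ve.
Qed.

End density.

Lemma aff_average V f h : density m V f ->
  s h (avg f (fun g => s g 0)) = avg f (fun g => s (h * g)%g 0).
Proof.
move=> df; have c0 : continuous (fun g => s g 0) by exact: aff_continuous.
rewrite affE -(avg_affine G_hausdorff mH (C := 1) _ df (pi_linear h) _ (@pi_continuous h) c0).
  by congr avg; apply/funext => g; rewrite -affE affM.
by move=> x; rewrite pi_norm mul1r.
Qed.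

End one_space.

Section uniform_estimates.
Hypothesis G_hausdorff : hausdorff_space G.
Context (m : {measure set (borel G) -> \bar R}) (mH : haar_measure m).
Context (S : set G) (S_compact : compact S) (S_nbhs : nbhs (1%g : G) S)
  (S_symmetric : symmetric_set S).
Local Notation avg := (avg m).

Lemma norm_orbit_le (E : completeNormedModType R) (s : G -> E -> E) g h :
  affine_isometric_action s -> (forall h, S h -> `|s h 0| <= 1) ->
  S g -> S h -> `|s (g * h)%g 0| <= 2.
Proof.
move=> sA sS Sg Sh; rewrite (affM sA) -[s g _](subrK (s g 0)).
apply: le_trans (ler_normD _ _) _; rewrite (aff_norm sA) subr0.
by have := sS _ Sg; have := sS _ Sh; lra.
Qed.

(** The averaged point has an orbit map whose modulus of continuity at 1 depends on f
    only, whatever the action. *)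
Lemma average_translate (f : G -> R) e : density m S f -> 0 < e ->
  exists2 V : set G, nbhs (1%g : G) V & forall h, V h ->
    forall (E : completeNormedModType R) (s : G -> E -> E),
    affine_isometric_action s -> (forall h, S h -> `|s h 0| <= 1) ->
    `|s h (avg f (fun g => s g 0)) - avg f (fun g => s g 0)| <= e.
Proof.
move=> df e0; have e20 : 0 < e / 2 by rewrite divr_gt0.
have [V nV VP] := bint_translate_close G_hausdorff mH S_compact S_nbhs (density_ccs df) e20.
exists (V `&` S); first exact: filterI.
move=> h [Vh Sh] E s sA sS; rewrite (aff_average sA G_hausdorff mH h df).
have := VP h Vh E (fun g => s g 0) 2 (aff_continuous sA (x:=0)) (ler0n _ _).
rewrite divfK//; apply => g [fg|fg].
  by rewrite (le_trans (sS _ (density_supp df fg)))// ler1n.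
have -> : g = (h * (h^-1 * g))%g by rewrite mulgA mulgV mul1g.
by apply: norm_orbit_le sA sS Sh _; exact: (density_supp df fg).
Qed.

(** The norm bound 3 used for the values s g^-1 x comes from |x| <= 1 and from the
    fact that g is in S or in h^-1 S. *)
Lemma inv_average_shift (f : G -> R) e : density m S f -> 0 < e ->
  exists2 V : set G, nbhs (1%g : G) V & forall h, V h ->
    forall (E : completeNormedModType R) (s : G -> E -> E) (x : E),
    affine_isometric_action s -> (forall h, S h -> `|s h 0| <= 1) -> `|x| <= 1 ->
    `|inv_average s m f (s h x) - inv_average s m f x| <= e.
Proof.
move=> df e0; have e30 : 0 < e / 3 by rewrite divr_gt0.
have [V nV VP] := bint_translate_close G_hausdorff mH S_compact S_nbhs (density_ccs df) e30.
exists ([set h | V h^-1%g] `&` S).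
  apply: filterI => //; have := @invg_continuous G 1%g.
  by rewrite /continuous_at invg1; apply.
move=> h [Vh Sh] E s x sA sS x1.
have := VP h^-1%g Vh E (fun g => s g^-1%g x) 3 (aff_continuousV sA (x:=x)) (ler0n _ _).
rewrite divfK// /inv_average /avg.
under [X in bint _ X]eq_fun do rewrite invgM invgK (affM sA).
apply => g fg.
rewrite -[s _ _](subrK (s g^-1%g 0)); apply: le_trans (ler_normD _ _) _.
rewrite (aff_norm sA) subr0.
suff : `|s g^-1%g 0| <= 2 by move: x1; lra.
case: fg => [fg|fg].
  rewrite (le_trans (sS _ (S_symmetric (density_supp df fg))))// ler1n//.
have Shg := density_supp df fg; rewrite invgK in Shg.
have -> : (g^-1 = (h * g)^-1 * h)%g by rewrite invgM -mulgA mulVg mulg1.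
by apply: norm_orbit_le sA sS _ Sh; exact: S_symmetric.
Qed.

End uniform_estimates.

Lemma pi_average_near (E : completeNormedModType R) (s : G -> E -> E)
    (m : {measure set (borel G) -> \bar R}) V f x e :
  hausdorff_space G -> haar_measure m -> affine_isometric_action s ->
  density m V f -> (forall g, V g -> `|linear_part s g x - x| <= e) ->
  `|bint m (fun g => f g *: linear_part s g x) - x| <= e.
Proof.
move=> Gh mH sA df Ve; apply: (avg_near Gh mH df _ Ve) => g.
exact: (repr_strongly_continuous (linear_part_representation sA)).
Qed.

End affine_actions.

(** * Smoothing in Banach ultraproducts *)

Section banach_ultraproduct_dist.
Context (R : realType) (U : free_ultrafilter) (E : nat -> completeNormedModType R).
Implicit Types x y : banach_seq E.

Lemma to_banach_seqP (y : forall i, E i) : (exists M, forall i, `|y i| <= M) ->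
  exists M : R, forall i, @mdist R (normed_metric (E i)) (0 : E i) (y i) <= M.
Proof.
by move=> [M yM]; exists M => i; rewrite normed_mdistE sub0r normrN.
Qed.

Definition to_banach_seq (y : forall i, E i) (yM : exists M, forall i, `|y i| <= M) :
  banach_seq E := BoundedSeq (to_banach_seqP yM).

Lemma banach_class_dist x y : `|banach_class U x - banach_class U y| =
  @mdist R (ultraproduct U _) (banach_class U x) (banach_class U y).
Proof. by rewrite banach_ultra_distE distrC. Qed.

Lemma banach_class_lt x y e : `|banach_class U x - banach_class U y| < e ->
  \forall i \near ultra_set U, `|banach_seq_val x i - banach_seq_val y i| < e.
Proof. by rewrite banach_class_dist => /ultraproduct_lt. Qed.

Lemma banach_class_le x y e :
  (\forall i \near ultra_set U, `|banach_seq_val x i - banach_seq_val y i| <= e) ->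
  `|banach_class U x - banach_class U y| <= e.
Proof.
rewrite banach_class_dist => xy.
exact: (@ultraproduct_le R U (fun i => normed_metric (E i)) (fun i => 0 : E i) x y e xy).
Qed.

Lemma banach_class_ext x y : (forall i, banach_seq_val x i = banach_seq_val y i) ->
  banach_class U x = banach_class U y.
Proof.
move=> xy; apply/eqP; rewrite -subr_eq0 -normr_le0; apply: banach_class_le.
by apply: nearW => i; rewrite xy subrr normr0.
Qed.

Lemma banach_reprK (a : banach_ultraproduct U E) :
  exists x : banach_seq E, a = banach_class U x.
Proof. by exists (ultra_repr a); rewrite [RHS]ultra_reprK. Qed.

End banach_ultraproduct_dist.

Section banach_limit.
Context (R : realType) (U : free_ultrafilter) (G : topologicalGroupType).
Hypotheses (G_hausdorff : hausdorff_space G)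
  (G_locally_compact : locally_compact [set: G]).
Context (m : {measure set (borel G) -> \bar R}) (mH : haar_measure m).
Context (S : set G) (S_compact : compact S) (S_nbhs : nbhs (1%g : G) S)
  (S_symmetric : symmetric_set S) (S_generates : generates S).
Context (E : nat -> completeNormedModType R) (s : forall i, G -> E i -> E i).
Arguments s : clear implicits.
Hypotheses (sA : forall i, affine_isometric_action (s i))
  (sS : forall i h, S h -> `|s i h 0| <= 1).
Local Notation pi := (fun i => linear_part (s i)).
Local Notation F := (banach_ultraproduct U E).
Local Notation cls := (banach_class U).
Local Notation val := banach_seq_val.

(** The family t is either the family s of affine actions or that of their linear
    parts: equicontinuous vectors for the latter are differences of equicontinuous
    points for the former. *)
Definition eqc (t : forall i, G -> E i -> E i) (x : banach_seq E) :=
  @equicontinuous R U G (fun i => normed_metric (E i)) t (val x).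

Lemma pi_action i : isometric_action
  (linear_part (s i) : G -> normed_metric (E i) -> normed_metric (E i)).
Proof.
have [p1 pM pL pN _] := linear_part_representation (sA i); split=> // g x y.
by rewrite !normed_mdistE -(linear_propB (pL g)) pN.
Qed.

Lemma eqc_limit (t : forall i, G -> E i -> E i) (x : banach_seq E) :
  (forall i, isometric_action (t i : G -> normed_metric (E i) -> normed_metric (E i))) ->
  (forall e, 0 < e -> exists2 y, eqc t y & `|cls x - cls y| < e) -> eqc t x.
Proof.
move=> tA xcl; refine (@equicontinuous_closed R U G (fun i => normed_metric (E i))
  (fun i => 0 : E i) t tA x _).
by move=> e /xcl[y yeq]; rewrite banach_class_dist => xy; exists y.
Qed.

Lemma eqc_ext (t : forall i, G -> E i -> E i) (x y : banach_seq E) :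
  (forall i, isometric_action (t i : G -> normed_metric (E i) -> normed_metric (E i))) ->
  cls x = cls y -> eqc t y -> eqc t x.
Proof.
move=> tA xy yeq; apply: (eqc_limit tA) => e e0.
by exists y => //; rewrite xy subrr normr0.
Qed.

Lemma orbit_bounded g : exists b, forall i,
  @mdist R (normed_metric (E i)) (s i g (0 : E i)) (0 : E i) <= b.
Proof.
have [n Sg] := set_pow_total S_symmetric S_generates g.
exists (n%:R * 1) => i.
have S1 h : S h -> @mdist R (normed_metric (E i)) (s i h (0 : E i)) (0 : E i) <= 1.
  by rewrite normed_mdistE subr0; exact: sS.
exact: (mdist_set_pow (aff_action (sA i)) S1 Sg).
Qed.

Definition limit_act : G -> F -> F :=
  @ultra_act R U G (fun i => normed_metric (E i)) (fun i => (0 : E i)) s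
    (fun i => aff_action (sA i)) orbit_bounded.

Lemma limit_act_isometric : isometric_action
  (limit_act : G -> ultraproduct U _ -> ultraproduct U _).
Proof. exact: ultra_act_isometric. Qed.

Lemma limit_act_norm g (a b : F) : `|limit_act g a - limit_act g b| = `|a - b|.
Proof.
have [[x ->] [y ->]] := (banach_reprK a, banach_reprK b).
have [[x' xE] [y' yE]] := (banach_reprK (limit_act g (cls x)), banach_reprK (limit_act g (cls y))).
rewrite xE yE !banach_class_dist -xE -yE; exact: (iact_dist limit_act_isometric).
Qed.

Lemma limit_actE g (x : banach_seq E) : exists2 y : banach_seq E,
  limit_act g (cls x) = cls y & forall i, val y i = s i g (val x i).
Proof.
rewrite /limit_act; have := @ultra_actE R U G (fun i => normed_metric (E i))
  (fun i => 0 : E i) s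
  (fun i => aff_action (sA i)) orbit_bounded g x => ->.
by eexists; [reflexivity|].
Qed.

(** Weights inside S keep these averages in the unit ball, because S moves 0 by at
    most 1. *)
Definition smoothings (V : set G) : set F := [set a | exists f (y : banach_seq E),
  [/\ density m (V `&` S) f, a = cls y &
      forall i, val y i = avg m f (fun g => s i g 0)]].

Lemma norm_average_le f i : density m S f -> `|avg m f (fun g => s i g 0)| <= 1.
Proof.
move=> df; rewrite -[X in `|X|]subr0; apply: (avg_near G_hausdorff mH df).
  exact: aff_continuous.
by move=> g Sg; rewrite subr0; exact: sS.
Qed.

Lemma smoothings_eqc V (y : banach_seq E) : smoothings V (cls y) -> eqc s y.
Proof.
move=> [f [y' [df yy' y'E]]].
apply: (eqc_ext (fun i => aff_action (sA i)) yy') => e e0.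
have dS : density m S f by apply: densityW df; exact: subIsetr.
have [W nW WP] := average_translate G_hausdorff mH S_compact S_nbhs dS e0.
exists W => //; apply: nearW => i g Wg.
by rewrite normed_mdistE y'E; apply: WP => //; exact: sS.
Qed.

Lemma smoothings_mid V a b : smoothings V a -> smoothings V b ->
  smoothings V (a + 2^-1 *: (b - a)).
Proof.
move=> [f [x [df -> xE]]] [f' [y [df' -> yE]]].
pose h g := 2^-1 * (f g + f' g).
have dh : density m (V `&` S) h by exact: density_mid.
exists h; rewrite -scaleN1r.
exists (banach_add x (banach_scale 2^-1 (banach_add y (banach_scale (-1) x)))).
split => //; first by rewrite -banach_classD -banach_classZ -banach_classD -banach_classZ.
move=> i; rewrite /= xE yE scaleN1r.
have cs := aff_continuous (sA i) (x := 0).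
have cf := ccsZ (density_ccs df) cs; have cf' := ccsZ (density_ccs df') cs.
have c2 : continuous (fun z : E i => 2^-1 *: z).
  by move=> z; apply: cvgZ; [exact: cvg_cst|exact: cvg_id].
have -> : avg m h (fun g => s i g 0) =
    2^-1 *: bint m (fun g => f g *: s i g 0 + f' g *: s i g 0).
  rewrite -(bint_linear G_hausdorff mH (C := `|2^-1|)
    (@linear_scale R (E i) 2^-1) _ c2 (ccsD cf cf')).
    by congr bint; apply/funext => g /=; rewrite -scalerDl scalerA.
  by move=> z; rewrite normrZ.
rewrite (bintD G_hausdorff mH cf cf') -/(avg m f _) -/(avg m f' _).
exact: midpointE.
Qed.

Lemma smoothings_bounded V a : smoothings V a -> `|a| <= 1.
Proof.
move=> [f [y [df -> yE]]].
have dS : density m S f by apply: densityW df; exact: subIsetr.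
have z0 : exists M : R, forall i, `|0 : E i| <= M by exists 0 => i; rewrite normr0.
have c0 : cls (to_banach_seq z0) = 0 by exact: banach_class_ext.
rewrite -[a in `|a|]subr0 -c0; apply: banach_class_le; apply: nearW => i.
by rewrite /= subr0 yE; exact: norm_average_le.
Qed.

(** As V shrinks, the sets of smoothings form a filter base of bounded convex sets,
    whose elements of almost minimal norm converge by uniform convexity. The limit is
    adherent to all of them, as a weak limit point would be. *)
Lemma smoothings_limit p c : 0 < p -> 0 < c ->
  uniformly_convex p c (normed_metric F) ->
  exists w : F, forall V e, nbhs (1%g : G) V -> 0 < e ->
    exists2 a, smoothings V a & `|w - a| < e.
Proof.
move=> p0 c0 [[cF _] Fconv].
pose C : set (set (normed_metric F)) := [set smoothings V | V in nbhs (1%g : G)].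
have [||||A [V nV <-]|_ x y [V nV <-]|w [N [near _]]] :=
  @near_minimisers R (normed_metric F) p (c / 4) 1 C (fun a : F => `|a| `^ p) cF (ltW p0).
- by rewrite divr_gt0.
- by exists (smoothings setT), setT => //; exact: filterT.
- move=> _ _ [V nV <-] [W nW <-]; exists (smoothings (V `&` W)).
    by exists (V `&` W) => //; exact: filterI.
  move=> a [f [y [df aE yE]]]; split; exists f, y; split=> //;
    by apply: densityW df => g [[]].
- by move=> a; exact: powR_ge0.
- have [f df] := density_exists G_hausdorff mH S_compact S_nbhs G_locally_compact
    (filterI nV S_nbhs).
  have dS : density m S f by apply: densityW df; exact: subIsetr.
  have yM : exists M : R, forall i, `|avg m f (fun g => s i g 0)| <= M.
    by exists 1 => i; exact: norm_average_le.
  have Ca : smoothings V (cls (to_banach_seq yM)) by exists f, (to_banach_seq yM).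
  exists (cls (to_banach_seq yM)) => //.
  have := smoothings_bounded Ca => /(@ge0_ler_powR _ p (ltW p0)).
  by rewrite powR1; apply; rewrite nnegrE.
- move=> Vx Vy; exists (x + 2^-1 *: (y - x) : F); first exact: smoothings_mid.
  have nz u : @mdist R (normed_metric F) (0 : F) u = `|u : F|.
    by rewrite normed_mdistE sub0r normrN.
  have := Fconv x y (0 : F) _ 2^-1 (@segment_geodesic R F x y) (half_in01 R).
  rewrite !nz /=.
  move: (mdist x y `^ p) (`|x : F| `^ p) (`|y : F| `^ p) => dxy nx ny.
  by move: (_ `^ p) => nm; lra.
exists w => V e nV e0; have [|x [Vx wx _]] := near (smoothings V) e _ e0.
  by exists V.
by exists x.
Qed.

Section limit_point.
Context (w : F).
Hypothesis w_limit : forall V e, nbhs (1%g : G) V -> 0 < e ->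
  exists2 a, smoothings V a & `|w - a| < e.

Lemma limit_point_eqc (x : banach_seq E) : w = cls x -> eqc s x.
Proof.
move=> wx; apply: (eqc_limit (fun i => aff_action (sA i))) => e e0.
have [a Va wa] := w_limit filterT e0; have [y aE] := banach_reprK a.
by exists y; [by apply: (@smoothings_eqc setT); rewrite -aE|rewrite -wx -aE].
Qed.

(** w plays the role of a canonical projection of the base point 0 to the
    equicontinuous points. It is a limit of smoothings z of 0. For Q the average over
    inverses against a weight carried near 1, Q fixes w and t w up to e, because these
    are equicontinuous; and if the weight of z is carried much closer to 1, then Q z
    and Q 0 are e-close, and so are Q (t z) and Q (t 0). Since Q does not increase
    distances, t w and w are no further apart than t 0 and 0, up to errors. *)
Lemma limit_point_displacement t : S t -> `|limit_act t w - w| <= 1.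
Proof.
move=> St; have [x wx] := banach_reprK w; rewrite wx.
have [y -> yE] := limit_actE t x.
have xeq := limit_point_eqc wx.
have yeq : eqc s y.
  move=> e /(equicontinuous_act (fun i => aff_action (sA i)) t xeq)[V nV xV].
  by exists V => //; apply: filterS xV => i xi g /xi; rewrite yE.
apply/ler_addgt0Pl => e e0; have e60 : 0 < e / 6 by rewrite divr_gt0.
have [V nV xV] := xeq _ e60; have [V' nV' yV'] := yeq _ e60.
have nVV : nbhs (1%g : G) ((V `&` V') `&` S) by apply: filterI => //; exact: filterI.
have [f df] := density_exists G_hausdorff mH S_compact S_nbhs G_locally_compact nVV.
have dfS : density m S f by apply: densityW df; exact: subIsetr.
have dfV : density m V f by apply: densityW df => g [[]].
have dfV' : density m V' f by apply: densityW df => g [[]].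
have [W nW WP] := inv_average_shift G_hausdorff mH S_compact S_nbhs S_symmetric dfS e60.
pose W' : set G := W `&` [set h | W (t * h * t^-1)%g].
have nW' : nbhs (1%g : G) W'.
  by apply: filterI => //; exact: near_conj.
have [a [f' [z [df' aE zE]]] wa] := w_limit nW' e60.
apply: banach_class_le.
move: wa; rewrite wx aE => /banach_class_lt wz.
apply: filterS (filterI (filterI xV yV') wz) => i [[xVi yVi] wzi].
pose Q := inv_average (s i) m f; rewrite yE.
have Qx : `|Q (val x i) - val x i| <= e / 6.
  exact: (inv_average_near (sA i) G_hausdorff mH dfV).
have Qy : `|Q (s i t (val x i)) - s i t (val x i)| <= e / 6.
  apply: (inv_average_near (sA i) G_hausdorff mH dfV') => g /yVi.
  by rewrite yE.
have Qd := inv_average_dist (sA i) G_hausdorff mH df.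
have [L [c [Ll LC cL QE]]] := inv_average_affine (sA i) G_hausdorff mH df.
have c0 : continuous (fun g => s i g 0) by exact: aff_continuous.
have cLs : continuous (L \o (fun g => s i g 0)).
  by move=> g; apply: continuous_comp; [exact: c0|exact: cL].
have dfW : density m W' f' by apply: densityW df'; exact: subIsetl.
have Qz : `|Q (val z i) - Q 0| <= e / 6.
  rewrite zE /Q (QE (avg m f' _)) -(avg_affine G_hausdorff mH c df' Ll LC cL c0).
  apply: (avg_near G_hausdorff mH dfW) => [g|g [Wg _]].
    by apply: cvgD; [exact: cLs|exact: cvg_cst].
  rewrite -QE; apply: WP => //; [exact: sS|by rewrite normr0].
have Qtz : `|Q (s i t (val z i)) - Q (s i t 0)| <= e / 6.
  have cpt : continuous (L \o linear_part (s i) t).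
    by move=> u; apply: continuous_comp; [exact: (pi_continuous (sA i))|exact: cL].
  have cLts : continuous ((L \o linear_part (s i) t) \o (fun g => s i g 0)).
    by move=> g; apply: continuous_comp; [exact: c0|exact: cpt].
  have lpt : linear (L \o linear_part (s i) t).
    by move=> k u v; rewrite /= (pi_linear (sA i)) Ll.
  have LCt u : `|(L \o linear_part (s i) t) u| <= 1 * `|u|.
    by apply: le_trans (LC _) _; rewrite (pi_norm (sA i)).
  have QtE u : Q (s i t u) = (L \o linear_part (s i) t) u + (L (s i t 0) + c).
    by rewrite /Q QE (affE (s i) t u) (linear_propD Ll) addrA.
  rewrite QtE zE -(avg_affine G_hausdorff mH _ df' lpt LCt cpt c0).
  apply: (avg_near G_hausdorff mH dfW) => [g|g [_ Wg]].
    by apply: cvgD; [exact: cLts|exact: cvg_cst].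
  rewrite -QtE -(affM (sA i)).
  have -> : (t * g = t * g * t^-1 * t)%g by rewrite -mulgA mulVg mulg1.
  by rewrite (affM (sA i)); apply: WP => //; exact: sS.
have Qt : `|Q (s i t 0) - Q 0| <= 1.
  by apply: le_trans (Qd _ _) _; rewrite subr0; exact: sS.
have Qxz : `|Q (val x i) - Q (val z i)| <= e / 6.
  exact: le_trans (Qd _ _) (ltW wzi).
have Qtxz : `|Q (s i t (val x i)) - Q (s i t (val z i))| <= e / 6.
  by apply: le_trans (Qd _ _) _; rewrite (aff_norm (sA i)) ltW.
have := dist_chain Qy Qtxz Qtz Qt Qz Qxz Qx; have -> : 6 * (e / 6) = e by field.
by rewrite [1 + _]addrC.
Qed.

End limit_point.

Section smoothed_space.
Implicit Types x y : banach_seq E.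

Lemma eqcP (t : forall i, G -> E i -> E i) x : eqc t x <-> forall e, 0 < e ->
  exists2 V : set G, nbhs (1%g : G) V & \forall i \near ultra_set U,
    forall g, V g -> `|t i g (val x i) - val x i| <= e.
Proof. by []. Qed.

Lemma eqc_add x y : eqc s x -> eqc pi y -> eqc s (banach_add x y).
Proof.
move=> /eqcP xeq /eqcP yeq; apply/eqcP => e e0.
have e20 : 0 < e / 2 by rewrite divr_gt0.
have [V nV xV] := xeq _ e20; have [W nW yW] := yeq _ e20.
exists (V `&` W); first exact: filterI.
apply: filterS (filterI xV yW) => i [xi yi] g [/xi xg /yi yg].
have -> : s i g (val (banach_add x y) i) - val (banach_add x y) i =
    (s i g (val x i) - val x i) + (linear_part (s i) g (val y i) - val y i).
  rewrite (affE (s i) g (val x i + val y i)) (linear_propD (pi_linear (sA i) g)).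
  rewrite (affE (s i) g (val x i)) [RHS]addrACA -opprD; congr (_ + _).
  exact: addrAC.
apply: le_trans (ler_normD _ _) _; rewrite [e]splitr; exact: lerD.
Qed.

Lemma eqc_sub x y : eqc s x -> eqc s y -> eqc pi (banach_add x (banach_scale (-1) y)).
Proof.
move=> /eqcP xeq /eqcP yeq; apply/eqcP => e e0.
have e20 : 0 < e / 2 by rewrite divr_gt0.
have [V nV xV] := xeq _ e20; have [W nW yW] := yeq _ e20.
exists (V `&` W); first exact: filterI.
apply: filterS (filterI xV yW) => i [xi yi] g [/xi xg /yi yg].
have -> : val (banach_add x (banach_scale (-1) y)) i = val x i - val y i.
  by rewrite /= scaleN1r.
rewrite -(aff_sub (sA i)).
have -> : forall a b c d : E i, a - b - (c - d) = (a - c) - (b - d).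
  by move=> a b c d; rewrite !opprD !opprK addrACA.
by apply: le_trans (ler_normB _ _) _; rewrite [e]splitr; exact: lerD.
Qed.

Lemma eqc_comb (l : R) x y : eqc pi x -> eqc pi y ->
  eqc pi (banach_add (banach_scale l x) y).
Proof.
move=> /eqcP xeq /eqcP yeq; apply/eqcP => e e0.
have l0 : 0 < `|l| + 1 by rewrite ltr_wpDl.
have e20 : 0 < e / 2 by rewrite divr_gt0.
have e30 : 0 < e / 2 / (`|l| + 1) by rewrite divr_gt0.
have [V nV xV] := xeq _ e30; have [W nW yW] := yeq _ e20.
exists (V `&` W); first exact: filterI.
apply: filterS (filterI xV yW) => i [xi yi] g [/xi xg /yi yg].
have -> : linear_part (s i) g (val (banach_add (banach_scale l x) y) i) -
    val (banach_add (banach_scale l x) y) i =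
    l *: (linear_part (s i) g (val x i) - val x i) +
    (linear_part (s i) g (val y i) - val y i).
  have -> : val (banach_add (banach_scale l x) y) i = l *: val x i + val y i by [].
  by rewrite (pi_linear (sA i)) opprD addrACA -scalerBr.
apply: le_trans (ler_normD _ _) _; rewrite [e]splitr lerD// normrZ.
apply: le_trans (ler_wpM2l (normr_ge0 l) xg) _.
rewrite mulrCA; apply: ler_piMr; first exact: ltW.
by rewrite ler_pdivrMr// mul1r lerDl.
Qed.

(** The norm of the linear orbit of x i is constant in g, so the translation estimate
    for f applies to all i at once. *)
Lemma smoothed_vector_eqc y : smoothed_vectors m pi (cls y) -> eqc pi y.
Proof.
move=> [f [x [z [[cf ccf] fz yz]]]].
apply: (eqc_ext pi_action yz); apply/eqcP => e e0.
have ccsf : continuous_compact_support f.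
  by split => //; exists (closure [set g | f g != 0]) => // g fg; exact: subset_closure.
have [M xM] := banach_seqP x.
have M0 : 0 < `|M| + 1 by rewrite ltr_wpDl.
have eM0 : 0 < e / (`|M| + 1) by rewrite divr_gt0.
have [V nV VP] := bint_translate_close G_hausdorff mH S_compact S_nbhs ccsf eM0.
exists V => //; apply: nearW => i g Vg.
have cpi : continuous (fun g => linear_part (s i) g (val x i)).
  exact: (repr_strongly_continuous (linear_part_representation (sA i))).
have cfx := ccsZ ccsf cpi.
have -> : val z i = bint m (fun g => f g *: linear_part (s i) g (val x i)).
  exact: (bint_uniq G_hausdorff mH cfx (fz i)).
rewrite -(bint_linear G_hausdorff mH (C := 1) (pi_linear (sA i) g) _
  (@pi_continuous _ _ _ _ (sA i) g) cfx); last first.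
  by move=> u; rewrite (pi_norm (sA i)) mul1r.
have := VP g Vg (E i) (fun h => linear_part (s i) h (val x i)) (`|M| + 1) cpi (ltW M0).
rewrite divfK ?gt_eqF// => VPg.
rewrite (_ : linear_part (s i) g \o _ =
    fun h => f h *: linear_part (s i) (g * h)%g (val x i)).
  apply: VPg => h _; rewrite (pi_norm (sA i)) (le_trans (xM i))//.
  by rewrite (le_trans (ler_norm M))// lerDl.
apply/funext => h /=; rewrite (linear_propZ (pi_linear (sA i) g)).
by rewrite (reprM (linear_part_representation (sA i))).
Qed.

Lemma closed_span_eqc x : closed_span (smoothed_vectors m pi) (cls x) -> eqc pi x.
Proof.
pose W : set F := [set a | forall y, a = cls y -> eqc pi y].
suff Wsub : closed_subspace W.
  move=> /(_ W Wsub) Wx; apply: Wx => // a sa y aE.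
  by apply: smoothed_vector_eqc; rewrite -aE.
split.
- move=> a Wa y aE; apply: (eqc_limit pi_action) => e e0.
  have [b [Wb ab]] := Wa _ (nbhsx_ballx a e e0).
  have [z bE] := banach_reprK b; exists z; first exact: Wb.
  by rewrite -aE -bE; move: ab; rewrite -ball_normE.
- move=> y y0; apply/eqcP => e e0; exists setT; first exact: filterT.
  have : `|cls y - cls (banach_scale 0 y)| < e / 2.
    by rewrite -banach_classZ scale0r subr0 -y0 normr0 divr_gt0.
  move=> /banach_class_lt; apply: filterS => i /= yi g _.
  move: yi; rewrite scale0r subr0 => yi.
  apply: le_trans (ler_normB _ _) _; rewrite (pi_norm (sA i)).
  by rewrite [e]splitr lerD// ltW.
- move=> l a b Wa Wb y yE; have [[xa aE] [xb bE]] := (banach_reprK a, banach_reprK b).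
  apply: (@eqc_ext pi y (banach_add (banach_scale l xa) xb) pi_action).
    by rewrite -yE aE bE banach_classZ banach_classD.
  by apply: eqc_comb; [exact: Wa|exact: Wb].
Qed.

(** An equicontinuous vector is the limit of its averages over small neighbourhoods,
    uniformly in the index i. *)
Lemma eqc_closed_span x : eqc pi x -> closed_span (smoothed_vectors m pi) (cls x).
Proof.
move=> /eqcP xeq W Wsub sW; have [clW _ _] := Wsub.
apply: clW => B /nbhs_ballP[e e0 eB].
have e20 : 0 < e / 2 by rewrite divr_gt0.
have [V nV xV] := xeq _ e20.
have [f df] := density_exists G_hausdorff mH S_compact S_nbhs G_locally_compact nV.
have [M xM] := banach_seqP x.
have cf := density_ccs df.
have cpi i : continuous (fun g => linear_part (s i) g (val x i)).
  exact: (repr_strongly_continuous (linear_part_representation (sA i))).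
have yM : exists M, forall i, `|bint m (fun g => f g *: linear_part (s i) g (val x i))| <= M.
  exists M => i; rewrite -[X in `|X|]subr0; apply: (avg_near G_hausdorff mH df (@cpi i)).
  by move=> g _; rewrite subr0 (pi_norm (sA i)).
exists (cls (to_banach_seq yM)); split.
  apply: sW; exists f, x, (to_banach_seq yM); split => //.
    split; first exact: cf.1.
    have [_ [K cK fK]] := cf.
    apply: (subclosed_compact _ cK); first exact: closed_closure.
    have -> : K = closure K by apply/closure_id; exact: compact_closed.
    exact: closure_subset.
  by move=> i; apply: (bintP G_hausdorff mH); exact: ccsZ.
apply: eB; rewrite -ball_normE/=.
apply: (@le_lt_trans _ _ (e / 2)); last by rewrite gtr_pMr// invf_lt1// ltr1n.
apply: banach_class_le; apply: filterS xV => i xi; rewrite distrC.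
exact: (pi_average_near G_hausdorff mH (sA i) df).
Qed.

End smoothed_space.

Section smoothed_action.
Local Notation W := (smoothed_ultraproduct U m pi).
Context (w : F).
Hypothesis w_limit : forall V e, nbhs (1%g : G) V -> 0 < e ->
  exists2 a, smoothings V a & `|w - a| < e.
Hypothesis low : forall i (y : E i), `|y| <= i%:R ->
  exists2 h, S h & 1 - i.+1%:R^-1 <= `|s i h y - y|.

(** Since w is equicontinuous, w plus the span of the smoothed vectors is the set of
    equicontinuous points for s, hence invariant under the limit action. *)
Definition span_translate (x : W) : F := w + closed_span_val x.

Lemma span_translate_eqc (x : W) (u : banach_seq E) : span_translate x = cls u ->
  eqc s u.
Proof.
move=> xu; have [y wy] := banach_reprK w.
have [z xz] := banach_reprK (closed_span_val x : F).
apply: (@eqc_ext s u (banach_add y z) (fun i => aff_action (sA i))).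
  by rewrite -xu /span_translate wy xz banach_classD.
apply: eqc_add; first exact: (limit_point_eqc w_limit).
by apply: closed_span_eqc; rewrite -xz; apply/asboolP; exact: closed_span_valP.
Qed.

Lemma span_translate_act g (x : W) : exists y : W,
  span_translate y = limit_act g (span_translate x).
Proof.
have [u xu] := banach_reprK (span_translate x); have [v wv] := banach_reprK w.
have [z zE zi] := limit_actE g u.
have zeq : eqc s z.
  move=> e /(equicontinuous_act (fun i => aff_action (sA i)) g (span_translate_eqc xu))[V nV uV].
  by exists V => //; apply: filterS uV => i ui h /ui; rewrite zi.
have sp : limit_act g (span_translate x) - w \in
    closed_span_pred (smoothed_vectors m pi).
  apply/asboolP; rewrite xu zE wv -scaleN1r banach_classZ banach_classD.
  by apply: eqc_closed_span; apply: eqc_sub zeq _; exact: (limit_point_eqc w_limit).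
by exists (ClosedSpan sp); rewrite /span_translate/= addrC subrK.
Qed.

Lemma span_translate_dist (x y : W) : `|span_translate x - span_translate y| =
  @mdist R (normed_metric W) x y.
Proof.
rewrite normed_mdistE; have -> : `|x - y| = `|closed_span_val (x - y)| by [].
by rewrite /span_translate opprD addrACA subrr add0r.
Qed.

Lemma smoothed_action : exists (t : G -> normed_metric W -> normed_metric W)
    (v : normed_metric W),
  [/\ continuous_isometric_action t, forall h, S h -> mdist (t h v) v <= 1 &
      forall x e, 0 < e -> exists2 h, S h & 1 - e <= mdist (t h x) x].
Proof.
have /choice[t' tE] : forall gx : G * W, exists y : W,
    span_translate y = limit_act gx.1 (span_translate gx.2).
  by move=> [g x]; exact: span_translate_act.
pose t g (x : normed_metric W) : normed_metric W := t' (g, x : W).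
have dE (x y : normed_metric W) : mdist x y = `|span_translate x - span_translate y|.
  by rewrite span_translate_dist.
have tjE g x : span_translate (t g x) = limit_act g (span_translate x) by exact: (tE (g, x)).
have jI (x y : normed_metric W) : span_translate x = span_translate y -> x = y.
  by move=> xy; apply: mdist_positivity; rewrite dE xy subrr normr0.
have [l1 lM lD] := limit_act_isometric.
exists t, (0 : W); split.
- apply: orbit_continuous_action.
    split=> [x|g h x|g x y].
    + by apply: jI; rewrite tjE; exact: l1.
    + by apply: jI; rewrite !tjE; exact: lM.
    + by rewrite !dE !tjE limit_act_norm.
  move=> x e e0; have [u xu] := banach_reprK (span_translate x).
  have [V nV uV] := (eqcP s u).1 (span_translate_eqc xu) _ e0.
  apply: filterS nV => g Vg; rewrite dE tjE xu.
  have [z -> zi] := limit_actE g u; apply: banach_class_le.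
  by apply: filterS uV => i ui; rewrite zi; exact: ui.
- move=> h Sh; rewrite dE tjE /span_translate/=.
  rewrite (_ : w + _ = w); last exact: addr0.
  exact: (limit_point_displacement w_limit).
- move=> x e e0; have [u xu] := banach_reprK (span_translate x).
  have [|h Sh he] := @equicontinuous_displacement R U G (fun i => normed_metric (E i))
    (fun i => (0 : E i)) s (fun i => aff_action (sA i)) orbit_bounded S u S_compact
    _ (span_translate_eqc xu) e e0.
    move=> i y; rewrite normed_mdistE subr0 => /low[h Sh hy]; exists h => //; exact: hy.
  exists h => //; rewrite dE tjE xu; have [z zE zi] := limit_actE h u.
  by rewrite zE banach_class_dist -zE; exact: he.
Qed.

End smoothed_action.

End banach_limit.

(** * Actions without fixed points *)

Section rescaled_action.
Context (R : realType) (G : topologicalGroupType) (E : completeNormedModType R).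
Context (s : G -> normed_metric E -> normed_metric E) (v : E) (t : {posnum R}).
Hypothesis sA : continuous_isometric_action s.

(** The base point v is moved to 0, where Banach ultraproducts have theirs. *)
Definition recentered : G -> scaled_banach t E -> scaled_banach t E :=
  fun g x => (s g ((x : E) + v) : E) - v.

Lemma recentered_affine : uniquely_geodesic (normed_metric E) ->
  affine_isometric_action recentered.
Proof.
move=> Egeo; have iA := cont_isometric_action sA.
have dE := @normed_mdistE R E.
have nE (a : scaled_banach t E) : `|a| = t%:num * `|a : E| by [].
split.
- split=> [x|g h x|g x y].
  + by rewrite /recentered (iact1 iA) addrK.
  + by rewrite /recentered (iactM iA) subrK.
  + rewrite !normed_mdistE !nE /recentered; congr (_ * _).
    transitivity `|(s g ((x : E) + v) : E) - (s g ((y : E) + v) : E)|.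
      by rewrite opprB addrA subrK.
    by rewrite -dE iact_dist// dE opprD addrACA subrr addr0.
- move=> x g; apply/cvgrPdist_lt => e e0.
  have et0 : 0 < e / t%:num by rewrite divr_gt0.
  have sc : \forall h \near g, ball (s g ((x : E) + v)) (e / t%:num) (s h ((x : E) + v)).
    exact: (orbit_map_continuous sA (nbhsx_ballx (s g ((x : E) + v)) _ et0)).
  apply: filterS sc => h; rewrite /= ballEmdist/= dE ltr_pdivlMr// mulrC => sgh.
  rewrite nE /recentered; apply: le_lt_trans sgh; rewrite ler_pM2l//.
  by rewrite opprB addrA subrK.
- move=> g.
  have Tiso (x y : E) : `|(s g (x + v) - v : E) - (s g (y + v) - v : E)| = `|x - y|.
    transitivity (@mdist R (normed_metric E) (s g (x + v)) (s g (y + v))).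
      by rewrite dE opprB addrA subrK.
    by rewrite iact_dist// dE opprD addrACA subrr addr0.
  exact: (@isometry_affine R E (fun x => s g (x + v) - v : E) Egeo Tiso).
Qed.

End rescaled_action.

Lemma growth_conclusion (R : realType) (G : topologicalGroupType) (S : set G)
    (E : metricType R) (t : G -> E -> E) (v : E) (p c : R) :
  S 1%g -> symmetric_set S -> generates S -> 0 < p -> 0 < c ->
  uniformly_convex p c E -> isometric_action t ->
  (forall h, S h -> mdist (t h v) v <= 1) ->
  (forall x e, 0 < e -> exists2 h, S h & 1 - e <= mdist (t h x) x) ->
  0 < displacement S t v 1 /\ forall n : nat, (1 <= n)%N ->
    (2^-1 * (c * (n%:R - 1) + 1) `^ p^-1 - 2) * displacement S t v 1
      <= displacement S t v n.
Proof.
move=> S1 SV Sgen p0 c0 Econv tA v1 low.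
have D1 : displacement S t v 1 = 1.
  exact: (displacement1 S1 SV Sgen tA v1 low).
rewrite D1; split=> // n n1; rewrite mulr1.
have := displacement_growth S1 SV Sgen tA p0 c0 Econv v1 low n1; lra.
Qed.

Theorem theorem2 (R : realType) (U : free_ultrafilter)
    (G : topologicalGroupType)
    (G_hausdorff : hausdorff_space G)
    (G_locally_compact : locally_compact [set: G])
    (S : set G) (S_compact : compact S) (S_nbhs : nbhs (1%g : G) S)
    (S_symmetric : symmetric_set S) (S_generates : generates S)
    (X : metricType R -> Prop) (X_not_F : ~ property_F G X)
    (p c : R) (p_ge2 : 2 <= p) (c_gt0 : 0 < c)
    (X_cond :
      [/\ forall A : set G, open A,
          forall E, X E -> uniformly_convex p c E,
          metric_stable_scaling X &
          metric_stable_ultraproducts U X]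
      \/
      exists B : completeNormedModType R -> Prop,
        [/\ X = metric_class B,
            forall E, B E -> uniformly_convex p c (normed_metric E),
            banach_stable_scaling B,
            banach_stable_ultraproducts U B &
            banach_stable_smoothing G U B]) :
  exists (F : metricType R) (sigma : G -> F -> F) (v : F),
    [/\ X F, continuous_isometric_action sigma,
        0 < displacement S sigma v 1 &
        forall n : nat, (1 <= n)%N ->
          (2^-1 * (c * (n%:R - 1) + 1) `^ p^-1 - 2) * displacement S sigma v 1
            <= displacement S sigma v n].
Proof.
have p_gt0 : 0 < p by lra.
have S1 : S 1%g by exact: nbhs_singleton.
apply: contrapT => none; apply: X_not_F => E s XE Einh sA.
apply: contrapT => nofix; apply: none.
have iA := cont_isometric_action sA.
case: X_cond => [[G_discrete Xconv Xscale Xultra]|[B [XB Bconv Bscale Bultra Bsmooth]]].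
- have [[Ecomplete _] _] := Xconv _ XE.
  have /choice[vt vtP] : forall n : nat, exists vt : E * {posnum R},
      (forall h, S h -> vt.2%:num * mdist (s h vt.1) vt.1 <= 1) /\
      forall x, vt.2%:num * mdist x vt.1 <= n%:R ->
        exists2 h, S h & 1 - n.+1%:R^-1 <= vt.2%:num * mdist (s h x) x.
    move=> n; have [v [t vtP]] := almost_minimal_point S_compact S1 S_generates sA
      n Ecomplete Einh nofix.
    by exists (v, t).
  pose En n : metricType R := scaled_metric (vt n).2 E.
  pose vn n : En n := (vt n).1.
  pose sn n : G -> En n -> En n := s.
  have dE n (x y : En n) : mdist x y = (vt n).2%:num * @mdist R E x y by [].
  have snA n : isometric_action (sn n).
    split; [exact: (iact1 iA)|exact: (iactM iA)|].
    by move=> g x y; rewrite !dE (iact_dist iA).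
  have vn1 n h : S h -> mdist (sn n h (vn n)) (vn n) <= 1 by exact: (vtP n).1.
  have sv g : exists b, forall n, mdist (sn n g (vn n)) (vn n) <= b.
    have [k Sg] := set_pow_total S_symmetric S_generates g.
    by exists (k%:R * 1) => n; exact: (mdist_set_pow (snA n) (vn1 n) Sg).
  have XL : X (ultraproduct U vn) by apply: Xultra => n; exact: Xscale.
  have tA := ultra_act_isometric U snA sv.
  have nbhs1 : nbhs (1%g : G) [set 1%g].
    by apply: open_nbhs_nbhs; split => //; exact: G_discrete.
  exists (ultraproduct U vn), (ultra_act (U := U) snA sv).
  have vP : exists M : R, forall i, mdist (vn i) (vn i) <= M.
    by exists 0 => i; rewrite mdistxx.
  pose v : bounded_seq vn := BoundedSeq vP.
  exists (ultra_class U v).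
  have [|x e e0|D1 Dn] := growth_conclusion S1 S_symmetric S_generates p_gt0 c_gt0
    (Xconv _ XL) tA (v := ultra_class U v).
  + move=> h Sh; rewrite ultra_actE; apply: ultraproduct_le.
    by apply: nearW => n; exact: vn1.
  + rewrite -(ultra_reprK x).
    apply: (@equicontinuous_displacement R U G En vn sn snA sv S (ultra_repr x) S_compact) => //.
      by move=> n y; exact: (vtP n).2.
    move=> d d0; exists [set 1%g] => //; apply: nearW => n g ->.
    by rewrite (iact1 (snA n)) mdistxx ltW.
  split=> //; apply: orbit_continuous_action => // x e e0.
  by apply: filterS nbhs1 => g ->; rewrite (iact1 tA) mdistxx ltW.
subst X; case: XE => E0 BE0 EE; subst E.
have [Egeo _] := Bconv _ BE0; have [Ecomplete _] := Egeo.
have /choice[vt vtP] : forall n : nat, exists vt : E0 * {posnum R},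
    (forall h, S h -> vt.2%:num * @mdist R (normed_metric E0) (s h vt.1) vt.1 <= 1) /\
    forall x, vt.2%:num * @mdist R (normed_metric E0) x vt.1 <= n%:R ->
      exists2 h, S h & 1 - n.+1%:R^-1 <= vt.2%:num * mdist (s h x) x.
  move=> n; have [v [t vtP]] := almost_minimal_point S_compact S1 S_generates sA
    n Ecomplete Einh nofix.
  by exists (v, t).
pose En n := scaled_banach (vt n).2 E0.
pose sn n := recentered s (vt n).1 (t := (vt n).2).
have snA n : affine_isometric_action (sn n) by exact: recentered_affine.
have BEn n : B (En n) by exact: Bscale.
have sn1 n h : S h -> `|sn n h 0| <= 1.
  move=> Sh; have := (vtP n).1 h Sh.
  by rewrite /sn /recentered add0r.
have low n (y : En n) : `|y| <= n%:R ->
    exists2 h, S h & 1 - n.+1%:R^-1 <= `|sn n h y - y|.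
  move=> yn; have [|h Sh hy] := (vtP n).2 ((y : E0) + (vt n).1).
    by rewrite normed_mdistE addrK.
  exists h => //; apply: le_trans hy _.
  have -> : `|sn n h y - y| = (vt n).2%:num *
    `|(s h ((y : E0) + (vt n).1) : E0) - (vt n).1 - (y : E0)| by [].
  by rewrite -addrA -opprD [(vt n).1 + _]addrC.
case: Bsmooth => m mH Bsmooth.
have BW := Bsmooth En (fun n => linear_part (sn n)) BEn
  (fun n => linear_part_representation (snA n)).
have [w w_limit] := smoothings_limit (s := sn) G_hausdorff G_locally_compact mH
  S_compact S_nbhs snA sn1 p_gt0 c_gt0 (Bconv _ (Bultra _ BEn)).
have [t [v [tA v1 tlow]]] := smoothed_action G_hausdorff G_locally_compact mH
  S_compact S_nbhs S_symmetric S_generates snA sn1 w_limit low.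
exists (normed_metric (smoothed_ultraproduct U m (fun n => linear_part (sn n)))), t, v.
have [D1 Dn] := growth_conclusion S1 S_symmetric S_generates p_gt0 c_gt0
  (Bconv _ BW) (cont_isometric_action tA) v1 tlow.
by split=> //; exists (smoothed_ultraproduct U m (fun n => linear_part (sn n))).
Qed.
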